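(* Let $f:\mathbb{D}\to\mathbb{D}$ be an inner function with $f(0)=0$ that is not a rotation. Let $(b_n)_{n\ge 0}$ be a sequence of complex numbers such that, with $B_N:=\sum_{n=0}^{N-1}|b_n|^2$, as $N\to\infty$, $$B_N\to\infty\qquad\text{and}\qquad \frac{\max_{0\le n<N}|b_n|^2\,L(L(B_N))}{B_N}\to 0 .$$ Let $S_N^{(b)}(z)=\sum_{n=0}^{N-1}b_n\,T_f^n(z)$ and $\sigma_N^2(f)=\|S_N^{(b)}\|_{L^2(m)}^2$. Then, for $m$-almost every $z\in\mathbb{T}$, $$\mathrm{Cl}\left\{\frac{S_N^{(b)}(z)}{\sqrt{\sigma_N^2(f)\,L(L(\sigma_N^2(f)))}}:N\ge 1\right\}=\overline{\mathbb{D}} .$$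
   Context: $\mathbb{D}$ is the open unit disc in $\mathbb{C}$, $\overline{\mathbb{D}}$ the closed unit disc, $\mathbb{T}=\partial\mathbb{D}$ the unit circle, and $m$ the normalized Lebesgue measure on $\mathbb{T}$. An inner function is a bounded holomorphic function $f$ on $\mathbb{D}$ whose radial limits $\lim_{r\to1^-}f(r\zeta)$ have modulus one for $m$-a.e. $\zeta\in\mathbb{T}$. $T_f:\mathbb{T}\to\mathbb{T}$ denotes the boundary map, $T_f(\zeta)=\lim_{r\to1^-}f(r\zeta)$ (defined $m$-a.e.). $T_f^n$ denotes the $n$-fold composition of $T_f$ with itself, with $T_f^0(z)=z$. A rotation is a map $z\mapsto cz$ with $|c|=1$. $L(x):=\log(\max\{e,x\})$. For a sequence $(x_N)$ in $\mathbb{C}$, $\mathrm{Cl}\{x_N:N\ge1\}$ is the set of all its subsequential limits in $\mathbb{C}$ (the finitely many initial $N$ for which a denominator may vanish are irrelevant). With $\lambda=f'(0)$, the quantity $\sigma_N^2(f)=\|S_N^{(b)}\|_{L^2(m)}^2$ equals $\sum_{n=0}^{N-1}|b_n|^2+2\,\mathrm{Re}\sum_{k=1}^{N-1}\lambda^k\sum_{n=0}^{N-k-1}\overline{b_n}\,b_{n+k}$. *)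

(* Defs.v *)
From HB Require Import structures.
From mathcomp Require Import all_boot all_order all_algebra.
From mathcomp Require Import all_classical all_reals all_analysis.
From mathcomp Require Import complex.

Set Implicit Arguments.
Unset Strict Implicit.
Unset Printing Implicit Defensive.

Import Order.TTheory GRing.Theory Num.Theory.
Import numFieldNormedType.Exports.

Local Open Scope classical_set_scope.
Local Open Scope ring_scope.
Local Open Scope complex_scope.

(* R[i] with its modulus topology, as a normed space over itself, so that
   [derivable f z 1] is complex differentiability at z. *)
HB.instance Definition _ (R : realType) := NormedModule.copy R[i] R[i]^o.

HB.instance Definition _ (R : realType) :=
  Measurable.copy R[i] (g_sigma_algebraType (@open R[i])).

Section circle_measure.
Variable R : realType.

Definition circle_param (t : R) : R[i] :=
  cos (2 * pi * t) +i* sin (2 * pi * t).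

Lemma continuous_real_complex : continuous (fun x : R => x%:C).
Proof.
move=> x; apply/cvgrPdist_lt => -[e e'].
rewrite ltcE /= => /andP[/eqP -> e0].
near=> y; rewrite -rmorphB normc_def /= expr0n addr0 sqrtr_sqr ltcR.
near: y; exact: (@cvgr_dist_lt _ _ _ _ _ _ _ (@cvg_id _ (nbhs x))).
Unshelve. all: by end_near. Qed.

Lemma continuous_circle_param : continuous circle_param.
Proof.
have -> : circle_param = (fun t : R =>
    (cos (2 * pi * t))%:C + 'i * (sin (2 * pi * t))%:C).
  by apply/funext => t; rewrite /circle_param; simpc.
have lin : continuous (fun t : R => 2 * pi * t) by exact: mulrl_continuous.
have comp (g : R -> R) : continuous g ->
    continuous (fun t => (g (2 * pi * t))%:C).
  move=> cg t.
  apply: (@continuous_comp R R R[i] (fun t => g (2 * pi * t)) (fun x => x%:C)).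
    by apply: (@continuous_comp R R R); [exact: lin|exact: cg].
  exact: continuous_real_complex.
move=> t; apply: cvgD; [|apply: cvgMl_tmp].
  exact/comp/continuous_cos.
exact/comp/continuous_sin.
Qed.

Lemma measurable_circle_param :
  measurable_fun [set: measurableTypeR R] circle_param.
Proof.
apply: (@measurability _ _ _ _ _ _ (@open R[i])) => //.
move=> _ [U oU <-]; rewrite setTI; apply: measurable_realfun.open_measurable.
by move/continuousP: continuous_circle_param; exact.
Qed.

(* Normalized arc length on the unit circle, as a Borel measure on R[i]. *)
Definition circle_measure : set R[i] -> \bar R :=
  pushforward (mrestr (@lebesgue_measure R) (measurable_itv `[0, 1[%R))
    circle_param.

Let circle_measure0 : circle_measure set0 = 0%E.
Proof. by rewrite /circle_measure /pushforward preimage_set0 measure0. Qed.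

Let circle_measure_ge0 A : (0 <= circle_measure A)%E.
Proof. by rewrite /circle_measure /pushforward /mrestr outer_measure_ge0. Qed.

Let circle_measure_sigma_additive : semi_sigma_additive circle_measure.
Proof.
suff pushforward_additive (mu : {measure set (measurableTypeR R) -> \bar R})
    (X : {mfun measurableTypeR R >-> R[i]}) :
    semi_sigma_additive (pushforward mu X).
  pose X : {mfun measurableTypeR R >-> R[i]} := HB.pack circle_param
    (isMeasurableFun.Build _ _ (measurableTypeR R) R[i] circle_param
      measurable_circle_param).
  exact: (@pushforward_additive _ X).
exact: measure_semi_sigma_additive.
Qed.

HB.instance Definition _ := isMeasure.Build _ _ _ circle_measure
  circle_measure0 circle_measure_ge0 circle_measure_sigma_additive.

Let circle_measure_setT : circle_measure [set: R[i]] = 1%E.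
Proof.
rewrite /circle_measure /pushforward /mrestr preimage_setT setTI.
by rewrite lebesgue_measure_itv /= lte_fin ltr01 sube0.
Qed.

HB.instance Definition _ := Measure_isProbability.Build _ _ _ circle_measure
  circle_measure_setT.

End circle_measure.

Arguments circle_measure R : clear implicits.

Section inner_functions.
Variable R : realType.
Implicit Types (f : R[i] -> R[i]) (b : nat -> R[i]) (N : nat) (z : R[i]).

Definition modulus z : R := complex.Re `|z|.

Definition holomorphic_on_disc f := forall z, `|z| < 1 -> derivable f z 1.

(* Where the radial limit does not exist, [lim] is an arbitrary default; for
   an inner function this only happens on a null subset of the circle. *)
Definition boundary_map f z : R[i] :=
  lim (f (r%:C * z) @[r --> (1 : R)^'-]).

(* f stands for a function on the open unit disc: its other values are
   irrelevant. *)
Definition inner_function f :=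
  [/\ holomorphic_on_disc f,
      exists M : R, forall z, `|z| < 1 -> modulus (f z) <= M &
      {ae circle_measure R, forall z,
        cvg (f (r%:C * z) @[r --> (1 : R)^'-]) /\ `|boundary_map f z| = 1}].

Definition rotation f :=
  exists2 c : R[i], `|c| = 1 & forall z, `|z| < 1 -> f z = c * z.

Definition weighted_sum f b N z : R[i] :=
  \sum_(0 <= n < N) b n * iter n (boundary_map f) z.

Definition sigma2 f b N : R :=
  fine ('N[circle_measure R]_(2%:E)
    [(fun z => (modulus (weighted_sum f b N z))%:E)])%E ^+ 2.

Definition sqnorm_sum b N : R := \sum_(0 <= n < N) modulus (b n) ^+ 2.

(* The neutral element 0 is harmless since the terms are nonnegative. *)
Definition sqnorm_max b N : R :=
  \big[Num.max/0]_(0 <= n < N) modulus (b n) ^+ 2.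

Definition L (x : R) : R := ln (Num.max (expR 1) x).

End inner_functions.

Definition subsequential_limits (T : topologicalType) (u : nat -> T) : set T :=
  [set l | exists2 k : nat -> nat,
    {homo k : m n / (m < n)%N} & u (k n) @[n --> \oo] --> l].

(* Main.v *)
From HB Require Import structures.
Require Import Defs.
From mathcomp Require Import all_boot all_order all_algebra.
From mathcomp Require Import all_classical all_reals all_analysis.
From mathcomp Require Import complex.
From mathcomp Require Import measurable_realfun.
From mathcomp Require Import ring lra.

(** Write X for the identity of the circle, T for the boundary map, and E for
    the mean over the circle. For h holomorphic on the punctured disc, the mean
    of h over the circle of radius r does not depend on r. Apply this to h(z) =
    z^i f(z)^k and h(z) = z^(-i) f(z)^k whose limits at 0 exist for k >= i
    because f(0) = 0: letting r tend to 0 and to 1 identifies the mean of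
    X^(+-i) T^k with that limit. Since moments determine a bounded density on
    the circle, this says that T preserves the measure, that E(X | T) = l T, and
    that E(X^2 | T) = a T + l^2 T^2, where l and a are the conjugates of f'(0)
    and of the mean of X^(-2) T. As f is not a rotation, |l| < 1. The record
    circle_system collects these facts (inner_circle_system), and the
    probabilistic part relies on nothing else (circle_system_lil).

    Conditioning on the decreasing sigma-algebras generated by T^n turns the
    sums S_N into reversed martingales up to a small remainder. The contribution
    of the first m terms is E(S_m | T^m) = l c_m T^m, with c_0 = 0 and c_{n+1} =
    b_n + l c_n; the martingale differences have total variance A_N = (1 -
    |l|^2) (|c_1|^2 + ... + |c_N|^2), and the variance of S_N is A_N + |l
    c_N|^2. The hypotheses on b pass to c: A_N tends to infinity, and |c_n|^2
    LL(A_N) = o(A_N) uniformly in n <= N, so that the variance and A_N are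
    interchangeable in the normalisation.

    Expanding the exponential to second order one step at a time shows that,
    given T^(m+K), the linear form Re(u .) of the increment between the times m
    and m + K has an exponential moment close to that of a Gaussian variable,
    exp(|u|^2 (A_(m+K) - A_m) / 4), as long as |u c_n| is small (mgf_block). The
    smallness of the c_n allows |u|^2 to be of the order of LL(A_N) / A_N, which
    is the range of the law of the iterated logarithm.

    The upper half (lil_upper) follows from an exponential maximal inequality
    for the reversed martingale and the Borel-Cantelli lemma along levels where
    A grows geometrically: in every direction e, eventually Re(e S_N) <= (1 +
    eps) sqrt(A_N LL(A_N)). For the lower half (lil_lower), exponential tilting
    shows that the increment between two very distant levels hits the disc of
    radius eps around z, in this scale, with conditional probability at least of
    the order of exp(- (|z|^2 + 3 eps) LL(A_N)), which is not summable when
    |z|^2 + 3 eps <= 1; the conditioning makes the probabilities of successive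
    misses multiply, so hits recur almost surely. The half-planes of the upper
    half confine the limit points to the closed disc, and the lower half makes
    them dense in it (cluster_setE). *)

Unset Printing Implicit Defensive.

Import Order.TTheory GRing.Theory Num.Theory.
Import numFieldNormedType.Exports.

Local Open Scope classical_set_scope.
Local Open Scope ring_scope.
Local Open Scope complex_scope.

Local Notation Re := complex.Re.
Local Notation Im := complex.Im.

Set Implicit Arguments.
Unset Strict Implicit.

(** * Complex modulus and the truncated logarithm *)

Section modulus.
Variable R : realType.
Implicit Types z w : R[i].

Lemma modulusE z : modulus z = Num.sqrt (Re z ^+ 2 + Im z ^+ 2).
Proof. by rewrite /modulus normc_def. Qed.

Lemma normE z : `|z| = (modulus z)%:C.
Proof. by rewrite /modulus normc_def. Qed.

Lemma modulus_ge0 z : 0 <= modulus z.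
Proof. by rewrite modulusE sqrtr_ge0. Qed.

Lemma modulus_sqr z : modulus z ^+ 2 = Re z ^+ 2 + Im z ^+ 2.
Proof. by rewrite modulusE sqr_sqrtr// addr_ge0// sqr_ge0. Qed.

Lemma modulusM z w : modulus (z * w) = modulus z * modulus w.
Proof. by rewrite {1}/modulus normrM !normE -rmorphM. Qed.

Lemma modulusD z w : modulus (z + w) <= modulus z + modulus w.
Proof. by rewrite -lecR rmorphD /= -!normE ler_normD. Qed.

Lemma modulusN z : modulus (- z) = modulus z.
Proof. by rewrite /modulus normrN. Qed.

Lemma modulusB z w : modulus (z - w) <= modulus z + modulus w.
Proof. by rewrite -[in leRHS](modulusN w) modulusD. Qed.

Lemma modulus_distC z w : modulus (z - w) = modulus (w - z).
Proof. by rewrite -modulusN opprB. Qed.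

Lemma modulusX z n : modulus (z ^+ n) = modulus z ^+ n.
Proof.
elim: n => [|n IH]; last by rewrite !exprS modulusM IH.
by rewrite !expr0 /modulus normr1.
Qed.

Lemma modulus0 : modulus (0 : R[i]) = 0.
Proof. by rewrite /modulus normr0. Qed.

Lemma modulus1 : modulus (1 : R[i]) = 1.
Proof. by rewrite /modulus normr1. Qed.

Lemma modulus_eq0 z : modulus z = 0 -> z = 0.
Proof. by move=> h; apply/eqP; rewrite -normr_eq0 normE h. Qed.

Lemma modulusV z : modulus z^-1 = (modulus z)^-1.
Proof.
have [->|z0] := eqVneq z 0; first by rewrite invr0 modulus0 invr0.
have m0 : modulus z != 0 by apply: contra_neq z0 => /modulus_eq0.
by apply: (mulIf m0); rewrite mulVf// -modulusM mulVf// modulus1.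
Qed.

Lemma modulus_conj z : modulus z^* = modulus z.
Proof. by rewrite !modulusE /=; case: z => a b /=; rewrite sqrrN. Qed.

Lemma modulusC (x : R) : modulus x%:C = `|x|.
Proof. by rewrite modulusE /= expr0n addr0 sqrtr_sqr. Qed.

Lemma Re_le_modulus z : `|Re z| <= modulus z.
Proof. by rewrite -sqrtr_sqr modulusE ler_wsqrtr// lerDl sqr_ge0. Qed.

Lemma Im_le_modulus z : `|Im z| <= modulus z.
Proof. by rewrite -sqrtr_sqr modulusE ler_wsqrtr// lerDr sqr_ge0. Qed.

Lemma ReleM z : Re z <= modulus z.
Proof. exact: le_trans (ler_norm _) (Re_le_modulus z). Qed.

Lemma modulus_le_ReIm z : modulus z <= `|Re z| + `|Im z|.
Proof.
rewrite -(@ler_pXn2r _ 2)// ?nnegrE ?modulus_ge0 ?addr_ge0//.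
rewrite modulus_sqr sqrrD !real_normK ?num_real//.
by rewrite addrAC lerDl mulrn_wge0// mulr_ge0.
Qed.

Lemma norm_le1 z : (`|z| <= 1) = (modulus z <= 1).
Proof. by rewrite normE -(rmorph1 (real_complex R)) lecR. Qed.

Lemma norm_lt1 z : (`|z| < 1) = (modulus z < 1).
Proof. by rewrite normE -(rmorph1 (real_complex R)) ltcR. Qed.

Lemma norm_eq1 z : (`|z| = 1) <-> (modulus z = 1).
Proof. by split=> [h|h]; rewrite ?normE ?h// /modulus h. Qed.

Lemma Re_add z w : Re (z + w) = Re z + Re w. Proof. by case: z; case: w. Qed.
Lemma Re_opp z : Re (- z) = - Re z. Proof. by case: z. Qed.
Lemma Re_sub z w : Re (z - w) = Re z - Re w. Proof. by rewrite Re_add Re_opp. Qed.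
Lemma Re_mul z w : Re (z * w) = Re z * Re w - Im z * Im w.
Proof. by case: z; case: w. Qed.
Lemma Im_add z w : Im (z + w) = Im z + Im w. Proof. by case: z; case: w. Qed.
Lemma Im_opp z : Im (- z) = - Im z. Proof. by case: z. Qed.
Lemma Im_sub z w : Im (z - w) = Im z - Im w. Proof. by rewrite Im_add Im_opp. Qed.
Lemma Im_mul z w : Im (z * w) = Re z * Im w + Im z * Re w.
Proof. by case: z; case: w. Qed.
Lemma Re_scale (x : R) z : Re (x%:C * z) = x * Re z.
Proof. by rewrite Re_mul /= mul0r subr0. Qed.
Lemma Re_conjc z : Re z^* = Re z. Proof. by case: z. Qed.
Lemma Im_conjc z : Im z^* = - Im z. Proof. by case: z. Qed.

Lemma ReRe_mul (a b : R[i]) : Re a * Re b = (1 / 2) * (Re (a * b) + Re (a * b^*)).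
Proof. by rewrite !Re_mul Re_conjc Im_conjc; field. Qed.

Lemma modulus_gt0_neq0 z : 0 < modulus z -> z != 0.
Proof. by apply: contraTneq => ->; rewrite modulus0 ltxx. Qed.

Lemma neq0_modulus_gt0 z : z != 0 -> 0 < modulus z.
Proof. by move=> z0; rewrite lt_def modulus_ge0 andbT; apply: contra z0 => /eqP/modulus_eq0 ->. Qed.

Lemma conj_unimodular z : modulus z = 1 -> z^* = z^-1.
Proof.
move=> z1; have z0 : z != 0 by apply: modulus_gt0_neq0; rewrite z1.
apply: (mulfI z0); rewrite mulfV//.
case: z z1 {z0} => x y /(congr1 (fun t => t ^+ 2)); rewrite modulus_sqr expr1n /= => xy1.
by apply/eqP; rewrite eq_complex /=; apply/andP; split; apply/eqP; [rewrite -xy1; ring|ring].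
Qed.

Lemma conj_mulJ v w : ((v * w^*%C)^*%C = v^*%C * w)%R.
Proof.
by case: v => a b; case: w => c d; apply/eqP; rewrite eq_complex /=; apply/andP; split; apply/eqP; ring.
Qed.

Lemma Re_mulNi w : Re (- 'i * w) = Im w.
Proof. by rewrite Re_mul /= oppr0 mul0r sub0r mulN1r opprK. Qed.

Lemma Re_pow2 z : Re z ^+ 2 = (modulus z ^+ 2 + Re (z ^+ 2)) / 2.
Proof. by rewrite modulus_sqr [z ^+ 2]expr2 Re_mul; lra. Qed.

End modulus.

Section iterated_log.
Variable R : realType.
Implicit Types x y : R.

Lemma exp_taylor1 x : `|x| <= 1 / 2 -> 0 <= expR x - 1 - x <= 2 * x ^+ 2.
Proof.
rewrite ler_norml => /andP[x1 x2]; apply/andP; split.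
  by have := expR_ge1Dx x; lra.
have := expR_ge1Dx (- x); rewrite expRN => h.
have e0 := expR_gt0 x.
have : (1 - x) * expR x <= 1.
  by rewrite -ler_pdivlMr// mul1r.
by nra.
Qed.

Lemma exp_taylor2 x : `|x| <= 1 / 2 ->
  `|expR x - 1 - x - x ^+ 2 / 2| <= 2 * `|x| ^+ 3.
Proof.
move=> hx.
pose phi (t : R) := expR t - 1 - t - t ^+ 2 / 2.
have dphi (t : R) : is_derive t 1 phi (expR t - 1 - t).
  rewrite /phi; apply: is_derive_eq.
  rewrite /= /GRing.scale /=; lra.
have cphi (i : interval R) : {within [set` i], continuous phi}.
  by apply: derivable_within_continuous => t _; have [] := dphi t.
have phi0 : phi 0 = 0 by rewrite /phi expR0; ring.
have [x0|x0|->] := ltgtP x 0; last 1 first.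
  by rewrite expR0 -[X in `|X|]/(1 - 1 - 0 - 0 ^+ 2 / 2) expr0n /= mul0r !subr0 subrr normr0 expr0n mulr0.
- have [c /andP[c1 c2] ec] := @MVT_segment _ phi _ x 0 (ltW x0) (fun t _ => dphi t) (cphi _).
  have hc : `|c| <= 1/2.
    by rewrite ler_norml; move: hx; rewrite ltr0_norm//; move: c1 c2; rewrite !bnd_simp; lra.
  have /andP[h1 h2] := exp_taylor1 hc.
  move: c1 c2; rewrite !bnd_simp => c1 c2.
  rewrite -[X in `|X|]/(phi x) -(subrK (phi 0) (phi x)) phi0 addr0 -normrN opprB -{1}phi0 ec.
  rewrite sub0r ger0_norm; last by nra.
  rewrite (ltr0_norm x0) -[_ ^+ 3]/(_ * ((- x) * (-x))).
  rewrite (mulrC _ (- x)) (mulrCA 2) ler_wpM2l//; first lra.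
  by apply: (le_trans h2); nra.
- have [c /andP[c1 c2] ec] := @MVT_segment _ phi _ 0 x (ltW x0) (fun t _ => dphi t) (cphi _).
  have hc : `|c| <= 1/2.
    by rewrite ler_norml; move: hx; rewrite gtr0_norm//; move: c1 c2; rewrite !bnd_simp; lra.
  have /andP[h1 h2] := exp_taylor1 hc.
  move: c1 c2; rewrite !bnd_simp => c1 c2.
  rewrite -[X in `|X|]/(phi x) -(subr0 (phi x)) -{1}phi0 ec.
  rewrite subr0 ger0_norm; last by nra.
  rewrite (gtr0_norm x0) -[_ ^+ 3]/(x * (x * x)).
  rewrite (mulrC _ x) (mulrCA 2) ler_wpM2l//; first lra.
  by apply: (le_trans h2); nra.
Qed.

Lemma L_ge1 x : 1 <= L x.
Proof.
rewrite /L -[leLHS](@expRK R) ler_ln ?posrE ?expR_gt0 ?lt_max ?expR_gt0//.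
by rewrite le_max lexx.
Qed.

Lemma L_gt0 x : 0 < L x.
Proof. exact: lt_le_trans ltr01 (L_ge1 x). Qed.

Lemma le_L x y : x <= y -> L x <= L y.
Proof.
move=> xy; rewrite /L ler_ln ?posrE ?lt_max ?expR_gt0//.
by rewrite ge_max le_max lexx /= le_max xy orbT.
Qed.

(** The concavity of the logarithm in the form ln (1 + h) <= h, together with L
    >= 1. Iterated, it makes LL insensitive to replacing a sequence by one
    comparable to it. *)
Lemma L_scale (x h : R) : 0 <= h -> L ((1 + h) * x) <= (1 + h) * L x.
Proof.
move=> h0; have m0 : 0 < Num.max (expR 1) x by rewrite lt_max expR_gt0.
have h1 : 0 < 1 + h by lra.
have le1 : Num.max (expR 1) ((1 + h) * x) <= (1 + h) * Num.max (expR 1) x.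
  rewrite ge_max; apply/andP; split.
    apply: (@le_trans _ _ (Num.max (expR 1) x)); first by rewrite le_max lexx.
    by rewrite ler_peMl// ?lerDl// ltW.
  by apply: ler_wpM2l; [exact: ltW|rewrite le_max lexx orbT].
rewrite /L; apply: (@le_trans _ _ (ln ((1 + h) * Num.max (expR 1) x))).
  by rewrite ler_ln ?posrE ?mulr_gt0 ?lt_max ?expR_gt0.
rewrite lnM ?posrE// mulrDl mul1r addrC lerD2l.
apply: (@le_trans _ _ h); first by have := ln_sublinear h1 ; have := le_ln1Dx (lt_le_trans (ltrN10 R) h0); lra.
by rewrite ler_peMr// (L_ge1 x).
Qed.

Lemma LL_scale (x h : R) : 0 <= h -> L (L ((1 + h) * x)) <= (1 + h) * L (L x).
Proof.
by move=> h0; apply: (le_trans _ (L_scale (L x) h0)); apply: le_L; exact: L_scale.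
Qed.

Lemma LE x : expR 1 <= x -> L x = ln x.
Proof. by move=> h; rewrite /L (max_idPr h). Qed.

Lemma LL_cvg_pinfty : (fun x : R => L (L x)) @ +oo --> +oo.
Proof.
apply/cvgryPge => M; near=> x.
have h1 : expR (expR M) <= x by near: x; apply: nbhs_pinfty_ge; rewrite num_real.
have p1 : 0 < Num.max (expR 1) x by rewrite lt_max expR_gt0.
have h2 : expR M <= L x.
  rewrite -[leLHS]expRK /L ler_ln ?posrE ?expR_gt0//.
  by rewrite le_max h1 orbT.
rewrite -[leLHS]expRK {1}/L ler_ln ?posrE ?expR_gt0 ?lt_max ?expR_gt0//.
by rewrite le_max h2 orbT.
Unshelve. all: by end_near. Qed.

End iterated_log.

(** * Means of bounded measurable functions *)

Section bounded_mean.
Context d (Om : measurableType d) (R : realType) (P : probability Om R).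
Implicit Types g h : Om -> R.

(** Bounded functions are integrable and stable under products and compositions,
    so that means can be manipulated without integrability side conditions. *)
Definition bmeas g :=
  measurable_fun setT g /\ exists M, forall w, `|g w| <= M.

Definition mean g : R := \int[P]_w g w.

Lemma bmeas_cst (c : R) : bmeas (cst c).
Proof. by split; [exact: measurable_cst|exists `|c|]. Qed.

Lemma bmeasD g h : bmeas g -> bmeas h -> bmeas (fun w => g w + h w).
Proof.
move=> [mg [M gM]] [mh [N hN]]; split; first exact: measurable_funD.
by exists (M + N) => w; apply: (le_trans (ler_normD _ _)); rewrite lerD.
Qed.

Lemma bmeasM g h : bmeas g -> bmeas h -> bmeas (fun w => g w * h w).
Proof.
move=> [mg [M gM]] [mh [N hN]]; split; first exact: measurable_funM.
by exists (M * N) => w; rewrite normrM ler_pM.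
Qed.

Lemma bmeasZ (c : R) g : bmeas g -> bmeas (fun w => c * g w).
Proof. exact: (bmeasM (bmeas_cst c)). Qed.

Lemma bmeasN g : bmeas g -> bmeas (fun w => - g w).
Proof.
by move=> /(bmeasZ (-1)); under eq_fun do rewrite mulN1r.
Qed.

Lemma bmeasB g h : bmeas g -> bmeas h -> bmeas (fun w => g w - h w).
Proof. by move=> bg /bmeasN; exact: bmeasD. Qed.

Lemma bmeas_sum (I : Type) (s : seq I) (F : I -> Om -> R) :
  (forall i, bmeas (F i)) -> bmeas (fun w => \sum_(i <- s) F i w).
Proof.
move=> bF; elim: s => [|i s IH].
  by under eq_fun do rewrite big_nil; exact: bmeas_cst.
by under eq_fun do rewrite big_cons; exact: bmeasD.
Qed.

Lemma bmeas_exp g : bmeas g -> bmeas (fun w => expR (g w)).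
Proof.
move=> [mg [M gM]]; split; first exact: measurableT_comp.
exists (expR M) => w; rewrite ger0_norm ?expR_ge0// ler_expR.
exact: le_trans (ler_norm _) (gM w).
Qed.

Lemma bmeas_indic (A : set Om) : measurable A -> bmeas (\1_A).
Proof.
move=> mA; split; first exact: measurable_indic.
by exists 1 => w; rewrite indicE; case: (_ \in _); rewrite ?normr1 ?normr0.
Qed.

Lemma bmeas_integrable g : bmeas g -> P.-integrable setT (EFin \o g).
Proof.
move=> [mg [M gM]]; apply: measurable_bounded_integrable => //.
  by apply: (@le_lt_trans _ _ 1%E); [exact: probability_le1|exact: ltry].
exists M; split; first by rewrite num_real.
by move=> x Mx w _ /=; apply: le_trans (gM w) (ltW Mx).
Qed.

Lemma meanD g h : bmeas g -> bmeas h ->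
  mean (fun w => g w + h w) = mean g + mean h.
Proof. by move=> bg bh; apply: RintegralD => //; exact: bmeas_integrable. Qed.

Lemma meanZ (c : R) g : bmeas g -> mean (fun w => c * g w) = c * mean g.
Proof. by move=> bg; apply: RintegralZl => //; exact: bmeas_integrable. Qed.

Lemma meanN g : bmeas g -> mean (fun w => - g w) = - mean g.
Proof.
move=> bg; rewrite -mulN1r -meanZ//; congr mean.
by apply/funext => w; rewrite mulN1r.
Qed.

Lemma meanB g h : bmeas g -> bmeas h ->
  mean (fun w => g w - h w) = mean g - mean h.
Proof. by move=> bg bh; rewrite meanD ?meanN//; exact: bmeasN. Qed.

Lemma mean_cst (c : R) : mean (cst c) = c.
Proof. rewrite /mean Rintegral_cst// (_ : fine _ = 1) ?mulr1//.
by rewrite -[RHS]/(fine 1%E); congr fine; exact: probability_setT. Qed.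

Lemma le_mean g h : bmeas g -> bmeas h -> (forall w, g w <= h w) ->
  mean g <= mean h.
Proof.
by move=> bg bh gh; apply: le_Rintegral => //; exact: bmeas_integrable.
Qed.

Lemma mean_ge0 g : (forall w, 0 <= g w) -> 0 <= mean g.
Proof. by move=> g0; apply: Rintegral_ge0. Qed.

Lemma mean_sum (I : Type) (s : seq I) (F : I -> Om -> R) :
  (forall i, bmeas (F i)) ->
  mean (fun w => \sum_(i <- s) F i w) = \sum_(i <- s) mean (F i).
Proof.
move=> bF; elim: s => [|i s IH].
  rewrite big_nil -[RHS]mean_cst; congr mean.
  by apply/funext => w; rewrite big_nil.
rewrite big_cons -IH -meanD//; last exact: bmeas_sum.
by congr mean; apply/funext => w; rewrite big_cons.
Qed.

Lemma eq_mean g h : g =1 h -> mean g = mean h.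
Proof. by move=> /funext ->. Qed.

Lemma mean_indic (A : set Om) : measurable A -> P A = (mean (\1_A))%:E.
Proof.
move=> mA; rewrite /mean /Rintegral integral_indic// setIT fineK//.
exact: fin_num_measure.
Qed.

Lemma eq_mean_ae g h : bmeas g -> bmeas h ->
  {ae P, forall w, g w = h w} -> mean g = mean h.
Proof.
move=> bg bh gh; congr fine; apply: ae_eq_integral => //.
- by apply/measurable_EFinP; case: bg.
- by apply/measurable_EFinP; case: bh.
- by apply: filterS gh => w + _ /=; move=> ->.
Qed.

End bounded_mean.

Lemma bmeas_comp {R : realType} {d d'} {Om : measurableType d} {Om' : measurableType d'}
    (T : Om -> Om') (g : Om' -> R) :
  measurable_fun setT T -> bmeas g -> bmeas (fun w => g (T w)).
Proof.
move=> mT [mg [M gM]]; split; last by exists M.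
exact: measurableT_comp mg mT.
Qed.

(** * Circle systems and their one-step exponential moments *)

Section circle_system.
Context d (Om : measurableType d) (R : realType) (P : probability Om R).
Variables (T : Om -> Om) (X : Om -> R[i]) (l a : R[i]).
Implicit Types (g : Om -> R) (v : R[i]).
Local Notation E := (mean P).

(** A measure preserving T and a unimodular X with E(X | T) = l (X o T) and
    E(X^2 | T) = a (X o T) + l^2 (X^2 o T). The conditional expectations are
    stated through test functions g(T); invariance of the mean removes the
    composition with T from the right-hand sides. The direction v replaces
    complex-valued means by real ones. *)
Record circle_system : Prop := CircleSystem {
  csT : measurable_fun setT T;
  csRe : measurable_fun setT (fun w => Re (X w));
  csIm : measurable_fun setT (fun w => Im (X w));
  csX : forall w, modulus (X w) = 1;
  csl : modulus l < 1;
  csa : modulus a <= 1;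
  csE0 : forall g, bmeas g -> E (fun w => g (T w)) = E g;
  csE1 : forall g v, bmeas g ->
    E (fun w => Re (v * X w) * g (T w)) = E (fun w => Re (v * (l * X w)) * g w);
  csE2 : forall g v, bmeas g ->
    E (fun w => Re (v * X w ^+ 2) * g (T w)) =
    E (fun w => Re (v * (a * X w + l ^+ 2 * X w ^+ 2)) * g w) }.

Hypothesis cs : circle_system.

Lemma bmeas_ReX v : bmeas (fun w => Re (v * X w)).
Proof.
split; last first.
  by exists (modulus v) => w; rewrite (le_trans (Re_le_modulus _))// modulusM csX// mulr1.
under eq_fun do rewrite Re_mul.
by apply: measurable_funB; apply: measurable_funM => //;
  [exact: csRe|exact: csIm].
Qed.

Lemma bmeas_iter n g : bmeas g -> bmeas (fun w => g (iter n T w)).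
Proof.
elim: n g => [//|n IH] g bg.
under eq_fun do rewrite iterSr.
exact: (bmeas_comp (csT cs) (IH _ bg)).
Qed.

Lemma measurable_iter n : measurable_fun setT (fun w => iter n T w).
Proof.
elim: n => [|n IH]; first exact: measurable_id.
under eq_fun do rewrite iterS.
exact: measurableT_comp (csT cs) IH.
Qed.

Lemma mean_iter n g : bmeas g -> E (fun w => g (iter n T w)) = E g.
Proof.
elim: n g => [//|n IH] g bg.
under eq_mean do rewrite iterS.
by rewrite (IH (fun w => g (T w)))// ?csE0//; exact: bmeas_comp (csT cs) bg.
Qed.

(** The conditional variance of X given T. *)
Definition kap : R := 1 - modulus l ^+ 2.

Lemma kap_gt0 : 0 < kap.
Proof. by rewrite subr_gt0 expr_lt1// ?modulus_ge0//; exact: csl. Qed.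

Lemma kap_le1 : kap <= 1.
Proof. by rewrite gerDl oppr_le0 sqr_ge0. Qed.

(** The square of Re (v X) is (|v|^2 + Re (v^2 X^2)) / 2 because X is
    unimodular: up to third order the exponential is affine in X and X^2, the
    two powers whose conditional expectations are known. *)
Lemma exp_step v w : modulus v <= 1 / 4 ->
  `|expR (Re (v * X w)) -
    (1 + modulus v ^+ 2 / 4 + Re (v * X w) + Re (v ^+ 2 * X w ^+ 2) / 4)|
  <= 2 * modulus v ^+ 3.
Proof.
move=> hv; set x := Re _.
have hx : `|x| <= modulus v.
  by rewrite (le_trans (Re_le_modulus _))// modulusM csX// mulr1.
have -> : 1 + modulus v ^+ 2 / 4 + x + Re (v ^+ 2 * X w ^+ 2) / 4 =
          1 + x + x ^+ 2 / 2.
  by rewrite /x (Re_pow2 (v * X w)) modulusM csX// mulr1 exprMn; lra.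
rewrite !opprD !addrA; apply: le_trans (exp_taylor2 _) _; first by lra.
by rewrite ler_pM2l// lerXn2r// nnegrE// modulus_ge0.
Qed.

(** The candidate for the conditional expectation of exp (Re (v X)), seen as a
    function of X o T, again as the exponential of a linear form. The square of
    Re (l v X) produces the l^2 X^2 term and the share |l|^2 |v|^2 / 4 of the
    variance; kap supplies the rest, and the a X term is of second order, so it
    moves into the coefficient of X. *)
Lemma exp_step_cond v w : modulus v <= 1 / 4 ->
  `|expR (kap / 4 * modulus v ^+ 2 + Re ((l * v + a * v ^+ 2 / 4) * X w)) -
    (1 + modulus v ^+ 2 / 4 + Re (v * (l * X w)) +
     Re (v ^+ 2 * (a * X w + l ^+ 2 * X w ^+ 2)) / 4)|
  <= 10 * modulus v ^+ 3.
Proof.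
move=> hv; set t := modulus v.
have t0 : 0 <= t := modulus_ge0 v.
pose p := Re (v * (l * X w)); pose r := Re (a * v ^+ 2 * X w) / 4.
pose h := r + kap / 4 * t ^+ 2.
have l1 : modulus l <= 1 by exact/ltW/csl.
have hp : `|p| <= t.
  rewrite (le_trans (Re_le_modulus _))// !modulusM csX// mulr1.
  by rewrite ler_piMr.
have hr : `|r| <= t ^+ 2 / 4.
  rewrite /r normrM (ger0_norm (_ : 0 <= 4^-1))// ler_pM2r ?invr_gt0//.
  rewrite (le_trans (Re_le_modulus _))// !modulusM csX// mulr1 -/t -expr2.
  by rewrite ler_piMl// ?sqr_ge0// csa.
have hh : `|h| <= t ^+ 2 / 2.
  rewrite (le_trans (ler_normD _ _))// (_ : t ^+ 2 / 2 = t ^+ 2 / 4 + t ^+ 2 / 4); last by lra.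
  rewrite lerD// normrM ger0_norm; last by rewrite divr_ge0// ltW// kap_gt0.
  rewrite ger0_norm ?sqr_ge0//; have := kap_le1; have := sqr_ge0 t; nra.
have -> : kap / 4 * t ^+ 2 + Re ((l * v + a * v ^+ 2 / 4) * X w) = p + h.
  have -> : (l * v + a * v ^+ 2 / 4) * X w =
      v * (l * X w) + (4^-1)%:C * (a * v ^+ 2 * X w).
    by rewrite fmorphV rmorph_nat; ring.
  by rewrite Re_add Re_scale /p /h /r; lra.
have -> : 1 + t ^+ 2 / 4 + p +
   Re (v ^+ 2 * (a * X w + l ^+ 2 * X w ^+ 2)) / 4 = 1 + p + p ^+ 2 / 2 + h.
  have -> : v ^+ 2 * (a * X w + l ^+ 2 * X w ^+ 2) =
      a * v ^+ 2 * X w + (v * (l * X w)) ^+ 2 by ring.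
  rewrite Re_add /p (Re_pow2 (v * (l * X w))) modulusM (modulusM l) csX// mulr1.
  by rewrite exprMn -/t /h /r /kap; lra.
have hy : `|p + h| <= 9 / 8 * t.
  rewrite (le_trans (ler_normD _ _))//; nra.
have hy2 : `|p + h| <= 1 / 2 by lra.
have ht := exp_taylor2 hy2.
have hy3 : `|p + h| ^+ 3 <= (9 / 8 * t) ^+ 3.
  by rewrite lerXn2r// nnegrE//; nra.
have e1 : `|p * h + h ^+ 2 / 2| <= t ^+ 3.
  rewrite (le_trans (ler_normD _ _))// normrM normrM normrX (ger0_norm (_ : 0 <= 2^-1))//.
  have : `|p| * `|h| <= t * (t ^+ 2 / 2) by rewrite ler_pM.
  have : `|h| ^+ 2 <= (t ^+ 2 / 2) ^+ 2.
    by rewrite lerXn2r// nnegrE//; nra.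
  have : t ^+ 4 <= t ^+ 3 * (1 / 4) by rewrite exprSr ler_wpM2l// exprn_ge0.
  have : 0 <= t ^+ 3 by rewrite exprn_ge0.
  nra.
have -> : expR (p + h) - (1 + p + p ^+ 2 / 2 + h) =
   (expR (p + h) - 1 - (p + h) - (p + h) ^+ 2 / 2) + (p * h + h ^+ 2 / 2).
  by field.
rewrite (le_trans (ler_normD _ _))//.
have t3 : 0 <= t ^+ 3 by rewrite exprn_ge0.
have -> : 10 * t ^+ 3 = 9 * t ^+ 3 + t ^+ 3 by ring.
apply: lerD e1; apply: (le_trans ht).
apply: (@le_trans _ _ (2 * (9 / 8 * t) ^+ 3)); first by rewrite ler_pM2l.
by rewrite exprMn; nra.
Qed.

Lemma bmeas_ReX2 v : bmeas (fun w => Re (v * X w ^+ 2)).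
Proof.
under eq_fun do rewrite expr2 mulrA Re_mul.
have bI : bmeas (fun w => Im (X w)).
  split; first exact: csIm.
  by exists 1 => w; rewrite (le_trans (Im_le_modulus _))// csX.
have bR : bmeas (fun w => Re (X w)).
  split; first exact: csRe.
  by exists 1 => w; rewrite (le_trans (Re_le_modulus _))// csX.
apply: bmeasB; apply: bmeasM => //; first exact: bmeas_ReX.
under eq_fun do rewrite Im_mul.
by apply: bmeasD; exact: bmeasZ.
Qed.

Lemma step_mean v g : bmeas g ->
  E (fun w => (1 + modulus v ^+ 2 / 4 + Re (v * X w) +
     Re (v ^+ 2 * X w ^+ 2) / 4) * g (T w)) =
  E (fun w => (1 + modulus v ^+ 2 / 4 + Re (v * (l * X w)) +
     Re (v ^+ 2 * (a * X w + l ^+ 2 * X w ^+ 2)) / 4) * g w).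
Proof.
move=> bg.
set k := 1 + _.
have bgT : bmeas (fun w => g (T w)) by exact: bmeas_comp (csT cs) bg.
have b1 : bmeas (fun w => Re (v * X w)) by exact: bmeas_ReX.
have b2 u := bmeas_ReX2 u.
have b3 : bmeas (fun w => Re (v * (l * X w))).
  by under eq_fun do rewrite mulrA; exact: bmeas_ReX.
have b4 : bmeas (fun w => Re (v ^+ 2 * (a * X w + l ^+ 2 * X w ^+ 2))).
  under eq_fun do rewrite mulrDr Re_add 2!mulrA.
  by apply: bmeasD; [exact: bmeas_ReX|exact: b2].
have split3 (f1 f2 h : Om -> R) : bmeas f1 -> bmeas f2 -> bmeas h ->
    E (fun w => (k + f1 w + f2 w / 4) * h w) =
    k * E h + E (fun w => f1 w * h w) + 4^-1 * E (fun w => f2 w * h w).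
  move=> bf1 bf2 bh; transitivity
    (E (fun w => k * h w + f1 w * h w + 4^-1 * (f2 w * h w))).
    by apply: eq_mean => w; lra.
  by rewrite !meanD ?meanZ//; repeat first [assumption|apply: bmeasD|apply: bmeasM|exact: bmeas_cst].
by rewrite !split3// (csE0 cs)// (csE1 cs)// (csE2 cs).
Qed.

Lemma bmeas_expReX v g : bmeas g -> bmeas (fun w => expR (Re (v * X w)) * g w).
Proof. by apply: bmeasM; apply: bmeas_exp; exact: bmeas_ReX. Qed.

(** The affine parts of both exponentials have equal means against g, by the two
    conditional expectations; only the third order errors remain. *)
Lemma step_approx v g : modulus v <= 1 / 4 -> bmeas g -> (forall w, 0 <= g w) ->
  `|E (fun w => expR (Re (v * X w)) * g (T w)) -
    E (fun w => expR (kap / 4 * modulus v ^+ 2 +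
      Re ((l * v + a * v ^+ 2 / 4) * X w)) * g w)| <= 12 * modulus v ^+ 3 * E g.
Proof.
move=> hv bg g0.
set t := modulus v.
have bgT : bmeas (fun w => g (T w)) by exact: bmeas_comp (csT cs) bg.
have c1 := 12 * t ^+ 3.
pose A w := 1 + t ^+ 2 / 4 + Re (v * X w) + Re (v ^+ 2 * X w ^+ 2) / 4.
pose B w := 1 + t ^+ 2 / 4 + Re (v * (l * X w)) +
     Re (v ^+ 2 * (a * X w + l ^+ 2 * X w ^+ 2)) / 4.
have bA : bmeas A.
  rewrite /A; apply: bmeasD.
    by apply: bmeasD; [exact: bmeas_cst|exact: bmeas_ReX].
  under eq_fun do rewrite mulrC; apply: bmeasZ; exact: bmeas_ReX2.
have bB : bmeas B.
  rewrite /B; apply: bmeasD.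
    apply: bmeasD; first exact: bmeas_cst.
    by under eq_fun do rewrite mulrA; exact: bmeas_ReX.
  under eq_fun do rewrite mulrC mulrDr Re_add 2!mulrA.
  by apply/bmeasZ/bmeasD; [exact: bmeas_ReX|exact: bmeas_ReX2].
have be1 : bmeas (fun w => expR (Re (v * X w))) by exact/bmeas_exp/bmeas_ReX.
set f2 := fun w => expR (kap / 4 * t ^+ 2 + Re ((l * v + a * v ^+ 2 / 4) * X w)).
have be2 : bmeas f2.
  by apply: bmeas_exp; apply: bmeasD; [exact: bmeas_cst|exact: bmeas_ReX].
have E1 : `|E (fun w => expR (Re (v * X w)) * g (T w)) - E (fun w => A w * g (T w))|
   <= 2 * t ^+ 3 * E g.
  rewrite -meanB; [|exact: bmeasM..].
  rewrite -(csE0 cs bg) -meanZ//.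
  rewrite ler_norml -meanN; last exact: bmeasZ.
  apply/andP; split; (apply: le_mean;
     [by repeat first [apply: bmeasN|apply: bmeasB|apply: bmeasM|assumption|exact: bmeas_cst]
     |by repeat first [apply: bmeasN|apply: bmeasB|apply: bmeasM|assumption|exact: bmeas_cst]|move=> w]).
    rewrite -mulNr -mulrBl ler_wpM2r//.
    by have := exp_step w hv; rewrite ler_norml => /andP[].
  rewrite -mulrBl ler_wpM2r//.
  by have := exp_step w hv; rewrite ler_norml => /andP[].
have E2 : `|E (fun w => B w * g w) - E (fun w => f2 w * g w)| <= 10 * t ^+ 3 * E g.
  rewrite distrC -meanB; [|exact: bmeasM..].
  rewrite -meanZ//.
  rewrite ler_norml -meanN; last exact: bmeasZ.
  apply/andP; split; (apply: le_mean;
     [by repeat first [apply: bmeasN|apply: bmeasB|apply: bmeasM|assumption|exact: bmeas_cst]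
     |by repeat first [apply: bmeasN|apply: bmeasB|apply: bmeasM|assumption|exact: bmeas_cst]|move=> w]).
    rewrite -mulNr -mulrBl ler_wpM2r//.
    by have := exp_step_cond w hv; rewrite ler_norml => /andP[].
  rewrite -mulrBl ler_wpM2r//.
  by have := exp_step_cond w hv; rewrite ler_norml => /andP[].
rewrite -[X in `|X|](subrKA (E (fun w => A w * g (T w)))).
apply: le_trans (ler_normD _ _) _.
have EA : E (fun w => A w * g (T w)) = E (fun w => B w * g w) := step_mean v bg.
rewrite -EA in E2.
rewrite (_ : 12 * _ * _ = 2 * t ^+ 3 * E g + 10 * t ^+ 3 * E g); last by ring.
exact: lerD.
Qed.

Section step_bounds.
Variables (v : R[i]) (g : Om -> R).
Hypotheses (hv : modulus v <= 1 / 4) (bg : bmeas g) (g0 : forall w, 0 <= g w).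
Let t := modulus v.
Let y w := kap / 4 * t ^+ 2 + Re ((l * v + a * v ^+ 2 / 4) * X w).

Let t0 : 0 <= t. Proof. exact: modulus_ge0. Qed.
Let t3 : t ^+ 3 <= 1 / 64.
Proof.
apply: (@le_trans _ _ ((1 / 4) ^+ 3)); first by rewrite lerXn2r// nnegrE.
by rewrite expr_div_n expr1n; lra.
Qed.
Let t30 : 0 <= t ^+ 3. Proof. by rewrite exprn_ge0. Qed.

(* This lower bound turns the additive error of step_approx into a factor. *)
Let y_ge w : 1 / 2 <= expR (y w).
Proof.
have h1 := expR_ge1Dx (y w); suff : - (1 / 2) <= y w by lra.
have kk : 0 <= kap / 4 * t ^+ 2.
  by rewrite mulr_ge0 ?sqr_ge0// divr_ge0// ltW// kap_gt0.
suff : `|Re ((l * v + a * v ^+ 2 / 4) * X w)| <= 1 / 2.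
  by rewrite ler_norml /y => /andP[+ _]; lra.
have four : (4 : R[i]) = (4 : R)%:C by rewrite rmorph_nat.
rewrite (le_trans (Re_le_modulus _))// modulusM csX// mulr1.
rewrite (le_trans (modulusD _ _))// !modulusM modulusV four modulusC -/t -expr2.
rewrite ger0_norm//.
have : modulus l * t <= t by rewrite ler_piMl// ltW// csl.
have : modulus a * t ^+ 2 <= t ^+ 2 by rewrite ler_piMl ?sqr_ge0// csa.
by move: hv t0; rewrite -/t => h1' h2' h3' h4'; nra.
Qed.

Let meanY : E (fun w => expR (y w) * g w) =
  expR (kap / 4 * t ^+ 2) *
    E (fun w => expR (Re ((l * v + a * v ^+ 2 / 4) * X w)) * g w).
Proof.
rewrite -meanZ; last exact: bmeas_expReX.
by apply: eq_mean => w; rewrite /y expRD mulrA.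
Qed.

Let Yge : E g <= 2 * E (fun w => expR (y w) * g w).
Proof.
have b : bmeas (fun w => expR (y w) * g w).
  apply: bmeasM => //; apply/bmeas_exp/bmeasD; first exact: bmeas_cst.
  exact: bmeas_ReX.
rewrite -meanZ//; apply: le_mean => //; first exact: bmeasZ.
move=> w; rewrite mulrA ler_peMl//; have := y_ge w; lra.
Qed.

Let Eg0 : 0 <= E g. Proof. exact: mean_ge0. Qed.

Lemma step_upper :
  E (fun w => expR (Re (v * X w)) * g (T w)) <=
  expR (kap / 4 * modulus v ^+ 2 + 48 * modulus v ^+ 3) *
    E (fun w => expR (Re ((l * v + a * v ^+ 2 / 4) * X w)) * g w).
Proof.
rewrite -/t addrC expRD -mulrA -meanY.
have := step_approx hv bg g0; rewrite -/t -/(y _) ler_norml => /andP[_].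
move: Yge Eg0; set A := E g; set Y := E (fun w => expR (y w) * _) => Yge' A0.
have Y0 : 0 <= Y by lra.
have := expR_ge1Dx (48 * t ^+ 3) => he h.
apply: (@le_trans _ _ ((1 + 48 * t ^+ 3) * Y)); last by rewrite ler_wpM2r.
have := ler_wpM2l t30 Yge'; have := mulr_ge0 t30 Y0; lra.
Qed.

Lemma step_lower :
  expR (kap / 4 * modulus v ^+ 2 - 48 * modulus v ^+ 3) *
    E (fun w => expR (Re ((l * v + a * v ^+ 2 / 4) * X w)) * g w) <=
  E (fun w => expR (Re (v * X w)) * g (T w)).
Proof.
rewrite -/t addrC expRD -mulrA -meanY.
have := step_approx hv bg g0; rewrite -/t -/(y _) ler_norml => /andP[+ _].
move: Yge Eg0; set A := E g; set Y := E (fun w => expR (y w) * _) => Yge' A0.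
have Y0 : 0 <= Y by lra.
move=> h.
have he : expR (- (48 * t ^+ 3)) <= 1 - 24 * t ^+ 3.
  have p1 : 0 < 1 - 24 * t ^+ 3 by move: t3; generalize (t ^+ 3) => s h1; lra.
  rewrite expRN -[leRHS]invrK lef_pV2 ?posrE ?expR_gt0 ?invr_gt0//.
  apply: (le_trans _ (expR_ge1Dx (48 * t ^+ 3))).
  rewrite -div1r ler_pdivrMr//; move: t3 t30.
  by generalize (t ^+ 3) => s h1 h2; nra.
apply: (@le_trans _ _ ((1 - 24 * t ^+ 3) * Y)); first by rewrite ler_wpM2r.
have := ler_wpM2l t30 Yge'; lra.
Qed.

End step_bounds.

End circle_system.

(** * Exponential moments of orbit sums *)

Section block_mgf.
Context d (Om : measurableType d) (R : realType) (P : probability Om R).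
Variables (T : Om -> Om) (X : Om -> R[i]) (l a : R[i]).
Hypothesis cs : circle_system P T X l a.
Implicit Types (g : Om -> R) (p v u : R[i]) (ws : seq R[i]) (dl : R).
Local Notation E := (mean P).
Local Notation kap := (kap l).

(** The sum of b_j X(T^j w) over the list of the b_j, defined by recursion on
    the list because one step of conditioning removes the head and applies T to
    the rest. *)
Fixpoint wsum ws (w : Om) : R[i] :=
  if ws is b :: ws' then b * X w + wsum ws' (T w) else 0.

(** When the head is conditioned out, the coefficient b + p of X becomes the
    coefficient l (b + p) of X o T. The argument p is the coefficient inherited
    from the earlier steps. *)
Fixpoint chain_energy p ws : R :=
  if ws is b :: ws' then modulus (b + p) ^+ 2 + chain_energy (l * (b + p)) ws'
  else 0.

Fixpoint chain_le dl p ws : Prop :=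
  if ws is b :: ws' then modulus (b + p) <= dl /\ chain_le dl (l * (b + p)) ws'
  else True.

Lemma wsum_sum ws w : wsum ws w = \sum_(0 <= j < size ws) ws`_j * X (iter j T w).
Proof.
elim: ws w => [|b ws IH] w /=; first by rewrite big_nil.
by rewrite big_nat_recl//= IH; congr (_ + _); apply: eq_bigr => i _; rewrite -iterSr.
Qed.

Lemma bmeas_wsum v ws : bmeas (fun w => Re (v * wsum ws w)).
Proof.
elim: ws => [|b ws IH] /=.
  by under eq_fun do rewrite mulr0; exact: bmeas_cst.
under eq_fun do rewrite mulrDr Re_add mulrA.
by apply: bmeasD; [exact: (bmeas_ReX cs)|exact: (bmeas_comp (csT cs) IH)].
Qed.

Let r := 1 - modulus l.
Let r0 : 0 < r. Proof. by rewrite subr_gt0 (csl cs). Qed.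
Let r1 : r <= 1. Proof. by rewrite gerBl modulus_ge0. Qed.
(* The price of an error of size e in the coefficient is K dl e. One step
   multiplies e by |l| = 1 - r, so K r, and not K, must dominate the absolute
   constants. *)
Let K := 200 / r.
Let Kr : K * r = 200. Proof. by rewrite /K divfK// gt_eqF. Qed.
Let K0 : 200 <= K. Proof. by rewrite /K ler_pdivlMr// ler_piMr. Qed.

Let k4 : 0 <= kap / 4.
Proof. by rewrite divr_ge0// ltW// (kap_gt0 cs). Qed.

(** One step changes the coefficient c + e into l c + e', where the new error e'
    is the contracted old one plus the a-term of second order. The contraction
    of e releases K r dl |e|, which pays for replacing |c + e| by |c| in the
    variance; the rest is absorbed by a small multiple of |c|^2. *)
Lemma chain_step dl (c e : R[i]) : 0 < dl -> dl <= r / 8 ->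
  modulus c <= dl -> modulus e <= dl ->
  let v := c + e in
  let e' := l * e + a * v ^+ 2 / 4 in
  [/\ modulus v <= 1 / 4, modulus e' <= dl &
   kap / 4 * `|modulus v ^+ 2 - modulus c ^+ 2| + 48 * modulus v ^+ 3
     + K * dl * modulus e' <= K * dl * modulus c ^+ 2 + K * dl * modulus e].
Proof.
move=> dl0 dlr hc he v e'; have r1' := r1; have K0' := K0.
set s := modulus c in hc *; set t := modulus e in he *; set q := modulus v.
have [s0 t0 q0] : [/\ 0 <= s, 0 <= t & 0 <= q] by split; exact: modulus_ge0.
have qst : q <= s + t := modulusD c e.
have sqt : s <= q + t.
  by rewrite /s (_ : c = v - e) ?modulusB// /v addrK.
have qd : q <= 2 * dl by lra.
have l1 := csl cs.
have he' : modulus e' <= modulus l * t + q ^+ 2 / 4.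
  rewrite /e' (le_trans (modulusD _ _))// !modulusM modulusV lerD//.
  have -> : modulus (4 : R[i]) = 4.
    by rewrite -(rmorph_nat (real_complex R)) modulusC ger0_norm.
  by rewrite ler_pM2r ?invr_gt0// -expr2 ler_piMl ?sqr_ge0// (csa cs).
have D : `|q ^+ 2 - s ^+ 2| <= 3 * dl * t.
  rewrite subr_sqr normrM (ger0_norm (_ : 0 <= q + s)) ?addr_ge0// mulrC.
  have : `|q - s| <= t by rewrite ler_norml; apply/andP; split; lra.
  move=> h; rewrite ler_pM// ?addr_ge0//; lra.
have q2 : q ^+ 2 <= s ^+ 2 + 3 * dl * t.
  by move: D; rewrite ler_norml => /andP[_]; lra.
have rle : r <= 1 by [].
have hl : modulus l = 1 - r by rewrite /r; lra.
split; first lra.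
- apply: (le_trans he'); rewrite hl.
  have : (1 - r) * t <= (1 - r) * dl by rewrite ler_wpM2l//; lra.
  have : q ^+ 2 <= 2 * dl * (2 * dl) by rewrite expr2 ler_pM.
  have : dl * dl <= r / 8 * dl by rewrite ler_wpM2r// ltW.
  have : 0 <= r * dl by rewrite mulr_ge0 ?ltW.
  lra.
have dt0 : 0 <= dl * t by rewrite mulr_ge0// ltW.
have ds0 : 0 <= dl * s ^+ 2 by rewrite mulr_ge0 ?sqr_ge0// ltW.
have p1 : kap / 4 * `|q ^+ 2 - s ^+ 2| <= dl * t.
  apply: (@le_trans _ _ (4^-1 * (3 * dl * t))); last by lra.
  by apply: ler_pM => //; rewrite -[leRHS]mul1r ler_pM2r// kap_le1.
have p2 : 48 * q ^+ 3 <= 96 * (dl * s ^+ 2) + 48 * (dl * t).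
  have h1 : q ^+ 3 <= 2 * dl * (s ^+ 2 + 3 * dl * t).
    by rewrite exprS ler_pM ?sqr_ge0.
  have h2 : dl * (dl * t) <= 8^-1 * (dl * t) by rewrite ler_wpM2r//; lra.
  lra.
have p3 : K * dl * modulus e' <=
    K * (1 - r / 2) * (dl * t) + K * (dl * s ^+ 2) / 4.
  have h1 : modulus e' <= (1 - r / 2) * t + s ^+ 2 / 4.
    apply: (le_trans he'); rewrite hl.
    have h2 : dl * t <= r / 8 * t by rewrite ler_wpM2r.
    have : 0 <= r * t by rewrite mulr_ge0 // ltW.
    lra.
  have Kd0 : 0 <= K * dl by rewrite mulr_ge0 ?ltW//; lra.
  by have := ler_wpM2l Kd0 h1; lra.
have p4 : K * (1 - r / 2) * (dl * t) = K * (dl * t) - 100 * (dl * t).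
  rewrite (_ : K * (1 - r / 2) = K - K * r / 2); last by ring.
  by rewrite Kr; lra.
have p5 : 200 * (dl * s ^+ 2) <= K * (dl * s ^+ 2) by rewrite ler_wpM2r.
lra.
Qed.

Section mgf.
Variable dl : R.
Hypotheses (dl0 : 0 < dl) (dlr : dl <= r / 8).

Let Gfun ws g w := expR (Re (wsum ws w)) * g (iter (size ws) T w).

Let bG ws g : bmeas g -> bmeas (Gfun ws g).
Proof.
move=> bg; apply: bmeasM; last exact: (bmeas_iter cs).
apply: bmeas_exp; have := bmeas_wsum 1 ws.
by under eq_fun do rewrite mul1r.
Qed.

Let G0 ws g : (forall w, 0 <= g w) -> forall w, 0 <= Gfun ws g w.
Proof. by move=> g0 w; rewrite mulr_ge0// expR_ge0. Qed.

Let GE u ws g : (fun w => expR (Re (u * X w + wsum ws w)) * g (iter (size ws) T w)) =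
  (fun w => expR (Re (u * X w)) * Gfun ws g w).
Proof. by apply/funext => w; rewrite Re_add expRD -mulrA. Qed.

Let Gcons u b ws g :
  (fun w => expR (Re (u * X w + wsum (b :: ws) w)) * g (iter (size (b :: ws)) T w)) =
  (fun w => expR (Re ((b + u) * X w)) * Gfun ws g (T w)).
Proof.
apply/funext => w; rewrite /Gfun -iterSr mulrA -expRD -Re_add /=.
by congr (expR (Re _) * _); ring.
Qed.

Let Vb p e w : modulus p <= dl -> modulus e <= dl ->
  - (2 * dl) <= Re ((p + e) * X w) <= 2 * dl.
Proof.
move=> hp he; rewrite -ler_norml (le_trans (Re_le_modulus _))// modulusM (csX cs) mulr1.
by rewrite (le_trans (modulusD _ _))//; lra.
Qed.

Let Kdl0 : 0 <= K * dl. Proof. by rewrite mulr_ge0 ?ltW//; have := K0; lra. Qed.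

(** Induction on the list: condition out the head with step_upper, and let
    chain_step account for the error coefficient e. The terminal factor exp (Re
    ((p + e) X)) costs 2 dl. *)
Lemma mgf_upper ws p e g : modulus p <= dl -> modulus e <= dl ->
  chain_le dl p ws -> bmeas g -> (forall w, 0 <= g w) ->
  E (fun w => expR (Re ((p + e) * X w + wsum ws w)) * g (iter (size ws) T w)) <=
  expR ((kap / 4 + K * dl) * chain_energy p ws + K * dl * modulus e + 2 * dl) * E g.
Proof.
move=> + + + bg g0; elim: ws p e => [|b ws IH] p e hp he.
  move=> _ /=; rewrite -meanZ//; apply: le_mean => [| |w].
  - under eq_fun do rewrite addr0.
    exact: (bmeas_expReX cs).
  - exact: bmeasZ.
  - rewrite addr0 ler_wpM2r// ler_expR.
    have /andP[_] := Vb w hp he.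
    have : 0 <= K * dl * modulus e by rewrite mulr_ge0 ?modulus_ge0.
    lra.
move=> [hc hch]; rewrite Gcons (addrA b p e).
have [h1 h2 h3] := chain_step dl0 dlr hc he.
apply: (le_trans (step_upper cs h1 (bG ws bg) (G0 ws g0))).
set v := b + p + e in h1 h2 h3 *; set c := b + p in hc hch v h1 h2 h3 *.
have -> : l * v + a * v ^+ 2 / 4 = l * c + (l * e + a * v ^+ 2 / 4).
  by rewrite /v; ring.
rewrite -GE.
have hlc : modulus (l * c) <= dl.
  by rewrite modulusM (le_trans _ hc)// ler_piMl ?modulus_ge0// ltW// (csl cs).
apply: le_trans (ler_wpM2l (expR_ge0 _) (IH _ _ hlc h2 hch)) _.
rewrite mulrA -expRD ler_wpM2r ?mean_ge0// ler_expR /= -/c.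
have : kap / 4 * modulus v ^+ 2 <= kap / 4 * modulus c ^+ 2 +
    kap / 4 * `|modulus v ^+ 2 - modulus c ^+ 2|.
  rewrite -mulrDr ler_wpM2l//.
  by have := ler_norm (modulus v ^+ 2 - modulus c ^+ 2); lra.
lra.
Qed.

Lemma mgf_lower ws p e g : modulus p <= dl -> modulus e <= dl ->
  chain_le dl p ws -> bmeas g -> (forall w, 0 <= g w) ->
  expR ((kap / 4 - K * dl) * chain_energy p ws - K * dl * modulus e - 2 * dl) * E g <=
  E (fun w => expR (Re ((p + e) * X w + wsum ws w)) * g (iter (size ws) T w)).
Proof.
move=> + + + bg g0; elim: ws p e => [|b ws IH] p e hp he.
  move=> _ /=; rewrite -meanZ//; apply: le_mean => [| |w].
  - exact: bmeasZ.
  - under eq_fun do rewrite addr0.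
    exact: (bmeas_expReX cs).
  - rewrite addr0 ler_wpM2r// ler_expR.
    have /andP[+ _] := Vb w hp he.
    have : 0 <= K * dl * modulus e by rewrite mulr_ge0 ?modulus_ge0.
    lra.
move=> [hc hch]; rewrite Gcons (addrA b p e).
have [h1 h2 h3] := chain_step dl0 dlr hc he.
apply: (le_trans _ (step_lower cs h1 (bG ws bg) (G0 ws g0))).
set v := b + p + e in h1 h2 h3 *; set c := b + p in hc hch v h1 h2 h3 *.
have -> : l * v + a * v ^+ 2 / 4 = l * c + (l * e + a * v ^+ 2 / 4).
  by rewrite /v; ring.
rewrite -GE.
have hlc : modulus (l * c) <= dl.
  by rewrite modulusM (le_trans _ hc)// ler_piMl ?modulus_ge0// ltW// (csl cs).
apply: le_trans (ler_wpM2l (expR_ge0 _) (IH _ _ hlc h2 hch)).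
rewrite mulrA -expRD ler_wpM2r ?mean_ge0// ler_expR /= -/c.
have : kap / 4 * modulus c ^+ 2 <= kap / 4 * modulus v ^+ 2 +
    kap / 4 * `|modulus v ^+ 2 - modulus c ^+ 2|.
  rewrite -mulrDr ler_wpM2l//.
  by have := ler_norm (- (modulus v ^+ 2 - modulus c ^+ 2)); rewrite normrN; lra.
lra.
Qed.

End mgf.

End block_mgf.

(** * The innovation coefficients and their energy *)

Section innovations.
Variables (R : realType) (l : R[i]) (b : nat -> R[i]).
Hypothesis l1 : modulus l < 1.
Local Notation kap := (kap l).

(** l * cpre m is the coefficient of X o T^m in the conditional expectation of
    the first m terms of the orbit sum given T^m. *)
Fixpoint cpre (m : nat) : R[i] := if m is n.+1 then b n + l * cpre n else 0.

(** The total variance of the martingale differences, the n-th of them being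
    cpre n.+1 times (X o T^n) - l (X o T^(n+1)). *)
Definition energy (N : nat) : R :=
  kap * \sum_(0 <= n < N) modulus (cpre n.+1) ^+ 2.
Local Notation A := energy.
Local Notation B := (sqnorm_sum b).

Let r := 1 - modulus l.
Lemma gap_gt0 : 0 < r. Proof. by rewrite subr_gt0. Qed.
Lemma gap_le1 : r <= 1. Proof. by rewrite gerBl modulus_ge0. Qed.
Lemma kap_pos : 0 < kap.
Proof. by rewrite subr_gt0 expr_lt1// modulus_ge0. Qed.

Lemma energyS N : A N.+1 = A N + kap * modulus (cpre N.+1) ^+ 2.
Proof. by rewrite /A big_nat_recr//= mulrDr. Qed.

Lemma energy_ge0 N : 0 <= A N.
Proof. by rewrite mulr_ge0 ?(ltW kap_pos)// sumr_ge0// => i _; rewrite sqr_ge0. Qed.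

Lemma energy_nd m n : (m <= n)%N -> A m <= A n.
Proof.
move=> /subnK <-; elim: (n - m)%N => [//|k IH]; apply: (le_trans IH).
by rewrite addSn energyS lerDl mulr_ge0 ?sqr_ge0// ltW// kap_pos.
Qed.

Lemma energyD m K : A (m + K) - A m =
  kap * \sum_(m <= n < m + K) modulus (cpre n.+1) ^+ 2.
Proof.
by rewrite /A (@big_cat_nat _ _ _ m 0 (m + K))//= ?leq_addr// mulrDr addrAC subrr add0r.
Qed.

Lemma sqnorm_max_ge N n : (n < N)%N -> modulus (b n) ^+ 2 <= sqnorm_max b N.
Proof.
move=> nN; rewrite /sqnorm_max; apply: (@le_bigmax_seq _ _ _ (index_iota 0 N) 0 n xpredT
  (fun i => modulus (b i) ^+ 2)) => //.
by rewrite mem_index_iota.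
Qed.

Lemma sqnorm_max_ge0 N : 0 <= sqnorm_max b N.
Proof. exact: bigmax_ge_id. Qed.

(** The geometric series of ratio |l| has sum 1 / r. *)
Lemma cpre_le N n : (n <= N)%N ->
  modulus (cpre n) ^+ 2 <= sqnorm_max b N / r ^+ 2.
Proof.
move=> nN; set s := Num.sqrt (sqnorm_max b N).
have s2 : s ^+ 2 = sqnorm_max b N by rewrite sqr_sqrtr// sqnorm_max_ge0.
have r0 := gap_gt0.
have sr0 : 0 <= s / r by rewrite divr_ge0 ?sqrtr_ge0 ?(ltW r0).
rewrite -s2 -expr_div_n lerXn2r ?nnegrE ?modulus_ge0//.
elim: n nN => [_|n IH nN] /=.
  by rewrite modulus0.
rewrite (le_trans (modulusD _ _))// modulusM.
have hb : modulus (b n) <= s.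
  by rewrite -[leLHS](ger0_norm (modulus_ge0 _)) -sqrtr_sqr ler_wsqrtr// sqnorm_max_ge.
have hl : modulus l * modulus (cpre n) <= modulus l * (s / r).
  by rewrite ler_wpM2l ?modulus_ge0// IH// ltnW.
have -> : s / r = s + modulus l * (s / r).
  rewrite -{2}[s](divfK (lt0r_neq0 r0)) (_ : modulus l = 1 - r) ?/r; last by ring.
  by ring.
exact: lerD.
Qed.

(** By convexity |b_n + l c_n|^2 <= |b_n|^2 / r + |l| |c_n|^2, so the energy is
    controlled by the contraction factor; with the converse comparison below,
    the hypotheses on b carry over to the c_n. *)
Lemma energy_le_sqnorm N : A N <= kap / r ^+ 2 * B N.
Proof.
have r0 := gap_gt0; have r1 := gap_le1.
have hl : modulus l = 1 - r by rewrite /r; ring.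
rewrite /A -mulrA ler_pM2l ?kap_pos// mulrC ler_pdivlMr ?exprn_gt0//.
set C := \sum_(0 <= n < N) modulus (cpre n.+1) ^+ 2.
pose C' := \sum_(0 <= n < N) modulus (cpre n) ^+ 2.
have CC' : C' <= C.
  suff -> : C = C' + modulus (cpre N) ^+ 2 by rewrite lerDl sqr_ge0.
  rewrite /C /C'; elim: (N) => [|k IH]; first by rewrite !big_nil modulus0 expr0n addr0.
  by rewrite big_nat_recr//= IH big_nat_recr.
have main : r * C <= B N + r * modulus l * C'.
  rewrite /C /C' /sqnorm_sum !mulr_sumr -big_split/=.
  apply: ler_sum => n _.
  have h : modulus (b n + l * cpre n) <= modulus (b n) + modulus l * modulus (cpre n).
    by rewrite -modulusM modulusD.
  have h2 : modulus (b n + l * cpre n) ^+ 2 <=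
      (modulus (b n) + modulus l * modulus (cpre n)) ^+ 2.
    by rewrite lerXn2r// nnegrE ?addr_ge0 ?mulr_ge0 ?modulus_ge0.
  apply: (le_trans (ler_wpM2l (ltW r0) h2)); rewrite hl.
  move: (modulus (b n)) (modulus (cpre n)) => x y.
  rewrite -subr_ge0 (_ : _ - _ = (1 - r) * (x - r * y) ^+ 2); last by ring.
  by rewrite mulr_ge0 ?sqr_ge0// subr_ge0.
have : r * modulus l * C' <= r * modulus l * C.
  by rewrite ler_wpM2l// mulr_ge0 ?modulus_ge0 ?(ltW r0).
by rewrite hl in main *; move: main; nra.
Qed.

Lemma sqnorm_le_energy N : B N <= 4 / kap * A N.
Proof.
have k0 := kap_pos.
rewrite /A mulrA divfK ?gt_eqF//.
set C := \sum_(0 <= n < N) modulus (cpre n.+1) ^+ 2.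
pose C' := \sum_(0 <= n < N) modulus (cpre n) ^+ 2.
have CC' : C' <= C.
  suff -> : C = C' + modulus (cpre N) ^+ 2 by rewrite lerDl sqr_ge0.
  rewrite /C /C'; elim: (N) => [|k IH]; first by rewrite !big_nil modulus0 expr0n addr0.
  by rewrite big_nat_recr//= IH big_nat_recr.
have : B N <= 2 * C + 2 * C'.
  rewrite /C /C' /sqnorm_sum !mulr_sumr -big_split/=.
  apply: ler_sum => n _.
  have h : modulus (b n) <= modulus (b n + l * cpre n) + modulus (cpre n).
    rewrite -{1}[b n](addrK (l * cpre n)) (le_trans (modulusB _ _))// lerD2l.
    by rewrite modulusM ler_piMl ?modulus_ge0// ltW.
  have h2 : modulus (b n) ^+ 2 <= (modulus (b n + l * cpre n) + modulus (cpre n)) ^+ 2.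
    by rewrite lerXn2r// nnegrE ?addr_ge0 ?modulus_ge0.
  apply: (le_trans h2); move: (modulus _) (modulus (cpre n)) => x y.
  by rewrite -subr_ge0 (_ : _ - _ = (x - y) ^+ 2) ?sqr_ge0//; ring.
lra.
Qed.

Hypothesis B_infty : B N @[N --> \oo] --> +oo.
Hypothesis b_small : sqnorm_max b N * L (L (B N)) / B N @[N --> \oo] --> (0 : R).

Lemma energy_cvg : A N @[N --> \oo] --> +oo.
Proof.
apply/cvgryPge => M.
have k0 := kap_pos.
move/cvgryPge : B_infty => /(_ (4 / kap * M)); apply: filterS => N h.
have := le_trans h (sqnorm_le_energy N).
by rewrite ler_pM2l// divr_gt0.
Qed.

Lemma cpre_small (eta : R) : 0 < eta -> \forall N \near \oo,
  forall n, (n <= N)%N -> modulus (cpre n) ^+ 2 * L (L (A N)) <= eta * A N.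
Proof.
move=> eta0; have r0 := gap_gt0; have k0 := kap_pos.
pose h := kap / r ^+ 2.
have h0 : 0 < h by rewrite divr_gt0// exprn_gt0.
pose cst := (1 + h) / r ^+ 2 * (4 / kap).
have cst0 : 0 < cst by rewrite mulr_gt0// divr_gt0// ?exprn_gt0//; lra.
have e0 : 0 < eta / cst by rewrite divr_gt0.
near=> N => n nN.
have B0 : 0 < B N.
  have : 1 <= B N by near: N; move/cvgryPge : B_infty; exact.
  by apply: lt_le_trans.
have small : sqnorm_max b N * L (L (B N)) <= eta / cst * B N.
  rewrite -ler_pdivrMr//.
  have : `|0 - sqnorm_max b N * L (L (B N)) / B N| < eta / cst.
    by near: N; move/cvgrPdist_lt : b_small => /(_ _ e0).
  by rewrite sub0r normrN => /ltW; apply: le_trans; exact: ler_norm.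
have hLL : L (L (A N)) <= (1 + h) * L (L (B N)).
  apply: (le_trans _ (LL_scale (B N) (ltW h0))); apply/le_L/le_L.
  apply: (le_trans (energy_le_sqnorm N)); rewrite ler_pM2r// -/h; lra.
have : modulus (cpre n) ^+ 2 * L (L (A N)) <=
   sqnorm_max b N / r ^+ 2 * ((1 + h) * L (L (B N))).
  by rewrite ler_pM ?sqr_ge0 ?cpre_le// (ltW (L_gt0 _)).
move/le_trans; apply.
rewrite (_ : _ * _ = (1 + h) / r ^+ 2 * (sqnorm_max b N * L (L (B N)))); last by ring.
have p0 : 0 < (1 + h) / r ^+ 2 by rewrite divr_gt0// ?exprn_gt0//; lra.
apply: (@le_trans _ _ ((1 + h) / r ^+ 2 * (eta / cst * (4 / kap * A N)))).
  rewrite ler_pM2l//; apply: (le_trans small).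
  by rewrite ler_pM2l// sqnorm_le_energy.
rewrite le_eqVlt; apply/orP; left; apply/eqP.
rewrite (_ : _ * _ = (eta / cst) * cst * A N); last by rewrite /cst; ring.
by rewrite divfK// gt_eqF.
Unshelve. all: by end_near. Qed.

Lemma energy_step (eta : R) : 0 < eta ->
  \forall N \near \oo, A N.+1 <= (1 + eta) * A N.
Proof.
move=> eta0; have k0 := kap_pos; have k1 : kap <= 1 := kap_le1 l.
pose e := eta / (1 + eta).
have e0 : 0 < e by rewrite divr_gt0//; lra.
have : \forall N \near \oo, forall n, (n <= N.+1)%N ->
    modulus (cpre n) ^+ 2 * L (L (A N.+1)) <= e * A N.+1.
  have [N0 _ hN] := cpre_small e0.
  by exists N0 => // N /= hle; apply: hN; exact: leqW.
apply: filterS => N /(_ N.+1 (leqnn _)) hs.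
have LL1 := L_ge1 (L (A N.+1)).
have h : modulus (cpre N.+1) ^+ 2 <= e * A N.+1.
  by apply: le_trans hs; rewrite ler_peMr ?sqr_ge0.
have : kap * modulus (cpre N.+1) ^+ 2 <= e * A N.+1.
  by apply: le_trans h; rewrite ler_piMl ?sqr_ge0.
rewrite -(lerD2l (A N)) -energyS => h3.
have : A N.+1 * (1 - e) <= A N by lra.
rewrite (_ : 1 - e = (1 + eta)^-1); last by rewrite /e; field; lra.
by rewrite ler_pdivrMr 1?mulrC//; lra.
Qed.

End innovations.

(** * Blocks *)

Section blocks.
Context d (Om : measurableType d) (R : realType) (P : probability Om R).
Variables (T : Om -> Om) (X : Om -> R[i]) (l a : R[i]) (b : nat -> R[i]).
Hypothesis cs : circle_system P T X l a.
Implicit Types (g : Om -> R) (u : R[i]).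
Local Notation E := (mean P).
Local Notation kap := (kap l).
Local Notation cpre := (cpre l b).
Local Notation A := (energy l b).
Let l1 := csl cs.

(** Composed with T^m, this is the conditional expectation of the orbit sum of
    length m + K given T^m: its first term is what remains of the first m terms. *)
Definition block m K (w : Om) : R[i] :=
  l * cpre m * X w + \sum_(0 <= j < K) b (m + j)%N * X (iter j T w).

Definition orbit_sum N (w : Om) : R[i] := \sum_(0 <= j < N) b j * X (iter j T w).

Let ws u m K := [seq u * b i | i <- iota m K].

Let size_ws u m K : size (ws u m K) = K.
Proof. by rewrite size_map size_iota. Qed.

Lemma block_wsum u m K w :
  u * block m K w = (u * (l * cpre m)) * X w + wsum T X (ws u m K) w.
Proof.
rewrite wsum_sum size_ws /block mulrDr mulr_sumr !mulrA; congr (_ + _).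
rewrite !big_mkord; apply: eq_bigr => j _.
by rewrite (nth_map 0%N) ?size_iota// nth_iota// mulrA.
Qed.

Lemma energy_chain u m K : chain_energy l (u * (l * cpre m)) (ws u m K) =
  modulus u ^+ 2 * \sum_(m <= n < m + K) modulus (cpre n.+1) ^+ 2.
Proof.
rewrite /ws; elim: K m => [|K IH] m.
  by rewrite addn0 big_geq// mulr0.
rewrite big_ltn; last by rewrite -{1}[m]addn0 ltn_add2l.
have hc : u * b m + u * (l * cpre m) = u * cpre m.+1 by rewrite /=; ring.
transitivity (modulus (u * cpre m.+1) ^+ 2 +
  chain_energy l (l * (u * cpre m.+1)) [seq u * b i | i <- iota m.+1 K]).
  by rewrite -hc.
rewrite modulusM exprMn [RHS]mulrDr; congr (_ + _).
by rewrite mulrCA IH addSnnS.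
Qed.

Lemma chain_le_block u dl m K :
  (forall n, (n <= m + K)%N -> modulus u * modulus (cpre n) <= dl) ->
  chain_le l dl (u * (l * cpre m)) (ws u m K).
Proof.
rewrite /ws; elim: K m => [//|K IH] m h.
rewrite /= (_ : u * b m + _ = u * cpre m.+1); last by rewrite /=; ring.
split; first by rewrite modulusM h// addnS ltnS leq_addr.
by rewrite mulrCA; apply: IH => n; rewrite addSnnS; exact: h.
Qed.

Lemma bmeas_block u m K : bmeas (fun w => Re (u * block m K w)).
Proof.
under eq_fun do rewrite block_wsum Re_add.
apply: bmeasD; first exact: (bmeas_ReX cs).
have := bmeas_wsum cs 1 (ws u m K).
by under eq_fun do rewrite mul1r.
Qed.

(** The Gaussian-like estimate used in every probabilistic argument: dl is
    chosen so small that the errors of mgf_upper and mgf_lower are a fraction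
    eps of the main term. *)
Lemma mgf_block (eps : R) : 0 < eps -> exists2 dl : R, 0 < dl &
  forall m K u, (forall n, (n <= m + K)%N -> modulus u * modulus (cpre n) <= dl) ->
  forall g, bmeas g -> (forall w, 0 <= g w) ->
   expR ((1 - eps) * (modulus u ^+ 2 / 4 * (A (m + K) - A m)) - eps) * E g <=
   E (fun w => expR (Re (u * block m K w)) * g (iter K T w)) <=
   expR ((1 + eps) * (modulus u ^+ 2 / 4 * (A (m + K) - A m)) + eps) * E g.
Proof.
move=> eps0; pose r := 1 - modulus l; have r0 : 0 < r := gap_gt0 l1.
have k0 : 0 < kap := kap_pos l1.
pose dl := Num.min (r / 8) (Num.min (eps / 2) (eps * kap * r / 800)).
have dl0 : 0 < dl.
  have h1 : 0 < r / 8 by exact: divr_gt0.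
  have h2 : 0 < eps / 2 by exact: divr_gt0.
  have h3 : 0 < eps * kap * r / 800.
    apply: divr_gt0; last by rewrite ltr0n.
    by apply: mulr_gt0; [exact: mulr_gt0|].
  by rewrite /dl lt_min h1 lt_min h2 h3.
have [d1 d2 d3] : [/\ dl <= r / 8, dl <= eps / 2 & dl <= eps * kap * r / 800].
  by rewrite /dl; split; rewrite !ge_min lexx ?orbT.
exists dl => // m K u hu g bg g0.
have hp : modulus (u * (l * cpre m)) <= dl.
  rewrite !modulusM mulrCA; apply: le_trans (hu m (leq_addr _ _)).
  by rewrite ler_piMl ?mulr_ge0 ?modulus_ge0// ltW.
have h0 : modulus (0 : R[i]) <= dl by rewrite modulus0 ltW.
have U := mgf_upper cs dl0 d1 hp h0 (chain_le_block hu) bg g0.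
have Lw := mgf_lower cs dl0 d1 hp h0 (chain_le_block hu) bg g0.
move: U Lw; rewrite addr0 modulus0 mulr0 addr0 subr0 size_ws energy_chain.
have -> : (fun w => expR (Re (u * (l * cpre m) * X w + wsum T X (ws u m K) w)) *
    g (iter K T w)) = (fun w => expR (Re (u * block m K w)) * g (iter K T w)).
  by apply/funext => w; rewrite block_wsum.
move=> U Lw; rewrite energyD.
set S := \sum_(_ <= _ < _) _ in U Lw *.
have S0 : 0 <= modulus u ^+ 2 * S.
  by rewrite mulr_ge0 ?sqr_ge0// sumr_ge0// => i _; rewrite sqr_ge0.
have Kd : 200 / r * dl <= eps * (kap / 4).
  rewrite mulrAC ler_pdivrMr//.
  apply: (@le_trans _ _ (200 * (eps * kap * r / 800))); first by rewrite ler_pM2l.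
  by lra.
have KS : 200 / r * dl * (modulus u ^+ 2 * S) <= eps * (kap / 4) * (modulus u ^+ 2 * S).
  by rewrite ler_wpM2r.
have Eg : 0 <= E g by exact: mean_ge0.
apply/andP; split.
  apply: le_trans Lw; rewrite ler_wpM2r// ler_expR.
  by rewrite -/r; lra.
apply: (le_trans U); rewrite ler_wpM2r// ler_expR.
by rewrite -/r; lra.
Qed.

Lemma block0 N w : block 0 N w = orbit_sum N w.
Proof. by rewrite /block /= mulr0 mul0r add0r. Qed.

(** Concatenation counts the past of the second block twice, once in each block,
    whence the subtraction. *)
Lemma block_cat m K1 K2 w : block m (K1 + K2) w =
  block m K1 w - l * cpre (m + K1) * X (iter K1 T w) + block (m + K1) K2 (iter K1 T w).
Proof.
rewrite /block (@big_cat_nat _ _ _ K1 0 (K1 + K2))//= ?leq_addr//.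
have -> : \sum_(K1 <= j < K1 + K2) b (m + j)%N * X (iter j T w) =
   \sum_(0 <= j < K2) b (m + K1 + j)%N * X (iter j T (iter K1 T w)).
  rewrite -{1}[K1]add0n big_addn addKn; apply: eq_bigr => j _.
  by rewrite -iterD [(j + K1)%N]addnC addnA [(K1 + j)%N]addnC.
ring.
Qed.

(** Pythagoras for the martingale difference v (X - l (X o T)), orthogonal to
    functions of T. *)
Lemma mean_modulus_step (v : R[i]) (H : Om -> R[i]) :
  bmeas (fun w => Re (H w)) -> bmeas (fun w => Im (H w)) ->
  E (fun w => modulus (v * X w + H (T w)) ^+ 2) =
  kap * modulus v ^+ 2 + E (fun w => modulus (l * v * X w + H w) ^+ 2).
Proof.
move=> bR bI.
have bRT := bmeas_comp (csT cs) bR; have bIT := bmeas_comp (csT cs) bI.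
have bX u := bmeas_ReX cs u.
have expand u (h : Om -> R[i]) w : modulus (u * X w + h w) ^+ 2 =
   modulus u ^+ 2 + (2 * (Re (u * X w) * Re (h w)) +
     2 * (Re (- 'i * u * X w) * Im (h w))) + (Re (h w) ^+ 2 + Im (h w) ^+ 2).
  have : modulus (u * X w) ^+ 2 = modulus u ^+ 2 by rewrite modulusM (csX cs) mulr1.
  rewrite !modulus_sqr Re_add Im_add => <-.
  have -> : Re (- 'i * u * X w) = Im (u * X w).
    by rewrite -mulrA mulNr Re_opp Re_mul /=; ring.
  by ring.
have meanX u (h : Om -> R[i]) : bmeas (fun w => Re (h w)) -> bmeas (fun w => Im (h w)) ->
    E (fun w => modulus (u * X w + h w) ^+ 2) =
    modulus u ^+ 2 + (2 * E (fun w => Re (u * X w) * Re (h w)) +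
      2 * E (fun w => Re (- 'i * u * X w) * Im (h w))) +
      E (fun w => Re (h w) ^+ 2 + Im (h w) ^+ 2).
  move=> bRh bIh.
  under eq_mean do rewrite expand.
  have b1 : bmeas (fun w => Re (u * X w) * Re (h w)) by exact: bmeasM.
  have b2 : bmeas (fun w => Re (- 'i * u * X w) * Im (h w)) by exact: bmeasM.
  have b3 : bmeas (fun w => Re (h w) ^+ 2 + Im (h w) ^+ 2).
    by apply: bmeasD; under eq_fun do rewrite expr2; exact: bmeasM.
  have b4 : bmeas (fun w => 2 * (Re (u * X w) * Re (h w)) +
      2 * (Re (- 'i * u * X w) * Im (h w))) by apply: bmeasD; exact: bmeasZ.
  have bc : bmeas (fun _ : Om => modulus u ^+ 2) by exact: bmeas_cst.
  have Ec : E (fun=> modulus u ^+ 2) = modulus u ^+ 2 by exact: (mean_cst P).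
  rewrite (meanD P (bmeasD bc b4) b3) (meanD P bc b4) (meanD P (bmeasZ 2 b1) (bmeasZ 2 b2)) Ec.
  by rewrite (meanZ P 2 b1) (meanZ P 2 b2).
rewrite (meanX v (fun w => H (T w)))// (meanX (l * v) H)//.
rewrite (csE1 cs v bR) (csE1 cs (- 'i * v) bI).
rewrite (csE0 cs (g := fun w => Re (H w) ^+ 2 + Im (H w) ^+ 2)); last first.
  by apply: bmeasD; under eq_fun do rewrite expr2; exact: bmeasM.
have -> : (fun w => Re (v * (l * X w)) * Re (H w)) =
          (fun w => Re (l * v * X w) * Re (H w)).
  by apply/funext => w; congr (Re _ * _); ring.
have -> : (fun w => Re (- 'i * v * (l * X w)) * Im (H w)) =
          (fun w => Re (- 'i * (l * v) * X w) * Im (H w)).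
  by apply/funext => w; congr (Re _ * _); ring.
by rewrite modulusM exprMn /kap; ring.
Qed.

(** Iterating mean_modulus_step conditions out the terms one by one; what is
    left at the end is the conditional expectation given T^N. *)
Lemma mean_sqr_orbit_sum N : E (fun w => modulus (orbit_sum N w) ^+ 2) =
  A N + modulus (l * cpre N) ^+ 2.
Proof.
have bI ws' : bmeas (fun w => Im (wsum T X ws' w)).
  have -> : (fun w => Im (wsum T X ws' w)) = (fun w => Re (- 'i * wsum T X ws' w)).
    by apply/funext => w; rewrite mulNr Re_opp Re_mul /=; ring.
  exact: (bmeas_wsum cs).
have bR ws' : bmeas (fun w => Re (wsum T X ws' w)).
  by have := bmeas_wsum cs 1 ws'; under eq_fun do rewrite mul1r.
have main m K : E (fun w => modulus (l * cpre m * X w + wsum T X (ws 1 m K) w) ^+ 2) =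
   A (m + K) - A m + modulus (l * cpre (m + K)) ^+ 2.
  elim: K m => [|K IH] m.
    rewrite addn0 subrr add0r -[RHS](mean_cst P); apply: eq_mean => w.
    by rewrite /= addr0 modulusM (csX cs) mulr1.
  have -> : (fun w => modulus (l * cpre m * X w + wsum T X (ws 1 m K.+1) w) ^+ 2) =
     (fun w => modulus (cpre m.+1 * X w + wsum T X (ws 1 m.+1 K) (T w)) ^+ 2).
    by apply/funext => w; congr (modulus _ ^+ 2); rewrite /=; ring.
  rewrite mean_modulus_step// IH addSnnS energyS; ring.
rewrite -[in RHS](add0n N).
have A0 : A 0%N = 0 by rewrite /energy big_nil mulr0.
have := main 0%N N; rewrite A0 subr0 => <-.
by apply: eq_mean => w; rewrite -block0 -[block 0 N w]mul1r block_wsum mul1r.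
Qed.

End blocks.

(** * The direct Borel-Cantelli lemma *)

Section borel_cantelli.
Context d (Om : measurableType d) (R : realType) (P : probability Om R).
Local Notation E := (mean P).

Lemma measurable_ge (g : Om -> R) (x : R) : measurable_fun setT g ->
  measurable [set w | x <= g w].
Proof.
move=> mg; rewrite (_ : [set w | _] = g @^-1` `[x, +oo[%classic); last first.
  by apply/seteqP; split => w /=; rewrite in_itv /= andbT.
by rewrite -[X in measurable X]setTI; exact: mg.
Qed.

Lemma bmeas_ge (g : Om -> R) (x : R) : measurable_fun setT g ->
  bmeas (fun w : Om => (x <= g w)%R%:R : R).
Proof.
move=> mg; have := @bmeas_indic _ Om R _ (measurable_ge x mg).
suff -> : \1_[set w | x <= g w] = (fun w => (x <= g w)%R%:R : R) by [].
by apply/funext => w; rewrite indicE; congr (nat_of_bool _)%:R; apply/idP/idP; rewrite inE.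
Qed.

Lemma bmeas_prod (I : Type) (s : seq I) (F : I -> Om -> R) :
  (forall i, bmeas (F i)) -> bmeas (fun w => \prod_(i <- s) F i w).
Proof.
move=> bF; elim: s => [|i s IH].
  by under eq_fun do rewrite big_nil; exact: bmeas_cst.
by under eq_fun do rewrite big_cons; exact: bmeasM.
Qed.

(** With Z the indicator of an event, Z < 1 says that the event does not occur.
    The Markov inequality gives the summability required by the Borel-Cantelli
    lemma. *)
Lemma ae_lt1_summable (Z : nat -> Om -> R) (k0 : nat) (C : R) :
  (forall k, bmeas (Z k)) -> (forall k w, 0 <= Z k w) ->
  (forall N, \sum_(0 <= k < N) E (Z (k0 + k)%N) <= C) ->
  {ae P, forall w, \forall k \near \oo, Z k w < 1}.
Proof.
move=> bZ Z0 hC.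
pose F k := [set w | 1 <= Z (k0 + k)%N w].
have mF k : measurable (F k) by apply: measurable_ge; case: (bZ (k0 + k)%N).
have PF k : (P (F k) <= (E (Z (k0 + k)%N))%:E)%E.
  rewrite (mean_indic P (mF k)) lee_fin.
  apply: le_mean => //; first exact: bmeas_indic.
  move=> w; rewrite indicE; case: (boolP (w \in F k)) => [|_]; last exact: Z0.
  by rewrite inE.
have sumF : (\sum_(0 <= k <oo) P (F k) < +oo)%E.
  apply: (@le_lt_trans _ _ C%:E); last exact: ltry.
  apply: lime_le; first by apply: is_cvg_nneseries => n _ _; exact: measure_ge0.
  apply: nearW => N; apply: (@le_trans _ _ (\sum_(0 <= k < N) (E (Z (k0 + k)%N))%:E)%E).
    by apply: lee_sum => k _; exact: PF.
  by rewrite sumEFin lee_fin.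
have nul := lim_sup_set_cvg0 mF sumF.
exists (lim_sup_set F); split => //.
  by apply: bigcap_measurable => // k _; exact: bigcup_measurable.
move=> w /= hw n _ /=; apply: contrapT => hn; apply: hw.
exists (k0 + n)%N => // k /= hk; rewrite ltNge; apply/negP => Zk; apply: hn.
have k0k : (k0 <= k)%N by rewrite (leq_trans _ hk)// leq_addr.
exists (k - k0)%N; first by rewrite /= leq_subRL.
by rewrite /F /= subnKC.
Qed.

End borel_cantelli.

Section p_series.
Variable R : realType.

(** Each term after the first is at most the difference of two successive values
    of k^(1 - s) / (s - 1), and these telescope. *)
Lemma p_series_bound (s : R) : 1 < s -> forall N,
  \sum_(0 <= k < N) expR (- s * ln (1 + k)%:R) <= 1 + (s - 1)^-1.
Proof.
move=> s1 N; pose v (k : nat) := expR (- (s - 1) * ln (1 + k)%:R) / (s - 1) : R.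
have s0 : 0 < s - 1 by lra.
have step k : expR (- s * ln (1 + k.+1)%:R) <= v k - v k.+1.
  rewrite /v -mulrBl ler_pdivlMr//.
  set x : R := (1 + k)%:R; have x0 : 0 < x by rewrite ltr0n.
  have -> : (1 + k.+1)%:R = x + 1 :> R by rewrite /x natr1 addnS.
  have x1 : 0 < x + 1 by lra.
  pose y := ln (x + 1) - ln x.
  have hy : 1 / (x + 1) <= y.
    rewrite /y -ln_div ?posrE//; have := @le_ln1Dx R (- (1 / (x + 1))).
    have -> : 1 + - (1 / (x + 1)) = x / (x + 1) by field; lra.
    have h1 : 1 / (x + 1) < 1 by rewrite ltr_pdivrMr//; lra.
    rewrite ltrN2 h1 => /(_ isT).
    rewrite ln_div ?posrE// ln_div ?posrE//; lra.
  have -> : - (s - 1) * ln x = - (s - 1) * ln (x + 1) + (s - 1) * y by rewrite /y; ring.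
  rewrite expRD (_ : - s * ln (x + 1) = - (s - 1) * ln (x + 1) + - ln (x + 1)); last by ring.
  rewrite expRD expRN lnK ?posrE// -{3}[expR _]mulr1 -mulrBr -mulrA.
  rewrite ler_pM2l ?expR_gt0// lerBrDl; apply: le_trans (expR_ge1Dx _).
  rewrite lerD2l mulrC ler_pM2l//.
  by rewrite -[leLHS]div1r.
case: N => [|N].
  by rewrite big_nil addr_ge0// invr_ge0 ltW.
rewrite big_nat_recl// addn0 ln1 mulr0 expR0 lerD2l.
apply: (@le_trans _ _ (\sum_(0 <= k < N) (v k - v k.+1))); first exact: ler_sum.
rewrite -[leLHS]opprK -sumrN; under eq_bigr do rewrite opprB.
rewrite telescope_sumr// opprB lerBlDr /v addn0 ln1 mulr0 expR0 div1r lerDl.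
by rewrite divr_ge0 ?expR_ge0 ?(ltW s0).
Qed.

End p_series.

(** * A maximal inequality *)

(** The probability of some success splits according to the position of the last
    success; the product runs over the later indices. *)
Lemma first_success_sum (R : comPzRingType) (q : nat -> R) (K : nat) :
  1 - \prod_(0 <= i < K) (1 - q i) =
  \sum_(0 <= j < K) q j * \prod_(j.+1 <= i < K) (1 - q i).
Proof.
elim: K => [|K IH]; first by rewrite !big_nil subrr.
rewrite [in LHS]big_nat_recr//= [in RHS]big_nat_recr//= (@big_geq _ _ _ K.+1 K.+1)// mulr1.
rewrite [X in _ = X + _](_ : _ =
    (\sum_(0 <= j < K) q j * \prod_(j.+1 <= i < K) (1 - q i)) * (1 - q K)).
  by rewrite -IH; ring.
rewrite mulr_suml; apply: eq_big_nat => j /andP[_ jK].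
by rewrite big_nat_recr//= mulrA.
Qed.

Section maximal_inequality.
Context d (Om : measurableType d) (R : realType) (P : probability Om R).
Variables (T : Om -> Om) (X : Om -> R[i]) (l a : R[i]) (b : nat -> R[i]).
Hypothesis cs : circle_system P T X l a.
Local Notation E := (mean P).
Local Notation cpre := (cpre l b).
Local Notation A := (energy l b).
Local Notation block := (block T X l b).
Implicit Types (e : R[i]) (x : R) (m K j : nat) (w : Om).

Let bBlk u m K : bmeas (fun w => Re (u * block m K w)).
Proof. exact: (@bmeas_block _ _ _ _ _ _ _ _ b cs u m K). Qed.

(** Indicator that the conditional expectation of the orbit sum of length m + K
    given T^(m+j) is at least x in the direction e, as a function of T^(m+j). *)
Definition crossing e x m K j w : R :=
  (x <= Re (e * block (m + j) (K - j) w))%R%:R.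

(** The indicator that some crossing occurs: the product is that of no crossing.
    Functions with values 0 and 1 multiply and compose with iterates of T more
    readily than events. *)
Definition zmax e x m K w : R :=
  1 - \prod_(0 <= j < K) (1 - crossing e x m K j (iter j T w)).

Lemma crossing01 e x m K j w : 0 <= crossing e x m K j w <= 1.
Proof. by rewrite /crossing; case: (x <= _); rewrite ?lexx ?ler01. Qed.

Lemma bmeas_crossing e x m K j : bmeas (crossing e x m K j).
Proof. by apply: bmeas_ge; have [] := @bmeas_block _ _ _ _ _ _ _ _ b cs e (m + j) (K - j). Qed.

Lemma zmax01 e x m K w : 0 <= zmax e x m K w <= 1.
Proof.
have h : 0 <= \prod_(0 <= j < K) (1 - crossing e x m K j (iter j T w)) <= 1.
  apply/andP; split.
    by apply: prodr_ge0 => j _; rewrite subr_ge0; case/andP: (crossing01 e x m K j (iter j T w)).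
  rewrite big_mkord; apply: prodr_ile1 => j _.
  by case/andP: (crossing01 e x m K j (iter j T w)) => h1 h2; apply/andP; split; lra.
by rewrite /zmax; case/andP: h => h1 h2; apply/andP; split; lra.
Qed.

Lemma zmax_lt1 e x m K w : zmax e x m K w < 1 ->
  forall j, (j < K)%N -> Re (e * block (m + j) (K - j) (iter j T w)) < x.
Proof.
move=> z1 j jK; rewrite ltNge; apply/negP => hx; move: z1.
rewrite /zmax big_mkord (bigD1 (Ordinal jK))//= /crossing hx subrr mul0r subr0.
by rewrite ltxx.
Qed.

Lemma bmeas_zmax e x m K : bmeas (zmax e x m K).
Proof.
apply: bmeasB; first exact: bmeas_cst.
apply: bmeas_prod => j; apply: bmeasB; first exact: bmeas_cst.
exact/(bmeas_iter cs)/bmeas_crossing.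
Qed.

(** The maximal inequality of Doob for exp (tau Re (e .)), along a decreasing
    filtration: the decomposition is by the last crossing time j, because the
    event that there is no crossing after j depends on T^j only. On that event
    the lower estimate of mgf_block says that the exponential of the whole block
    has a conditional expectation at least a constant times exp (tau x), and the
    upper estimate bounds its total mean. *)
Lemma mean_zmax_le (eps : R) : 0 < eps -> eps <= 1 -> exists2 dl : R, 0 < dl &
  forall m K (tau : R) e x, 0 <= tau -> modulus e = 1 ->
  (forall n, (n <= m + K)%N -> tau * modulus (cpre n) <= dl) ->
  E (zmax e x m K) <=
  expR (- (tau * x) + (1 + eps) * (tau ^+ 2 / 4 * (A (m + K) - A m)) + 3 * eps).
Proof.
move=> eps0 eps1; have [dl0 dl0_gt0 mgf] := @mgf_block _ _ _ _ _ _ _ _ b cs _ eps0.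
pose dl := Num.min dl0 eps.
have dl_gt0 : 0 < dl by rewrite lt_min dl0_gt0.
exists dl => // m K tau e x tau0 e1 hc.
have hu n : (n <= m + K)%N -> modulus (tau%:C * e) * modulus (cpre n) <= dl.
  by move=> hn; rewrite modulusM modulusC e1 mulr1 ger0_norm// hc.
have hu0 n : (n <= m + K)%N -> modulus (tau%:C * e) * modulus (cpre n) <= dl0.
  by move=> /hu /le_trans; apply; rewrite ge_min lexx.
set u := tau%:C * e in hu hu0.
have u2 : modulus u ^+ 2 = tau ^+ 2.
  by rewrite /u modulusM modulusC e1 mulr1 real_normK ?num_real.
pose q j w := crossing e x m K j w.
pose h j w := q j w * \prod_(j.+1 <= i < K) (1 - q i (iter (i - j) T w)).
have bq j : bmeas (q j) by exact: bmeas_crossing.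
have bh j : bmeas (h j).
  apply: bmeasM => //; apply: bmeas_prod => i.
  by apply: bmeasB; [exact: bmeas_cst|exact: (bmeas_iter cs)].
have h0 j w : 0 <= h j w.
  apply: mulr_ge0; first by case/andP: (crossing01 e x m K j w).
  by apply: prodr_ge0 => i _; rewrite subr_ge0; case/andP: (crossing01 e x m K i (iter (i - j) T w)).
have zE w : zmax e x m K w = \sum_(0 <= j < K) h j (iter j T w).
  rewrite /zmax first_success_sum; apply: eq_big_nat => j /andP[_ jK].
  congr (_ * _); apply: eq_big_nat => i /andP[ji _]; congr (1 - q i _).
  by rewrite -iterD subnK// ltnW.
have bW j : bmeas (fun w => Re (u * block (m + j) (K - j) w)) by exact: bBlk.
pose G j w := h j w * expR (Re (u * block (m + j) (K - j) w)).
have bG j : bmeas (G j) by apply: bmeasM => //; exact: bmeas_exp.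
have G0 j w : 0 <= G j w by rewrite mulr_ge0// expR_ge0.
(* G weights the event that the last crossing is at j by the exponential at j,
   which is at least exp (tau x) there. *)
have low j w : expR (tau * x) * h j w <= G j w.
  have [hx|hx] := boolP (x <= Re (e * block (m + j) (K - j) w)); last first.
    have hj0 : h j w = 0 by rewrite /h /q /crossing (negbTE hx) mul0r.
    by rewrite /G hj0 mulr0 mul0r.
  rewrite /G mulrC; apply: ler_wpM2l => //.
  by rewrite ler_expR /u -mulrA Re_scale ler_wpM2l.
(* The whole block is glued from its first j terms, whose conditional
   exponential moment given T^j is at least exp (- eps), and the rest; dl pays
   for the doubly counted past. *)
have mid j : (j < K)%N -> expR (- eps - dl) * E (G j) <=
   E (fun w => expR (Re (u * block m K w)) * h j (iter j T w)).
  move=> jK.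
  have hj n : (n <= m + j)%N -> modulus u * modulus (cpre n) <= dl0.
    by move=> hn; apply: hu0; rewrite (leq_trans hn)// leq_add2l ltnW.
  have /andP[lo _] := mgf m j u hj (G j) (bG j) (G0 j).
  have EG : 0 <= E (G j) by exact: mean_ge0.
  have lo' : expR (- eps) * E (G j) <=
     E (fun w => expR (Re (u * block m j w)) * G j (iter j T w)).
    apply: le_trans lo; rewrite ler_wpM2r// ler_expR.
    rewrite lerDr mulr_ge0 ?subr_ge0// mulr_ge0//.
      by rewrite divr_ge0 ?sqr_ge0.
    by rewrite subr_ge0; apply: energy_nd; [exact: csl cs|exact: leq_addr].
  rewrite addrC expRD -mulrA; apply: le_trans (ler_wpM2l (expR_ge0 _) lo') _.
  rewrite -meanZ; last first.
    by apply: bmeasM; [exact/bmeas_exp/bBlk|exact: (bmeas_iter cs)].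
  apply: le_mean.
  - apply: bmeasZ; apply: bmeasM; [exact/bmeas_exp/bBlk|exact: (bmeas_iter cs)].
  - apply: bmeasM; [exact/bmeas_exp/bBlk|exact: (bmeas_iter cs)].
  move=> w; rewrite [leLHS](_ : _ = expR (- dl) * (expR (Re (u * block m j w)) *
    expR (Re (u * block (m + j) (K - j) (iter j T w)))) * h j (iter j T w)); last first.
    by rewrite /G; ring.
  apply: ler_wpM2r => //.
  rewrite -!expRD ler_expR.
  have := block_cat T X l b m j (K - j) w; rewrite subnKC 1?ltnW// => ->.
  generalize (block m j w) (block (m + j) (K - j) (iter j T w)) => B1 B2.
  rewrite mulrDr mulrBr Re_add Re_sub.
  suff : Re (u * (l * cpre (m + j) * X (iter j T w))) <= dl by lra.
  rewrite (le_trans (ReleM _))// (modulusM u) (modulusM (l * _)) (modulusM l).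
  rewrite (csX cs) mulr1 mulrCA.
  have := hu (m + j)%N; rewrite leq_add2l => /(_ (ltnW jK)); apply: le_trans.
  by rewrite ler_piMl ?mulr_ge0 ?modulus_ge0// (ltW (csl cs)).
have tot : expR (tau * x - eps - dl) * E (zmax e x m K) <= E (fun w => expR (Re (u * block m K w))).
  have Ez : E (zmax e x m K) = \sum_(0 <= j < K) E (h j).
    rewrite (_ : E (zmax e x m K) = E (fun w => \sum_(0 <= j < K) h j (iter j T w))); last first.
      by apply: eq_mean => w; rewrite zE.
    rewrite mean_sum; last by move=> j; exact: (bmeas_iter cs).
    by apply: eq_bigr => j _; exact: (mean_iter cs).
  have bB : bmeas (fun w => expR (Re (u * block m K w))) by exact/bmeas_exp/bBlk.
  apply: (@le_trans _ _ (E (fun w => expR (Re (u * block m K w)) * zmax e x m K w))); last first.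
    apply: le_mean => //; first exact/bmeasM/bmeas_zmax.
    by move=> w; rewrite ler_piMr ?expR_ge0//; case/andP: (zmax01 e x m K w).
  rewrite (_ : (fun w => expR (Re (u * block m K w)) * zmax e x m K w) =
     fun w => \sum_(0 <= j < K) expR (Re (u * block m K w)) * h j (iter j T w)); last first.
    by apply/funext => w; rewrite zE mulr_sumr.
  rewrite mean_sum; last by move=> j; apply: bmeasM => //; exact: (bmeas_iter cs).
  rewrite Ez mulr_sumr; apply: ler_sum_nat => j /andP[_ jK].
  apply: le_trans (mid j jK).
  rewrite -addrA addrC expRD -mulrA; apply: ler_wpM2l; first exact: expR_ge0.
  by rewrite -meanZ//; apply: le_mean => //; exact: bmeasZ.
have /andP[_ up] := mgf m K u hu0 (cst 1) (bmeas_cst _ 1) (fun _ => ler01 : 0 <= cst 1 _).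
have E1 : E (cst 1) = 1 by exact: mean_cst.
move: up; rewrite E1 mulr1 => up.
have dle : dl <= eps by rewrite ge_min lexx orbT.
have {}up : E (fun w => expR (Re (u * block m K w))) <=
   expR ((1 + eps) * (tau ^+ 2 / 4 * (A (m + K) - A m)) + eps).
  by rewrite -u2; apply: le_trans up; under [leRHS]eq_mean do rewrite /= mulr1.
have {tot}up := le_trans tot up.
rewrite -(ler_pM2l (expR_gt0 (tau * x - eps - dl))); apply: (le_trans up).
by rewrite -expRD ler_expR; lra.
Qed.

End maximal_inequality.

(** * The upper half of the law *)

Section levels.
Variable R : realType.
Implicit Types (rho : R).

Lemma bernoulli_ge rho k : 1 <= rho -> 1 + k%:R * (rho - 1) <= rho ^+ k.
Proof.
move=> r1; elim: k => [|k IH]; first by rewrite mul0r addr0 expr0.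
rewrite exprS -natr1; have := ler_wpM2l (le_trans ler01 r1) IH.
have : 0 <= k%:R * (rho - 1) ^+ 2 by rewrite mulr_ge0 ?sqr_ge0.
by rewrite expr2; lra.
Qed.

Lemma expr_unbounded rho (C : R) : 1 < rho -> \forall k \near \oo, C < rho ^+ k.
Proof.
move=> r1; exists (Num.bound `|C / (rho - 1)|) => // k /= hk.
have r0 : 0 < rho - 1 by rewrite subr_gt0.
apply: lt_le_trans (bernoulli_ge k (ltW r1)).
have : C / (rho - 1) < k%:R.
  apply: le_lt_trans (ler_norm _) _.
  by apply: lt_le_trans (archi_boundP (normr_ge0 (C / (rho - 1)))) _; rewrite ler_nat.
by rewrite ltr_pdivrMr// => h; lra.
Qed.

Variable A : nat -> R.
Hypothesis A_nd : forall m n, (m <= n)%N -> A m <= A n.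
Hypothesis A_oo : A N @[N --> \oo] --> +oo.
Hypothesis A_step : forall eta, 0 < eta -> \forall N \near \oo, A N.+1 <= (1 + eta) * A N.

(** M k is the first index where A reaches rho^k. It need not be strictly
    increasing in k, but A (M k) overshoots rho^k only by a factor 1 + eta once
    A grows by small factors. *)
Lemma level_times rho : exists M : nat -> nat,
  forall k, rho ^+ k <= A (M k) /\ forall N, (N < M k)%N -> A N < rho ^+ k.
Proof.
suff h k : exists m, rho ^+ k <= A m /\ forall N, (N < m)%N -> A N < rho ^+ k.
  by have [M hM] := choice h; exists M.
have ex : exists n, rho ^+ k <= A n.
  move/cvgryPge : A_oo => /(_ (rho ^+ k)) [n _ hn]; by exists n; exact: (hn n (leqnn n)).
case: (ex_minnP ex) => m hm hmin; exists m; split => // N Nm.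
by rewrite ltNge; apply/negP => /hmin; rewrite leqNgt Nm.
Qed.

Variables (rho : R) (M : nat -> nat).
Hypothesis rho1 : 1 < rho.
Hypothesis hM : forall k, rho ^+ k <= A (M k) /\ forall N, (N < M k)%N -> A N < rho ^+ k.

Lemma level_unbounded N : \forall k \near \oo, (N < M k)%N.
Proof.
have := expr_unbounded (A N) rho1; apply: filterS => k hk.
rewrite ltnNge; apply/negP => /A_nd h; have [h1 _] := hM k; lra.
Qed.

Lemma level_upper (eta : R) : 0 < eta ->
  \forall k \near \oo, A (M k) <= (1 + eta) * rho ^+ k.
Proof.
move=> eta0; have [N0 _ hN0] := A_step eta0.
have := level_unbounded N0; apply: filterS => k.
have [_ ] := hM k; case: (M k) => [//|n] hn hk.
apply: le_trans (hN0 n _) _; first by rewrite /=.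
by rewrite ler_pM2l; [apply: ltW; exact: hn|lra].
Qed.

Lemma level_index k0 N : (M k0 <= N)%N ->
  exists k, [/\ (k0 <= k)%N, (M k <= N)%N & (N < M k.+1)%N].
Proof.
move=> h0; have [K _ hK] := level_unbounded N.
have bnd k : (M k <= N)%N -> (k <= K)%N.
  move=> hk; rewrite leqNgt; apply/negP => Kk.
  by have := hK k (ltnW Kk); rewrite /= ltnNge hk.
have ex : exists k, (M k <= N)%N by exists k0.
case: (ex_maxnP ex bnd) => k hk hmax; exists k; split => //; first exact: hmax.
by rewrite ltnNge; apply/negP => /hmax; rewrite ltnn.
Qed.

End levels.

Section upper_bound.
Context d (Om : measurableType d) (R : realType) (P : probability Om R).
Variables (T : Om -> Om) (X : Om -> R[i]) (l a : R[i]) (b : nat -> R[i]).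
Hypothesis cs : circle_system P T X l a.
Local Notation E := (mean P).
Local Notation cpre := (cpre l b).
Local Notation A := (energy l b).
Local Notation block := (block T X l b).
Local Notation S := (orbit_sum T X b).
Hypothesis B_infty : sqnorm_sum b N @[N --> \oo] --> +oo.
Hypothesis b_small : sqnorm_max b N * L (L (sqnorm_sum b N)) / sqnorm_sum b N
    @[N --> \oo] --> (0 : R).
Implicit Types (e : R[i]) (x : R) (m K j : nat) (w : Om).

Definition lil_time N : R := L (L (A N)).
(** The normalisation with the energy A in place of the variance, from which it
    differs by a factor tending to 1. *)
Definition lil_scale N : R := Num.sqrt (A N * lil_time N).
Local Notation t := lil_time.
Local Notation psi := lil_scale.

Let l1 := csl cs.
Let A_nd m n : (m <= n)%N -> A m <= A n := @energy_nd _ _ b l1 m n.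
Let A_oo := energy_cvg l1 B_infty.
Let A_step eta (eta0 : 0 < eta) := energy_step l1 B_infty b_small eta0.
Let A_ge0 N : 0 <= A N := energy_ge0 b l1 N.

Lemma lil_time_ge1 N : 1 <= t N. Proof. exact: L_ge1. Qed.

Lemma energy_gt0 : \forall N \near \oo, 0 < A N.
Proof.
move/cvgryPge : A_oo => /(_ 1); apply: filterS => N; exact: lt_le_trans.
Qed.

Lemma lil_scale_ge0 N : 0 <= psi N. Proof. exact: sqrtr_ge0. Qed.

Lemma lil_scale_sqr N : psi N ^+ 2 = A N * t N.
Proof. by rewrite sqr_sqrtr// mulr_ge0// (le_trans ler01)// lil_time_ge1. Qed.

Lemma energy_le_scale N : A N <= psi N ^+ 2.
Proof. by rewrite lil_scale_sqr ler_peMr// lil_time_ge1. Qed.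

(** Both A and LL(A) grow at most by the factor 1 + c, by LL_scale, and the
    square root of the product of the two factors is 1 + c. *)
Lemma lil_scale_comp (c : R) m n : 0 <= c -> A m <= (1 + c) * A n ->
  psi m <= (1 + c) * psi n.
Proof.
move=> c0 h; rewrite -(@ler_pXn2r _ 2)// ?nnegrE ?lil_scale_ge0//; last first.
  by rewrite mulr_ge0 ?lil_scale_ge0//; lra.
rewrite exprMn !lil_scale_sqr.
have tt : t m <= (1 + c) * t n.
  by apply: le_trans (LL_scale _ c0); apply/le_L/le_L.
rewrite (_ : _ * (A n * t n) = ((1 + c) * A n) * ((1 + c) * t n)); last by ring.
by rewrite ler_pM// (le_trans ler01)// lil_time_ge1.
Qed.

(** The maximal inequality with tau = s sqrt (t / A), which is admissible for
    any fixed s because the coefficients are small compared with sqrt (A / t).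
    Bounds at heights proportional to the scale then decay like powers of exp (-
    t). *)
Lemma mean_zmax_tail (eps s : R) : 0 < eps -> eps <= 1 -> 0 < s ->
  \forall N \near \oo, forall m e y, (m <= N)%N -> modulus e = 1 ->
  E (zmax T X l b e (y * psi N) m (N - m)) <=
  expR (t N * (- (s * y) + (1 + eps) * (s ^+ 2 / 4) * ((A N - A m) / A N)) + 3 * eps).
Proof.
move=> eps0 eps1 s0; have [dl dl0 hdl] := @mean_zmax_le _ _ _ _ _ _ _ _ b cs _ eps0 eps1.
have eta0 : 0 < (dl / s) ^+ 2 by rewrite exprn_gt0// divr_gt0.
near=> N => m e y mN e1.
have AN : 0 < A N by near: N; exact: energy_gt0.
have hc : forall n, (n <= N)%N -> modulus (cpre n) ^+ 2 * t N <= (dl / s) ^+ 2 * A N.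
  by near: N; exact: (cpre_small l1 B_infty b_small eta0).
have t0 : 0 <= t N by rewrite (le_trans ler01)// lil_time_ge1.
pose tau := s * Num.sqrt (t N / A N).
have tau0 : 0 <= tau by rewrite mulr_ge0 ?sqrtr_ge0// ltW.
have tau2 : tau ^+ 2 = s ^+ 2 * (t N / A N).
  by rewrite exprMn sqr_sqrtr// divr_ge0.
have taup : tau * (y * psi N) = s * y * t N.
  rewrite /tau /psi mulrACA -sqrtrM ?divr_ge0//.
  rewrite (_ : t N / A N * _ = t N ^+ 2); last by field; rewrite gt_eqF.
  by rewrite sqrtr_sqr ger0_norm.
have := hdl m (N - m)%N tau e (y * psi N) tau0 e1; rewrite subnKC// => hz.
apply: le_trans (hz _) _.
  move=> n nN.
  have tc0 : 0 <= tau * modulus (cpre n) by apply: mulr_ge0 => //; exact: modulus_ge0.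
  rewrite -(@ler_pXn2r _ 2)// ?nnegrE ?(ltW dl0)//.
  rewrite exprMn tau2 (_ : _ * modulus (cpre n) ^+ 2 =
    s ^+ 2 / A N * (modulus (cpre n) ^+ 2 * t N)); last by ring.
  rewrite (_ : dl ^+ 2 = s ^+ 2 / A N * ((dl / s) ^+ 2 * A N)); last first.
    by field; rewrite !gt_eqF.
  by rewrite ler_wpM2l ?hc// divr_ge0 ?sqr_ge0// ltW.
rewrite ler_expR taup tau2 lerD2r.
by rewrite le_eqVlt; apply/orP; left; apply/eqP; field; rewrite gt_eqF.
Unshelve. all: by end_near. Qed.

Variables (rho : R) (M : nat -> nat).
Hypothesis rho1 : 1 < rho.
Hypothesis hM : forall k, rho ^+ k <= A (M k) /\ forall N, (N < M k)%N -> A N < rho ^+ k.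

(** At the k-th level exp (- t) is at most a constant times 1 / k, so an
    exponent q > 1 makes the tails summable. *)
Lemma lil_time_level k : (0 < k)%N -> ln k%:R + ln (ln rho) <= t (M k).
Proof.
move=> k0; have lr : 0 < ln rho by rewrite ln_gt0.
have [h _] := hM k.
have rk : 0 < rho ^+ k by rewrite exprn_gt0// (lt_trans ltr01).
have Lge (y : R) : 0 < y -> ln y <= L y.
  move=> y0; rewrite /L ler_ln ?posrE// ?lt_max ?expR_gt0//.
  by rewrite le_max lexx orbT.
have kR : 0 < k%:R :> R by rewrite ltr0n.
rewrite -lnM ?posrE//; apply: le_trans (Lge _ (mulr_gt0 kR lr)) _.
apply: le_L; apply: le_trans (le_L h); apply: le_trans (Lge _ rk).
by rewrite lnXn ?mulr_natl// (lt_trans ltr01).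
Qed.

(** The exponent in mean_zmax_tail is at most - q t, so by lil_time_level the
    means form a convergent p-series. *)
Lemma ae_zmax_lt1 (m : nat -> nat) (eps s y q : R) e :
  (forall k, (m k <= M k)%N) -> 0 < eps -> eps <= 1 -> 0 < s -> 1 < q ->
  modulus e = 1 ->
  (\forall k \near \oo, - (s * y) +
    (1 + eps) * (s ^+ 2 / 4) * ((A (M k) - A (m k)) / A (M k)) <= - q) ->
  {ae P, forall w, \forall k \near \oo,
     zmax T X l b e (y * psi (M k)) (m k) (M k - m k) (iter (m k) T w) < 1}.
Proof.
move=> mM eps0 eps1 s0 q1 e1 [k1 _ hq].
have [N0 _ hN0] := mean_zmax_tail eps0 eps1 s0.
have [k2 _ hk2] := level_unbounded A_nd rho1 hM N0.
pose k0 := (maxn 1 (maxn k1 k2))%N.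
pose C := expR (3 * eps - q * ln (ln rho)).
apply: (@ae_lt1_summable _ _ _ _ _ k0 (C * (1 + (q - 1)^-1))).
- by move=> k; exact/(bmeas_iter cs)/(bmeas_zmax b cs).
- by move=> k w; case/andP: (zmax01 T X l b e (y * psi (M k)) (m k) (M k - m k) (iter (m k) T w)).
move=> N; apply: le_trans (ler_wpM2l (expR_ge0 _) (p_series_bound q1 N)).
rewrite mulr_sumr; apply: ler_sum => k _.
have k0k : (k0 <= k0 + k)%N by rewrite leq_addr.
set kk := (k0 + k)%N in k0k *.
have kk1 : (1 + k <= kk)%N by rewrite /kk leq_add2r /k0 leq_maxl.
have hk2' : (N0 <= M kk)%N.
  apply/ltnW/hk2; rewrite /= (leq_trans _ k0k)// /k0.
  by rewrite !leq_max leqnn !orbT.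
have hq' := hq kk; rewrite /= (leq_trans _ k0k) in hq'; last first.
  by rewrite /k0 !leq_max leqnn !orbT.
rewrite (mean_iter cs); last exact: (bmeas_zmax b cs).
apply: le_trans (hN0 _ hk2' _ _ _ (mM kk) e1) _.
rewrite /C -expRD ler_expR.
have tk : 0 < t (M kk) by apply: lt_le_trans ltr01 (lil_time_ge1 _).
have h1 := ler_wpM2l (ltW tk) (hq' isT).
have kk0 : (0 < kk)%N by apply: leq_trans kk1; rewrite add1n.
have h2 : ln (1 + k)%:R + ln (ln rho) <= t (M kk).
  apply: le_trans (lil_time_level kk0); rewrite lerD2r ler_ln ?posrE ?ltr0n//.
  by rewrite ler_nat.
have q0 : 0 < q by lra.
have := ler_wpM2l (ltW q0) h2; lra.
Qed.

Lemma level_nd k : (M k <= M k.+1)%N.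
Proof.
rewrite leqNgt; apply/negP; have [h1 _] := hM k.+1.
have [_ h] := hM k => /h; apply/negP; rewrite -leNgt.
apply: le_trans h1; rewrite exprS ler_peMl ?(ltW rho1)//.
by rewrite exprn_ge0// (le_trans ler01 (ltW rho1)).
Qed.

End upper_bound.

Section lil_upper.
Context d (Om : measurableType d) (R : realType) (P : probability Om R).
Variables (T : Om -> Om) (X : Om -> R[i]) (l a : R[i]) (b : nat -> R[i]).
Hypothesis cs : circle_system P T X l a.
Hypothesis B_infty : sqnorm_sum b N @[N --> \oo] --> +oo.
Hypothesis b_small : sqnorm_max b N * L (L (sqnorm_sum b N)) / sqnorm_sum b N
    @[N --> \oo] --> (0 : R).
Local Notation A := (energy l b).
Local Notation psi := (lil_scale l b).
Let l1 := csl cs.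
Let A_nd m n : (m <= n)%N -> A m <= A n := @energy_nd _ _ b l1 m n.
Let A_oo := energy_cvg l1 B_infty.
Let A_step eta (eta0 : 0 < eta) := energy_step l1 B_infty b_small eta0.

Ltac goal_lra := clear -cs B_infty b_small l1 A_nd A_oo A_step; lra.

(** Between two levels M k <= N < M', the sum S_N is S_M' minus the block from N
    to M', up to one term of size |c_N|. The sum at the level is at most (1 +
    ep) psi by the maximal inequality with the optimal slope s = 2, and the
    increments in the opposite direction exceed ep psi only finitely often when
    the ratio rho of the levels is close enough to 1. *)
Theorem lil_upper (e : R[i]) (eps : R) : modulus e = 1 -> 0 < eps -> eps <= 1 ->
  {ae P, forall w, \forall N \near \oo,
    Re (e * orbit_sum T X b N w) <= (1 + eps) * psi N}.
Proof.
move=> e1 eps0 eps1.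
pose ep := eps / 7; pose dt := ep ^+ 2 / 16.
have ep0 : 0 < ep by rewrite divr_gt0.
have ep1 : ep <= 1 / 7 by rewrite /ep ler_pM2r ?invr_gt0.
have ep20 : 0 < ep ^+ 2 by rewrite exprn_gt0.
have ep2 : ep ^+ 2 <= ep / 7.
  by rewrite expr2 ler_pM2l// -div1r.
have dt0 : 0 < dt by rewrite divr_gt0.
have dt1 : dt <= 1 by rewrite /dt; lra.
pose rho := 1 + dt.
have rho1 : 1 < rho by rewrite /rho; lra.
have rho0 : 0 < rho by rewrite /rho; lra.
have rho2 : rho ^+ 2 <= 1 + 3 * dt.
  rewrite /rho; have : dt * dt <= 1 * dt by rewrite ler_pM2r.
  by rewrite expr2; lra.
have [M hM] := level_times A_oo rho.
have Mnd := level_nd rho1 hM.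
have e1' : modulus (- e) = 1 by rewrite modulusN.
(* With s = 2 and y = 1 + ep the exponent is at most - 2 (1 + ep) + (1 + ep) =
   - (1 + ep). *)
have Z1 : {ae P, forall w, \forall k \near \oo,
    zmax T X l b e ((1 + ep) * psi (M k)) 0 (M k - 0) (iter 0 T w) < 1}.
  apply: (ae_zmax_lt1 cs B_infty b_small rho1 hM (m := fun=> 0%N)
    (eps := ep) (s := 2) (q := 1 + ep)) => //; [lra|lra|].
  apply: nearW => k.
  have A0 : A 0%N = 0 by rewrite /energy big_nil mulr0.
  rewrite A0 subr0.
  have : A (M k) / A (M k) <= 1.
    by have [->|h] := eqVneq (A (M k)) 0; rewrite ?mul0r// divff.
  have -> : (2 : R) ^+ 2 / 4 = 1 by rewrite expr2; lra.
  rewrite mulr1 => h.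
  have := ler_wpM2l (_ : 0 <= 1 + ep) h; rewrite mulr1 => h'.
  have h2 : (1 + ep) * (A (M k) / A (M k)) <= 1 + ep by apply: h'; lra.
  lra.
(* With s = 4 / ep and y = ep the exponent is at most - 4 + 2 = - 2, as the
   energy between two levels is at most a fraction ep^2 / 4 of the total. The
   predecessor M k.-1 makes the block end at the level M k. *)
have Z2 : {ae P, forall w, \forall k \near \oo,
    zmax T X l b (- e) (ep * psi (M k)) (M k.-1) (M k - M k.-1) (iter (M k.-1) T w) < 1}.
  apply: (ae_zmax_lt1 cs B_infty b_small rho1 hM (m := fun k => M k.-1)
    (eps := 1) (s := 4 / ep) (q := 2)) => //.
  - by case.
  - by rewrite divr_gt0.
  - lra.
  have := level_upper A_nd A_step rho1 hM dt0.
  move=> h; near=> k.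
  have hk : A (M k) <= (1 + dt) * rho ^+ k by near: k.
  have k0 : (0 < k)%N by near: k; exists 1%N.
  have [hk1 _] := hM k; have [hk2 _] := hM k.-1.
  have rk : 0 < rho ^+ k by rewrite exprn_gt0.
  have Ak : 0 < A (M k) by apply: lt_le_trans hk1.
  have ratio : (A (M k) - A (M k.-1)) / A (M k) <= ep ^+ 2 / 4.
    rewrite ler_pdivrMr//.
    have h1 : A (M k) <= rho ^+ 2 * A (M k.-1).
      apply: le_trans hk _; rewrite -/rho -[in leLHS](prednK k0) exprS mulrA -expr2.
      by rewrite ler_pM2l// exprn_gt0.
    have h2 : A (M k) <= (1 + 3 * dt) * A (M k.-1).
      apply: le_trans h1 _; rewrite ler_wpM2r//.
      by apply: le_trans hk2; rewrite exprn_ge0// ltW.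
    have : 3 * dt * A (M k.-1) <= 3 * dt * A (M k).
      rewrite ler_pM2l ?mulr_gt0//.
      by have := Mnd k.-1; rewrite prednK// => /A_nd.
    have : 3 * dt * A (M k) <= ep ^+ 2 / 4 * A (M k).
      by rewrite ler_pM2r// /dt; lra.
    lra.
  have -> : (4 / ep) * ep = 4 by rewrite divfK// gt_eqF.
  have -> : (1 + 1) * ((4 / ep) ^+ 2 / 4) = 8 / ep ^+ 2 :> R.
    by field; rewrite gt_eqF.
  have e8 : 0 <= 8 / ep ^+ 2 by apply: divr_ge0 => //; exact: ltW.
  have := ler_wpM2l e8 ratio.
  rewrite (_ : 8 / ep ^+ 2 * (ep ^+ 2 / 4) = 2); last by field; rewrite gt_eqF.
  lra.
near=> w.
have z1 : \forall k \near \oo, zmax T X l b e ((1 + ep) * psi (M k)) 0 (M k - 0) (iter 0 T w) < 1.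
  by near: w.
have z2 : \forall k \near \oo, zmax T X l b (- e) (ep * psi (M k)) (M k.-1)
   (M k - M k.-1) (iter (M k.-1) T w) < 1 by near: w.
have [N0 _ hN0] := cpre_small l1 B_infty b_small ep20.
have : \forall k \near \oo, [/\ zmax T X l b e ((1 + ep) * psi (M k)) 0 (M k - 0) (iter 0 T w) < 1,
   zmax T X l b (- e) (ep * psi (M k)) (M k.-1) (M k - M k.-1) (iter (M k.-1) T w) < 1,
   (N0 < M k)%N & A (M k) <= (1 + dt) * rho ^+ k].
  near=> k; split; near: k => //; first exact: (level_unbounded A_nd rho1 hM N0).
  exact: (level_upper A_nd A_step rho1 hM dt0).
move=> [k0 _ hk0]; exists (M k0) => // N /= hN.
have [k [k0k MkN NMk]] := level_index A_nd rho1 hM hN.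
have [y1 y2 hk3 hk4] := hk0 k.+1 (leqW k0k).
set M' := M k.+1 in NMk y1 y2 hk3 hk4.
have M'0 : (0 < M')%N by apply: leq_ltn_trans NMk.
have := zmax_lt1 y1 (j := 0%N); rewrite !subn0 addn0 => /(_ M'0) /=.
rewrite block0 => S1.
have := zmax_lt1 y2 (j := (N - M k)%N); rewrite /= ltn_sub2r// => [/(_ isT)|]; last first.
  exact: leq_ltn_trans NMk.
rewrite subnKC// -iterD subnK// (_ : M' - M k - (N - M k) = M' - N)%N; last first.
  by rewrite subnBA// subnK// (leq_trans MkN)// ltnW.
move=> S2.
have := block_cat T X l b 0 N (M' - N) w; rewrite subnKC 1?ltnW// !block0 add0n => SE.
have cN : modulus (cpre l b N) <= ep * psi M'.
  have ps0 : 0 <= ep * psi M'.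
    by apply: mulr_ge0; [exact: ltW|exact: lil_scale_ge0].
  rewrite -(@ler_pXn2r _ 2)// ?nnegrE ?modulus_ge0//.
  rewrite exprMn; have := hN0 M' (ltnW hk3) N (ltnW NMk).
  have t1 := lil_time_ge1 l b M'.
  move=> hc; apply: (@le_trans _ _ (modulus (cpre l b N) ^+ 2 * lil_time l b M')).
    by rewrite ler_peMr ?sqr_ge0.
  by apply: le_trans hc _; rewrite ler_pM2l// (energy_le_scale b cs).
have ReX : Re (e * (l * cpre l b N * X (iter N T w))) <= ep * psi M'.
  rewrite (le_trans (ReleM _))// !modulusM e1 mul1r (csX cs) mulr1.
  by rewrite (le_trans _ cN)// ler_piMl ?modulus_ge0// (ltW l1).
have main : Re (e * orbit_sum T X b N w) <= (1 + 3 * ep) * psi M'.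
  move: S1; rewrite SE mulrDr mulrBr Re_add Re_sub.
  by move: S2 ReX; rewrite mulNr Re_opp; goal_lra.
apply: (le_trans main).
have AM : A M' <= (1 + ep) * A N.
  apply: le_trans hk4 _; rewrite -/rho exprS mulrA -expr2.
  have [hk1 _] := hM k; have AkN := A_nd MkN.
  have p0 : 0 < rho ^+ k by rewrite exprn_gt0.
  apply: (@le_trans _ _ ((1 + ep) * rho ^+ k)).
    by rewrite ler_pM2r//; apply: (le_trans rho2); rewrite /dt; lra.
  by rewrite ler_pM2l; [exact: le_trans AkN|move: ep0; goal_lra].
have := lil_scale_comp cs (ltW ep0) AM => hpsi.
have p0 : 0 <= 1 + 3 * ep by move: ep0; goal_lra.
apply: le_trans (ler_wpM2l p0 hpsi) _; rewrite mulrA ler_wpM2r//.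
  exact: lil_scale_ge0.
rewrite (_ : eps = 7 * ep); last by rewrite /ep; goal_lra.
by move: ep0 ep1; clear -cs B_infty b_small l1 A_nd A_oo A_step; nra.
Unshelve. all: by end_near. Qed.

End lil_upper.

(** * The converse Borel-Cantelli argument *)

Section reverse_borel_cantelli.
Context d (Om : measurableType d) (R : realType) (P : probability Om R).
Local Notation E := (mean P).

Lemma harmonic_unbounded (c C : R) (K : nat) : 0 < c ->
  exists n, C < \sum_(0 <= i < n) c / (K + i).+1%:R.
Proof.
move=> c0; apply: contrapT => hn.
have bnd n : \sum_(0 <= i < n) c / (K + i).+1%:R <= C.
  by rewrite leNgt; apply/negP => h; apply: hn; exists n.
apply: (@dvg_harmonic R).
apply: (@nondecreasing_is_cvgn R); first by apply: nondecreasing_series => n _ _; exact: harmonic_ge0.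
exists (\sum_(0 <= i < K) harmonic i + C / c) => _ [n _ <-].
apply: (@le_trans _ _ (series harmonic (K + n)%N)).
  by apply: (@nondecreasing_series R) => [k _ _|]; [exact: harmonic_ge0|exact: leq_addl].
rewrite /series /= (@big_cat_nat _ _ _ K 0 (K + n))//= ?leq_addr// lerD2l.
rewrite ler_pdivlMr// -{1}[K]add0n big_addn addKn mulr_suml.
apply: le_trans (bnd n); apply: ler_sum => i _.
by rewrite /harmonic /= mulrC addnC.
Qed.

(** Y k is the indicator of a miss. A product bound on consecutive misses stands
    in for independence: as the harmonic series diverges, the probability of
    missing forever from any index on is 0. *)
Lemma ae_infinitely_often (Y : nat -> Om -> R) (c : R) (K0 : nat) : 0 < c ->
  (forall k, bmeas (Y k)) -> (forall k w, Y k w = 0 \/ Y k w = 1) ->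
  (forall K n, (K0 <= K)%N -> E (fun w => \prod_(0 <= i < n) Y (K + i)%N w) <=
     \prod_(0 <= i < n) expR (- (c / (K + i).+1%:R))) ->
  {ae P, forall w, forall K, exists2 k, (K <= k)%N & Y k w = 0}.
Proof.
move=> c0 bY Y01 hE.
suff h K : {ae P, forall w, exists2 k, (K0 + K <= k)%N & Y k w = 0}.
  have : {ae P, forall w, forall K, exists2 k, (K0 + K <= k)%N & Y k w = 0}.
    exact: ae_foralln.
  apply: filterS => w hw K; have [k h1 h2] := hw K; exists k => //.
  by rewrite (leq_trans _ h1)// leq_addl.
pose B := \bigcap_(n in @setT nat) [set w | 1 <= \prod_(0 <= i < n) Y (K0 + K + i)%N w].
have bP n : bmeas (fun w => \prod_(0 <= i < n) Y (K0 + K + i)%N w) by exact: bmeas_prod.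
have mB : measurable B.
  by apply: bigcap_measurable => // n _; apply: measurable_ge; case: (bP n).
exists B; split => //.
- have PB n : (P B <= (expR (- \sum_(0 <= i < n) c / (K0 + K + i).+1%:R))%:E)%E.
    rewrite (mean_indic P mB) lee_fin.
    apply: (@le_trans _ _ (E (fun w => \prod_(0 <= i < n) Y (K0 + K + i)%N w))).
      apply: le_mean => //; first exact: bmeas_indic.
      move=> w; rewrite indicE; case: (boolP (w \in B)) => [|_].
        by rewrite inE => /(_ n I).
      by apply: prodr_ge0 => i _; case: (Y01 (K0 + K + i)%N w) => ->.
    apply: (le_trans (hE (K0 + K)%N n (leq_addr _ _))).
    by rewrite -sumrN expR_sum.
  have PB0 : (0 <= fine (P B)) by rewrite fine_ge0// measure_ge0.
  have PBf : P B = (fine (P B))%:E by rewrite fineK// fin_num_measure.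
  suff : fine (P B) = 0 by move=> h0; rewrite PBf h0.
  apply/eqP; rewrite eq_le PB0 andbT leNgt; apply/negP => PBp.
  have [n hn] := harmonic_unbounded (- ln (fine (P B))) (K0 + K) c0.
  have := PB n; rewrite PBf lee_fin leNgt => /negP; apply.
  by rewrite -[ltRHS]lnK ?posrE// ltr_expR ltrNl.
- move=> w /= hw n _ /=.
  rewrite big1 // => i _; case: (Y01 (K0 + K + i)%N w) => // h.
  by exfalso; apply: hw; exists (K0 + K + i)%N => //; rewrite leq_addr.
Qed.

End reverse_borel_cantelli.

(** * Conditional lower bounds for large deviations *)

Section large_deviation.
Context d (Om : measurableType d) (R : realType) (P : probability Om R).
Variables (T : Om -> Om) (X : Om -> R[i]) (l a : R[i]) (b : nat -> R[i]).
Hypothesis cs : circle_system P T X l a.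
Hypothesis B_infty : sqnorm_sum b N @[N --> \oo] --> +oo.
Hypothesis b_small : sqnorm_max b N * L (L (sqnorm_sum b N)) / sqnorm_sum b N
    @[N --> \oo] --> (0 : R).
Local Notation E := (mean P).
Local Notation A := (energy l b).
Local Notation t := (lil_time l b).
Local Notation psi := (lil_scale l b).
Local Notation block := (block T X l b).
Let l1 := csl cs.
Let A_oo := energy_cvg l1 B_infty.

Let bBlk u m K : bmeas (fun w => Re (u * block m K w)).
Proof. exact: (@bmeas_block _ _ _ _ _ _ _ _ b cs u m K). Qed.

Ltac goal_lra := clear -cs B_infty b_small l1 A_oo bBlk; lra.

(** Indicator that the block from m to N avoids the disc of radius eps psi
    around z psi; the squares keep it a polynomial condition on real and
    imaginary parts. *)
Definition miss (z : R[i]) (eps : R) m N w : R :=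
  ((eps * psi N) ^+ 2 <= modulus (block m (N - m) w - z * (psi N)%:C) ^+ 2)%R%:R.

Lemma miss01 z eps m N w : miss z eps m N w = 0 \/ miss z eps m N w = 1.
Proof. by rewrite /miss; case: ((eps * psi N) ^+ 2 <= _); [right|left]. Qed.

Lemma bmeas_miss z eps m N : bmeas (miss z eps m N).
Proof.
apply: bmeas_ge; under eq_fun do rewrite modulus_sqr Re_sub Im_sub.
have mR : measurable_fun setT (fun w => Re (block m (N - m) w)).
  by have [] := bBlk 1 m (N - m); under eq_fun do rewrite mul1r.
have mI : measurable_fun setT (fun w => Im (block m (N - m) w)).
  have [] := bBlk (- 'i) m (N - m); under eq_fun do
    rewrite mulNr Re_opp Re_mul /= mul0r mul1r sub0r opprK.
  by [].
by apply: measurable_funD; apply: measurable_funX; apply: measurable_funB.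
Qed.

(** For every v one of the four products has real part at least |v| / 2, so four
    half-planes at distance s / 2 from the origin cover the outside of the disc
    of radius s. *)
Definition quads : seq R[i] := [:: 1; -1; 'i; - 'i].

Lemma modulus_quads e : e \in quads -> modulus e = 1.
Proof.
have mi : modulus ('i : R[i]) = 1 by rewrite modulusE /= expr0n expr1n add0r sqrtr1.
by rewrite !inE => /or4P[] /eqP ->; rewrite ?modulusN ?modulus1 ?mi.
Qed.

Lemma quads_cover (v : R[i]) (s : R) : s <= modulus v ->
  exists2 e, e \in quads & s / 2 <= Re (e * v).
Proof.
move=> h; have := le_trans h (modulus_le_ReIm v) => h2.
have ReI : Re ('i * v) = - Im v by rewrite Re_mul /=; ring.
have [hr|hr] := leP (s / 2) `|Re v|.
  have [v0|v0] := leP 0 (Re v).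
    exists 1; first by rewrite !inE eqxx.
    by rewrite mul1r; rewrite ger0_norm in hr.
  exists (-1); first by rewrite !inE eqxx orbT.
  by rewrite mulN1r Re_opp; rewrite ltr0_norm in hr.
have hi : s / 2 <= `|Im v| by lra.
have [v0|v0] := leP 0 (Im v).
  exists (- 'i); first by rewrite !inE eqxx !orbT.
  by rewrite mulNr Re_opp ReI opprK; rewrite ger0_norm in hi.
exists 'i; first by rewrite !inE eqxx !orbT.
by rewrite ReI; rewrite ltr0_norm in hi.
Qed.

Lemma lil_time_cvg (C : R) : \forall N \near \oo, C <= t N.
Proof.
have h : (fun N => L (L (A N))) @ \oo --> +oo.
  exact: (cvg_comp (fun N => A N) (fun x => L (L x)) A_oo (@LL_cvg_pinfty R)).
by move/cvgryPge : h => /(_ C).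
Qed.

(** Exponential tilting. Under the weight F v = exp (tau Re (v V)) with v = 2
    conj z, the block V concentrates around z psi: leaving the disc forces V
    into one of four half-planes, and the Markov inequality with v moved by eps
    e leaves in each of them a fraction of the tilted mass of the order of exp
    (- eps^2 t / 8). So at least half of the tilted mass lies in the disc, where
    the weight is at most exp ((2 |z|^2 + 2 eps) t), while the total tilted mass
    is about exp (|z|^2 t). The quotient is the conditional probability of a
    hit. *)
Lemma miss_upper (z : R[i]) (eps : R) : modulus z <= 1 -> 0 < eps -> eps <= 1 ->
  \forall N \near \oo, forall m, (m <= N)%N -> A m <= eps ^+ 2 / 16 * A N ->
  forall g, bmeas g -> (forall w, 0 <= g w) ->
  E (fun w => miss z eps m N w * g (iter (N - m) T w)) <=
  (1 - expR (- 2 - (modulus z ^+ 2 + 3 * eps) * t N)) * E g.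
Proof.
move=> z1 eps0 eps1.
pose ep := eps ^+ 2 / 64; pose th := eps ^+ 2 / 16.
have e2 : 0 < eps ^+ 2 by rewrite exprn_gt0.
have ep0 : 0 < ep by rewrite divr_gt0.
have e21 : eps ^+ 2 <= eps by rewrite expr2 ler_piMl// ltW.
have ep1 : ep <= 1 / 64 by rewrite /ep ler_pM2r ?invr_gt0//; exact: le_trans e21 eps1.
have [dl dl0 mgf] := @mgf_block _ _ _ _ _ _ _ _ b cs _ ep0.
have eta0 : 0 < (dl / 3) ^+ 2 by rewrite exprn_gt0// divr_gt0.
near=> N => m mN Am g bg g0.
have AN : 0 < A N by near: N; exact: (energy_gt0 cs B_infty).
have hc : forall n, (n <= N)%N -> modulus (cpre l b n) ^+ 2 * t N <= (dl / 3) ^+ 2 * A N.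
  by near: N; exact: (cpre_small l1 B_infty b_small eta0).
have t1 := lil_time_ge1 l b N.
have t0 : 0 < t N by exact: lt_le_trans t1.
have tbig : 64 / eps ^+ 2 <= t N by near: N; exact: lil_time_cvg.
pose tau := Num.sqrt (t N / A N).
have tau0 : 0 <= tau := sqrtr_ge0 _.
have tau2 : tau ^+ 2 = t N / A N by rewrite sqr_sqrtr// divr_ge0// ltW.
have taup : tau * psi N = t N.
  rewrite /tau /lil_scale -sqrtrM ?divr_ge0 ?(ltW t0) ?(ltW AN)//.
  rewrite (_ : t N / A N * _ = t N ^+ 2); last by field; rewrite gt_eqF.
  by rewrite sqrtr_sqr ger0_norm// ltW.
set K := (N - m)%N.
have Eg : 0 <= E g by exact: mean_ge0.
pose q := (A N - A m) / A N.
have q1 : q <= 1.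
  by rewrite ler_pdivrMr// mul1r lerBlDr lerDl (energy_ge0 b l1).
have qth : 1 - th <= q.
  rewrite ler_pdivlMr// mulrBl mul1r; have := Am; rewrite -/th; goal_lra.
have th1 : th <= 1 by move: e21 eps1; rewrite /th; goal_lra.
have th0 : 0 <= th by rewrite divr_ge0// ltW.
pose F (v : R[i]) w := expR (tau * Re (v * block m K w)).
have FE v w : F v w = expR (Re (tau%:C * v * block m K w)).
  by rewrite /F -mulrA Re_scale.
have bF v : bmeas (F v).
  rewrite (_ : F v = fun w => expR (Re (tau%:C * v * block m K w))).
    exact/bmeas_exp/bBlk.
  by apply/funext => w; exact: FE.
have bgT : bmeas (fun w => g (iter K T w)) by exact: (bmeas_iter cs).
(* With tau^2 = t / A, and with a fraction q of the energy close to 1, the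
   exponential moment of Re (v V) is about exp (|v|^2 t / 4). *)
have mgfF v : modulus v <= 3 ->
   expR ((1 - ep) * (modulus v ^+ 2 / 4 * (t N * q)) - ep) * E g <=
   E (fun w => F v w * g (iter K T w)) <=
   expR ((1 + ep) * (modulus v ^+ 2 / 4 * (t N * q)) + ep) * E g.
  move=> v3; have hu n : (n <= m + K)%N ->
      modulus (tau%:C * v) * modulus (cpre l b n) <= dl.
    rewrite subnKC// => nN; rewrite modulusM modulusC (ger0_norm tau0).
    have h1 : tau * modulus v * modulus (cpre l b n) <= 3 * (tau * modulus (cpre l b n)).
      rewrite mulrAC mulrC; apply: ler_wpM2r => //.
      by rewrite mulr_ge0 ?modulus_ge0.
    apply: (le_trans h1); rewrite mulrC -ler_pdivlMr//.
    have tc0 : 0 <= tau * modulus (cpre l b n) by rewrite mulr_ge0 ?modulus_ge0.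
    have d30 : 0 <= dl / 3 by rewrite divr_ge0// ltW.
    rewrite -(@ler_pXn2r _ 2)// ?nnegrE//.
    rewrite exprMn tau2 mulrAC mulrC [t N * _]mulrC.
    rewrite mulrC ler_pdivrMr//; exact: hc.
  have := mgf m K (tau%:C * v) hu g bg g0.
  rewrite modulusM modulusC (ger0_norm tau0) exprMn tau2 subnKC//.
  have -> : t N / A N * modulus v ^+ 2 / 4 * (A N - A m) = modulus v ^+ 2 / 4 * (t N * q).
    by rewrite /q; ring.
  by under [E (fun w => F v w * _)]eq_mean do rewrite FE.
pose gT w := g (iter K T w).
have gT0 w : 0 <= gT w by exact: g0.
pose V w := block m K w.
pose v := 2 * z^*.
have vz : modulus v = 2 * modulus z.
  by rewrite modulusM modulus_conj -(rmorph_nat (real_complex R)) modulusC ger0_norm.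
have z0 := modulus_ge0 z.
have z2 : modulus z ^+ 2 <= 1 by rewrite expr_le1.
have z20 : 0 <= modulus z ^+ 2 by rewrite sqr_ge0.
have [Rev Imv] : Re v = 2 * Re z /\ Im v = - (2 * Im z).
  by rewrite /v -(rmorph_nat (real_complex R)) Re_scale Re_conjc Im_mul Im_conjc /=; split; ring.
pose x := modulus z ^+ 2.
pose Lam := expR (t N * (x - ep - th) - ep).
have low : Lam * E g <= E (fun w => F v w * gT w).
  have v3 : modulus v <= 3 by rewrite vz; move: z1; goal_lra.
  have /andP[h _] := mgfF v v3; apply: le_trans h; rewrite ler_wpM2r// ler_expR.
  rewrite vz exprMn (_ : 2 ^+ 2 * modulus z ^+ 2 / 4 = x); last by rewrite /x; field.
  rewrite lerD2r (_ : (1 - ep) * _ = t N * (x * ((1 - ep) * q))); last by ring.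
  rewrite ler_pM2l//.
  have h1 : (1 - ep) * (1 - th) <= (1 - ep) * q.
    by rewrite ler_wpM2l//; move: ep1; goal_lra.
  have h2 : 1 - (ep + th) <= (1 - ep) * q.
    apply: le_trans h1; have : 0 <= ep * th by rewrite mulr_ge0// ltW.
    by goal_lra.
  have h3 : x * (1 - (ep + th)) <= x * ((1 - ep) * q) by rewrite ler_wpM2l.
  have h4 : x * (ep + th) <= ep + th by rewrite ler_piMl// addr_ge0// ltW.
  by move: h3 h4; goal_lra.
pose hp e w : R := (eps / 2 * psi N <= Re (e * (V w - z * (psi N)%:C)))%R%:R.
have psi0 := lil_scale_ge0 l b N.
(* Markov inequality under the tilted measure: e is the inner normal of the
   half-plane. *)
have halfplane e w : e \in quads ->
    hp e w * F v w <= expR (- (t N * eps * (Re (e * z) + eps / 2))) * F (v + eps%:C * e) w.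
  move=> eq; rewrite /hp; case: (boolP (eps / 2 * psi N <= _)) => [h|_]; last first.
    by rewrite mul0r; apply: mulr_ge0; exact: expR_ge0.
  rewrite mul1r /F -expRD ler_expR -/(V w).
  have -> : Re ((v + eps%:C * e) * V w) = Re (v * V w) + eps * Re (e * V w).
    by rewrite mulrDl Re_add -(mulrA eps%:C) Re_scale.
  move: h; rewrite mulrBr Re_sub mulrA [e * z * _]mulrC Re_scale => h.
  have h2 := ler_wpM2l (mulr_ge0 tau0 (ltW eps0)) h.
  rewrite -taup; move: h2; move: (Re (e * V w)) (Re (v * V w)) (Re (e * z)) => r1 r2 r3.
  by goal_lra.
have bhp e : bmeas (hp e).
  apply: bmeas_ge; under eq_fun do rewrite mulrBr Re_sub.
  by apply: measurable_funB => //; case: (bBlk e m K).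
have bmiss := bmeas_miss z eps m N.
have miss_le w : miss z eps m N w <= \sum_(e <- quads) hp e w.
  rewrite /miss; case: (boolP ((eps * psi N) ^+ 2 <= _)) => [h|_]; last first.
    by apply: sumr_ge0 => e _; rewrite /hp ler0n.
  have : eps * psi N <= modulus (V w - z * (psi N)%:C).
    rewrite -(@ler_pXn2r _ 2)// ?nnegrE ?modulus_ge0//.
    by rewrite mulr_ge0// ltW.
  move/quads_cover => [e eq he].
  rewrite (big_rem e eq) /= {1}/hp (_ : eps / 2 * psi N <= _); last first.
    by apply: le_trans he; rewrite mulrAC.
  by rewrite lerDl; apply: sumr_ge0 => e' _; rewrite /hp ler0n.
have bad : E (fun w => miss z eps m N w * F v w * gT w) <=
   4 * expR (t N * (x - eps ^+ 2 / 4 + 3 * ep) + ep) * E g.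
  have bsum e : bmeas (fun w => hp e w * F v w * gT w) by do 2 apply: bmeasM => //.
  apply: (@le_trans _ _ (E (fun w => \sum_(e <- quads) hp e w * F v w * gT w))).
    apply: le_mean; first by do 2 apply: bmeasM => //.
      exact: bmeas_sum.
    by move=> w; rewrite -!mulr_suml; do 2 apply: ler_wpM2r => //; exact: expR_ge0.
  rewrite mean_sum//.
  have -> : 4 * expR (t N * (x - eps ^+ 2 / 4 + 3 * ep) + ep) * E g =
     \sum_(e <- quads) expR (t N * (x - eps ^+ 2 / 4 + 3 * ep) + ep) * E g.
    by rewrite !big_cons big_nil; ring.
  rewrite big_seq [leRHS]big_seq; apply: ler_sum => e eq.
  have e1 := modulus_quads eq.
  apply: (@le_trans _ _ (expR (- (t N * eps * (Re (e * z) + eps / 2))) *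
     E (fun w => F (v + eps%:C * e) w * gT w))).
    have bFg : bmeas (fun w => F (v + eps%:C * e) w * gT w) by exact: bmeasM.
    rewrite -meanZ//; apply: le_mean => //; first exact: bmeasZ.
    by move=> w; rewrite mulrA ler_wpM2r//; exact: halfplane.
  have v3 : modulus (v + eps%:C * e) <= 3.
    rewrite (le_trans (modulusD _ _))// modulusM modulusC e1 mulr1 (ger0_norm (ltW eps0)).
    by rewrite vz; move: z1 eps1; goal_lra.
  have /andP[_ h] := mgfF _ v3.
  apply: le_trans (ler_wpM2l (expR_ge0 _) h) _.
  rewrite (mulrA (expR _)) -expRD ler_wpM2r// ler_expR.
  pose y := Re (e * z).
  have ye : `|y| <= modulus z by rewrite (le_trans (Re_le_modulus _))// modulusM e1 mul1r.
  have -> : modulus (v + eps%:C * e) ^+ 2 / 4 = x + eps * y + eps ^+ 2 / 4.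
    rewrite modulus_sqr Re_add Im_add Re_scale Rev Imv /x modulus_sqr /y Re_mul.
    have -> : Im (eps%:C * e) = eps * Im e by rewrite Im_mul /= mul0r addr0.
    have : Re e ^+ 2 + Im e ^+ 2 = 1 by rewrite -modulus_sqr e1 expr1n.
    move: (Re e) (Im e) (Re z) (Im z) => c1 c2 c3 c4 hc12.
    have hh : eps ^+ 2 * (c1 ^+ 2 + c2 ^+ 2) = eps ^+ 2 by rewrite hc12 mulr1.
    by move: hh; goal_lra.
  pose Y := x + eps * y + eps ^+ 2 / 4.
  have Y0 : 0 <= Y.
    have : - modulus z <= y by move: ye; rewrite ler_norml => /andP[].
    move=> hy; have := ler_wpM2l (ltW eps0) hy => hy2.
    by have := sqr_ge0 (modulus z - eps / 2); move: hy2; rewrite /Y /x; goal_lra.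
  have Y3 : Y <= 3.
    have : y <= modulus z by move: ye; rewrite ler_norml => /andP[].
    move=> hy; have := ler_wpM2l (ltW eps0) hy => hy2.
    have : eps * modulus z <= 1 by rewrite mulr_ile1// ltW.
    by move: hy2 e21 eps1 z2; rewrite /Y /x; goal_lra.
  rewrite -/y -/Y.
  have hY : (1 + ep) * (Y * q) <= Y + 3 * ep.
    have h1 : Y * q <= Y by rewrite ler_piMr.
    have h2 : (1 + ep) * (Y * q) <= (1 + ep) * Y.
      by rewrite ler_wpM2l//; move: ep0; goal_lra.
    have h3 : ep * Y <= ep * 3 by rewrite ler_pM2l.
    by move: h2 h3; goal_lra.
  by have := ler_wpM2l (ltW t0) hY; rewrite /Y; goal_lra.
have tb : 8 <= t N * (eps ^+ 2 / 8).
  by move: tbig; rewrite ler_pdivrMr//; goal_lra.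
have bad2 : E (fun w => miss z eps m N w * F v w * gT w) <= Lam / 2 * E g.
  apply: (le_trans bad); rewrite ler_wpM2r//.
  have -> : Lam = expR (t N * (x - eps ^+ 2 / 4 + 3 * ep) + ep) *
      expR (t N * (eps ^+ 2 / 8) - 2 * ep).
    by rewrite /Lam -expRD; congr (expR _); rewrite /ep /th; field.
  rewrite mulrC -mulrA; apply: ler_wpM2l; first exact: expR_ge0.
  by have := expR_ge1Dx (t N * (eps ^+ 2 / 8) - 2 * ep); move: tb ep1; goal_lra.
have good : Lam / 2 * E g <= E (fun w => (1 - miss z eps m N w) * F v w * gT w).
  have -> : (fun w => (1 - miss z eps m N w) * F v w * gT w) =
     (fun w => F v w * gT w - miss z eps m N w * F v w * gT w).
    by apply/funext => w; ring.
  rewrite meanB; [by move: low bad2; goal_lra|exact: bmeasM|by do 2 apply: bmeasM => //].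
(* On the disc, Re (v V) differs from 2 |z|^2 psi by at most 2 eps psi. *)
have cap w : (1 - miss z eps m N w) * F v w <=
    expR (t N * (2 * x + 2 * eps)) * (1 - miss z eps m N w).
  rewrite /miss; case: (boolP ((eps * psi N) ^+ 2 <= _)) => [_|h]; first by rewrite subrr mul0r mulr0.
  rewrite subr0 mul1r mulr1 /F ler_expR.
  have d1 : modulus (V w - z * (psi N)%:C) <= eps * psi N.
    rewrite -(@ler_pXn2r _ 2)// ?nnegrE ?modulus_ge0//; last by rewrite mulr_ge0// ltW.
    by move: h; rewrite -ltNge => /ltW.
  have -> : block m K w = z * (psi N)%:C + (V w - z * (psi N)%:C) by rewrite addrC subrK.
  rewrite mulrDr Re_add.
  have -> : Re (v * (z * (psi N)%:C)) = 2 * x * psi N.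
    rewrite mulrA [v * z * _]mulrC Re_scale Re_mul Rev Imv /x modulus_sqr; ring.
  have d2 : Re (v * (V w - z * (psi N)%:C)) <= 2 * (eps * psi N).
    rewrite (le_trans (ReleM _))// modulusM; apply: ler_pM => //; rewrite ?modulus_ge0//.
    by rewrite vz; move: z1; goal_lra.
  have d3 := ler_wpM2l tau0 d2.
  by move: d3; rewrite -taup; goal_lra.
have goodT : expR (- 2 - (x + 3 * eps) * t N) * E g <= E (fun w => (1 - miss z eps m N w) * gT w).
  have bg1 : bmeas (fun w => (1 - miss z eps m N w) * gT w).
    by apply: bmeasM => //; apply: bmeasB => //; exact: bmeas_cst.
  have h1 : Lam / 2 * E g <= expR (t N * (2 * x + 2 * eps)) * E (fun w => (1 - miss z eps m N w) * gT w).
    apply: (le_trans good); rewrite -meanZ//; apply: le_mean.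
    - apply: bmeasM => //; apply: bmeasM => //; apply: bmeasB => //; exact: bmeas_cst.
    - exact: bmeasZ.
    - by move=> w; rewrite mulrA ler_wpM2r.
  rewrite -(ler_pM2l (expR_gt0 (t N * (2 * x + 2 * eps)))).
  apply: le_trans h1; rewrite mulrA ler_wpM2r// -expRD.
  rewrite ler_pdivlMr//.
  apply: (@le_trans _ _ (expR (t N * (2 * x + 2 * eps) + (- 2 - (x + 3 * eps) * t N)) * expR 1)).
    by rewrite ler_wpM2l ?expR_ge0//; have := expR_ge1Dx (1 : R); goal_lra.
  rewrite -expRD ler_expR.
  have h5 : ep + th <= eps by move: e21 e2; rewrite /ep /th; goal_lra.
  by have := ler_wpM2l (ltW t0) h5; move: ep1; goal_lra.
have -> : (fun w => miss z eps m N w * g (iter (N - m) T w)) =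
   (fun w => gT w - (1 - miss z eps m N w) * gT w).
  by apply/funext => w; rewrite /gT -/K; ring.
rewrite meanB//; last by apply: bmeasM => //; apply: bmeasB => //; exact: bmeas_cst.
have -> : E gT = E g by exact: (mean_iter cs).
by move: goodT; rewrite -/x; goal_lra.
Unshelve. all: by end_near. Qed.

End large_deviation.

(** * The lower half of the law *)

Lemma expR1_le4 (R : realType) : expR 1 <= (4 : R).
Proof.
rewrite [X in expR X](_ : _ = 1 / 2 + 1 / 2); last by lra.
rewrite expRD -expr2.
have h : 0 < 1 - (1 / 2) :> R by lra.
have : expR (1 / 2) <= (2 : R).
  have := expR_ge1Dx (- (1 / 2) : R); rewrite expRN => h1.
  have e0 := expR_gt0 (1 / 2 : R).
  have : (1 / 2) * expR (1 / 2) <= (1 : R).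
    have := ler_wpM2r (ltW e0) h1; rewrite mulVf ?gt_eqF//; lra.
  lra.
have := expR_ge0 (1 / 2 : R); rewrite expr2; nra.
Qed.

Section lil_lower.
Context d (Om : measurableType d) (R : realType) (P : probability Om R).
Variables (T : Om -> Om) (X : Om -> R[i]) (l a : R[i]) (b : nat -> R[i]).
Hypothesis cs : circle_system P T X l a.
Hypothesis B_infty : sqnorm_sum b N @[N --> \oo] --> +oo.
Hypothesis b_small : sqnorm_max b N * L (L (sqnorm_sum b N)) / sqnorm_sum b N
    @[N --> \oo] --> (0 : R).
Local Notation E := (mean P).
Local Notation A := (energy l b).
Local Notation t := (lil_time l b).
Local Notation psi := (lil_scale l b).
Let l1 := csl cs.
Let A_nd m n : (m <= n)%N -> A m <= A n := @energy_nd _ _ b l1 m n.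
Let A_oo := energy_cvg l1 B_infty.
Let A_step eta (eta0 : 0 < eta) := energy_step l1 B_infty b_small eta0.

Section levels.
Variables (rho : R) (M : nat -> nat).
Hypothesis rho4 : 4 <= rho.
Hypothesis hM : forall k, rho ^+ k <= A (M k) /\ forall N, (N < M k)%N -> A N < rho ^+ k.

Let rho1 : 1 < rho. Proof. by apply: lt_le_trans rho4; rewrite ltr1n. Qed.
Let rho0 : 0 < rho. Proof. exact: lt_trans rho1. Qed.

Lemma level_homo m n : (m <= n)%N -> (M m <= M n)%N.
Proof.
elim: n => [|n IH]; first by rewrite leqn0 => /eqP ->.
rewrite leq_eqVlt => /orP[/eqP -> //|/IH h]; exact: leq_trans h (level_nd rho1 hM n).
Qed.

Lemma ln_rho_ge1 : 1 <= ln rho.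
Proof.
rewrite -[leLHS](@expRK R) ler_ln ?posrE ?expR_gt0//.
exact: le_trans (expR1_le4 R) rho4.
Qed.

(** The converse of lil_time_level: the conditional probability of a hit at the
    k-th level is at least of the order of 1 / k. *)
Lemma lil_time_level_upper : \forall k \near \oo,
  expR (- t (M k.+1)) >= (k.+1%:R)^-1 / (2 * ln rho).
Proof.
have r1 := ln_rho_ge1; have rr1 := rho1; have rr0 := rho0.
have [k0 _ hk0] := level_upper A_nd A_step rho1 hM ltr01.
exists (maxn k0 2) => // k /= hk.
have [h1 h2] : (k0 <= k.+1)%N /\ (2 <= k)%N.
  by move: hk; rewrite geq_max => /andP[h1 ->]; split => //; exact: leqW.
have hA : A (M k.+1) <= rho ^+ k.+2.
  apply: le_trans (hk0 _ h1) _; rewrite [leRHS]exprS ler_pM2r ?exprn_gt0//.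
  by apply: le_trans rho4; lra.
have pos : 0 < k.+2%:R * ln rho by rewrite mulr_gt0//; lra.
have ht : t (M k.+1) <= ln (k.+2%:R * ln rho).
  rewrite -[leRHS]LE; last first.
    apply: le_trans (expR1_le4 R) _; apply: (@le_trans _ _ (k.+2%:R * 1)).
      by rewrite mulr1 ler_nat.
    by rewrite ler_pM2l// ltr0n.
  apply: le_L; apply: le_trans (le_L hA) _.
  rewrite LE; first by rewrite lnXn// mulr_natl.
  apply: le_trans (expR1_le4 R) _; apply: (le_trans rho4).
  by rewrite exprS ler_peMr ?(ltW rr0)// exprn_ege1// ltW.
apply: (@le_trans _ _ (expR (- ln (k.+2%:R * ln rho)))); last by rewrite ler_expR lerN2.
rewrite expRN lnK ?posrE//.
rewrite [leLHS](_ : _ = (2 * k.+1%:R * ln rho)^-1); last first.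
  by rewrite !invfM; ring.
have l0 : 0 < ln rho by lra.
have p2 : 0 < 2 * k.+1%:R * ln rho by rewrite !mulr_gt0// ltr0n.
rewrite lef_pV2 ?posrE// ler_pM2r// -natrM ler_nat mul2n -addnn.
by rewrite addnS ltnS addSn ltnS leq_addr.
Qed.

End levels.

Ltac goal_only := clear -cs B_infty b_small l1 A_nd A_oo A_step.
Ltac goal_lra := goal_only; lra.

(** When rho is large, the energy at the level k is negligible compared with
    that at the level k + 1, so S at the higher level is the block between the
    levels up to 2 eps psi: the upper half of the law bounds S at the lower
    level, and the doubly counted past is small. The blocks hit the disc
    infinitely often, by miss_upper and the converse Borel-Cantelli argument. *)
Theorem lil_lower (z : R[i]) (eps : R) : 0 < eps -> modulus z ^+ 2 + 3 * eps <= 1 ->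
  {ae P, forall w, forall K, exists2 N, (K <= N)%N &
    modulus (orbit_sum T X b N w - z * (psi N)%:C) <= 3 * eps * psi N}.
Proof.
move=> eps0 gam1.
have z20 : 0 <= modulus z ^+ 2 by rewrite sqr_ge0.
have z0 := modulus_ge0 z.
have eps1 : eps <= 1 by lra.
have z1 : modulus z <= 1.
  by rewrite -(@expr_le1 _ 2)//; lra.
have e2 : 0 < eps ^+ 2 by rewrite exprn_gt0.
have e21 : eps ^+ 2 <= 1 by rewrite expr_le1// ltW.
(* The overshoot factor of a level is at most 2, whence A (M k) <= 2 rho^k <=
   (eps^2 / 16) A (M k.+1), with room to spare; this matches the hypothesis of
   miss_upper and gives 4 psi (M k) <= eps psi (M k.+1). *)
pose rho := 64 / eps ^+ 2.
have rho64 : 64 <= rho by rewrite ler_pdivlMr// ler_piMr.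
have rho4 : 4 <= rho by apply: le_trans rho64; rewrite ler_nat.
have rho1 : 1 < rho by apply: lt_le_trans rho4; rewrite ltr1n.
have rho0 : 0 < rho by lra.
have [M hM] := level_times A_oo rho.
have Mh := level_homo rho4 hM.
have lr1 := ln_rho_ge1 rho4.
pose Y k w := miss T X l b z eps (M k) (M k.+1) (iter (M k) T w).
pose c := expR (- 2) / (2 * ln rho).
have c0 : 0 < c by rewrite divr_gt0 ?expR_gt0// mulr_gt0//; lra.
have [N0 _ hN0] := miss_upper cs B_infty b_small z1 eps0 eps1.
have small : \forall k \near \oo, A (M k) <= eps ^+ 2 / 16 * A (M k.+1).
  have := level_upper A_nd A_step rho1 hM ltr01; apply: filterS => k h.
  have [h2 _] := hM k.+1; apply: (le_trans h).
  rewrite exprS in h2; have h3 : 0 < eps ^+ 2 / 16 by rewrite divr_gt0.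
  have := ler_wpM2l (ltW h3) h2; apply: le_trans.
  rewrite mulrA ler_pM2r ?exprn_gt0// (_ : eps ^+ 2 / 16 * rho = 4); first by lra.
  by rewrite /rho; field; rewrite gt_eqF.
have one k : (N0 <= M k.+1)%N -> A (M k) <= eps ^+ 2 / 16 * A (M k.+1) ->
    (k.+1%:R)^-1 / (2 * ln rho) <= expR (- t (M k.+1)) ->
    forall g, bmeas g -> (forall w, 0 <= g w) ->
    E (fun w => miss T X l b z eps (M k) (M k.+1) w * g (iter (M k.+1 - M k) T w)) <=
    expR (- (c / k.+1%:R)) * E g.
  move=> k1 k2 k3 g bg g0.
  apply: le_trans (hN0 _ k1 _ (Mh _ _ (leqnSn k)) k2 g bg g0) _.
  rewrite ler_wpM2r ?mean_ge0//.
  apply: le_trans (expR_ge1Dx _); rewrite lerD2l lerN2.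
  apply: (@le_trans _ _ (expR (- 2) * expR (- t (M k.+1)))).
    rewrite /c -mulrA ler_pM2l ?expR_gt0//; apply: le_trans k3.
    by rewrite mulrC.
  rewrite -expRD ler_expR lerD2l lerN2 ler_piMl//.
  by rewrite (le_trans ler01)// lil_time_ge1.
have [k0 _ hk0] : \forall k \near \oo, [/\ (N0 <= M k.+1)%N,
    A (M k) <= eps ^+ 2 / 16 * A (M k.+1) &
    (k.+1%:R)^-1 / (2 * ln rho) <= expR (- t (M k.+1))].
  near=> k; split; near: k => //; last exact: (lil_time_level_upper rho4 hM).
  have := level_unbounded A_nd rho1 hM N0; apply: filterS => k /ltnW h.
  exact: leq_trans h (Mh _ _ (leqnSn k)).
have bm k := @bmeas_miss _ _ _ _ _ _ _ _ b cs z eps (M k) (M k.+1).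
have ioY : {ae P, forall w, forall K, exists2 k, (K <= k)%N & Y k w = 0}.
  apply: (@ae_infinitely_often _ _ _ P Y c k0 c0).
  - by move=> k; exact/(bmeas_iter cs)/bm.
  - by move=> k w; exact: miss01.
  move=> K n hK.
  (* The misses from the level K on, seen from time M K. The first of them is a
     block up to the time M K.+1, and the others depend on T^(M K.+1) only, so
     the estimate conditional on the future applies. *)
  pose Q K n w := \prod_(0 <= i < n) miss T X l b z eps (M (K + i)%N) (M (K + i).+1)
     (iter (M (K + i)%N - M K) T w).
  have bQ K' n' : bmeas (Q K' n').
    by apply: bmeas_prod => i; exact/(bmeas_iter cs)/bm.
  have Q0 K' n' w : 0 <= Q K' n' w.
    by apply: prodr_ge0 => i _; case: (miss01 T X l b z eps (M (K' + i)%N) (M (K' + i).+1) (iter (M (K' + i)%N - M K') T w)) => ->.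
  have -> : E (fun w => \prod_(0 <= i < n) Y (K + i)%N w) = E (Q K n).
    rewrite -(mean_iter cs (M K) (bQ K n)); apply: eq_mean => w.
    apply: eq_bigr => i _; rewrite /Y -iterD subnK//.
    by apply: Mh; rewrite leq_addr.
  elim: n K hK => [|n IH] K hK.
    rewrite big_nil (_ : Q K 0%N = cst 1); first by rewrite mean_cst.
    by apply/funext => w; rewrite /Q big_nil.
  rewrite big_nat_recl//.
  have -> : Q K n.+1 = fun w => miss T X l b z eps (M K) (M K.+1) w *
      Q K.+1 n (iter (M K.+1 - M K) T w).
    apply/funext => w; rewrite /Q big_nat_recl// addn0 subnn; congr (_ * _).
    apply: eq_bigr => i _; rewrite addnS addSn -iterD; congr (miss _ _ _ _ _ _ _ _ (iter _ _ _)).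
    rewrite addnBA; last exact: Mh.
    by rewrite subnK//; apply: Mh; rewrite ltnS leq_addr.
  have [h1 h2 h3] := hk0 K hK.
  apply: le_trans (one K h1 h2 h3 _ (bQ _ _) (Q0 _ _)) _.
  rewrite addn0 ler_wpM2l ?expR_ge0//; apply: le_trans (IH K.+1 (leqW hK)) _.
  by under eq_bigr do rewrite addSnnS.
have up e : modulus e = 1 -> {ae P, forall w, \forall N \near \oo,
    Re (e * orbit_sum T X b N w) <= (1 + 1) * psi N}.
  by move=> e1; exact: (lil_upper cs B_infty b_small e1 ltr01).
have mi : modulus ('i : R[i]) = 1 by rewrite modulusE /= expr0n expr1n add0r sqrtr1.
have u1 := up 1 (modulus1 R).
have u2 := up (-1) (etrans (modulusN _) (modulus1 R)).
have u3 := up 'i mi.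
have u4 := up (- 'i) (etrans (modulusN _) mi).
near=> w => K.
have v1 : \forall N \near \oo, Re (1 * orbit_sum T X b N w) <= (1 + 1) * psi N by near: w.
have v2 : \forall N \near \oo, Re (-1 * orbit_sum T X b N w) <= (1 + 1) * psi N by near: w.
have v3 : \forall N \near \oo, Re ('i * orbit_sum T X b N w) <= (1 + 1) * psi N by near: w.
have v4 : \forall N \near \oo, Re (- 'i * orbit_sum T X b N w) <= (1 + 1) * psi N by near: w.
have io : forall K, exists2 k, (K <= k)%N & Y k w = 0 by near: w.
have [n0 _ hn0] : \forall N \near \oo, modulus (orbit_sum T X b N w) <= 4 * psi N.
  near=> N.
  have w1 : Re (1 * orbit_sum T X b N w) <= (1 + 1) * psi N by near: N.
  have w2 : Re (-1 * orbit_sum T X b N w) <= (1 + 1) * psi N by near: N.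
  have w3 : Re ('i * orbit_sum T X b N w) <= (1 + 1) * psi N by near: N.
  have w4 : Re (- 'i * orbit_sum T X b N w) <= (1 + 1) * psi N by near: N.
  move: w1 w2 w3 w4; set s := orbit_sum T X b N w; rewrite mul1r mulN1r mulNr !Re_opp.
  have -> : Re ('i * s) = - Im s by rewrite Re_mul /=; ring.
  move=> w1 w2 w3 w4; apply: (le_trans (modulus_le_ReIm s)).
  have : `|Re s| <= 2 * psi N.
    by rewrite ler_norml; move: w1 w2; goal_only; move=> w1 w2; apply/andP; split; lra.
  have : `|Im s| <= 2 * psi N.
    by rewrite ler_norml; move: w3 w4; goal_only; move=> w3 w4; apply/andP; split; lra.
  by goal_lra.
have [n1 _ hn1] := cpre_small l1 B_infty b_small e2.
have [k1 _ hk1] : \forall k \near \oo, [/\ (n0 < M k)%N, (n1 < M k)%N, (K < M k)%N &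
    A (M k) <= eps ^+ 2 / 16 * A (M k.+1)].
  by near=> k; split; near: k => //; exact: (level_unbounded A_nd rho1 hM).
have [k kk Yk] := io k1.
have [h1 h2 h3 h4] := hk1 k kk.
have Mk := Mh _ _ (leqnSn k).
set m := M k in h1 h2 h3 h4 Mk; set N := M k.+1 in h4 Mk.
exists N; first by apply: leq_trans Mk; exact: ltnW.
have psiN := lil_scale_ge0 l b N.
have epsi : 0 <= eps * psi N by rewrite mulr_ge0// ltW.
have hit : modulus (block T X l b m (N - m) (iter m T w) - z * (psi N)%:C) <= eps * psi N.
  move: Yk; rewrite /Y /miss -/m -/N.
  case: (boolP ((eps * psi N) ^+ 2 <= _)) => [_ /eqP|h _]; first by rewrite oner_eq0.
  rewrite -(@ler_pXn2r _ 2)// ?nnegrE ?modulus_ge0//.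
  by move: h; rewrite -ltNge => /ltW.
have t1 m' : 0 <= t m' by rewrite (le_trans ler01)// lil_time_ge1.
have Sm : modulus (orbit_sum T X b m w) <= eps * psi N.
  apply: le_trans (hn0 m (ltnW h1)) _.
  rewrite -(@ler_pXn2r _ 2)// ?nnegrE ?mulr_ge0 ?lil_scale_ge0//.
  rewrite !exprMn !(lil_scale_sqr b cs).
  have tt : t m <= t N by apply/le_L/le_L/A_nd.
  have : A m * t m <= eps ^+ 2 / 16 * A N * t N.
    by apply: ler_pM => //; exact: (energy_ge0 b l1).
  have -> : (4 : R) ^+ 2 = 16 by ring.
  by goal_lra.
have cm : modulus (l * cpre l b m * X (iter m T w)) <= eps * psi N.
  rewrite !modulusM (csX cs) mulr1.
  apply: (@le_trans _ _ (modulus (cpre l b m))).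
    by rewrite ler_piMl ?modulus_ge0// (ltW l1).
  rewrite -(@ler_pXn2r _ 2)// ?nnegrE ?modulus_ge0//.
  have n1N : (n1 <= N)%N by apply: leq_trans Mk; exact: ltnW.
  have := hn1 N n1N m Mk; have := lil_time_ge1 l b N => tN hc.
  apply: (@le_trans _ _ (modulus (cpre l b m) ^+ 2 * t N)).
    by rewrite ler_peMr ?sqr_ge0.
  by apply: (le_trans hc); rewrite exprMn ler_pM2l// (energy_le_scale b cs).
have := block_cat T X l b 0 m (N - m) w; rewrite subnKC// !block0 add0n => ->.
move: Sm cm hit; move: (orbit_sum _ _ _ _ _) (l * _ * _) (block _ _ _ _ _ _ _) => s1 s2 s3.
move=> Sm cm hit.
rewrite (_ : s1 - s2 + s3 - _ = s1 - s2 + (s3 - z * (psi N)%:C)); last by ring.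
rewrite (le_trans (modulusD _ _))//.
by have := modulusB s1 s2; move: Sm cm hit; goal_lra.
Unshelve. all: by end_near. Qed.

End lil_lower.

(** * Cluster sets in the complex plane *)

Section complex_topology.
Variable R : realType.
Implicit Types (z : R[i]).

Lemma complex_cvgP {I : Type} (F : set_system I) {FF : Filter F} (f : I -> R[i]) z :
  f @ F --> z <-> forall eps : R, 0 < eps -> \forall x \near F, modulus (z - f x) < eps.
Proof.
split => [/cvgrPdist_lt h eps eps0|h].
  have := h eps%:C; rewrite ltcR => /(_ eps0); apply: filterS => x.
  by rewrite normE ltcR.
apply/cvgrPdist_lt => -[e e'].
rewrite ltcE /= => /andP[/eqP -> e0].
by have := h e e0; apply: filterS => x hx; rewrite normE ltcR.
Qed.

(** A countable dense set of directions and of targets, so that almost sure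
    statements about each of them hold simultaneously. *)
Definition gauss_rat (p : rat * rat) : R[i] := ratr p.1 +i* ratr p.2.

Lemma gauss_rat_dense z (eps : R) : 0 < eps ->
  exists p, modulus (z - gauss_rat p) < eps.
Proof.
move=> eps0; have e2 : 0 < eps / 2 by rewrite divr_gt0.
have dense (x : R) : exists q : rat, `|x - ratr q| < eps / 2.
  have [q] := @rat_in_itvoo R (x - eps / 2) (x + eps / 2) ltac:(lra).
  rewrite in_itv /= => /andP[h1 h2]; exists q.
  by rewrite ltr_norml; apply/andP; split; lra.
have [q1 h1] := dense (Re z); have [q2 h2] := dense (Im z).
exists (q1, q2); apply: le_lt_trans (modulus_le_ReIm _) _.
by rewrite Re_sub Im_sub /=; lra.
Qed.

End complex_topology.

Section cluster_set.
Variables (R : realType) (u : nat -> R[i]) (psi phi : nat -> R).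
Hypothesis psi0 : \forall N \near \oo, 0 < psi N.
Hypothesis ratio : phi N / psi N @[N --> \oo] --> (1 : R).
Hypothesis upper : forall (p : rat * rat) (j : nat), \forall N \near \oo,
  Re (gauss_rat R p * u N) <= (1 + j.+1%:R^-1) * modulus (gauss_rat R p) * psi N.
Hypothesis lower : forall (p : rat * rat) (j : nat), modulus (gauss_rat R p) < 1 ->
  forall K, exists2 N, (K <= N)%N &
    modulus (u N - gauss_rat R p * (psi N)%:C) <= j.+1%:R^-1 * psi N.

Let v N := u N / (phi N)%:C.

Lemma inv_small (eps : R) : 0 < eps -> exists j : nat, j.+1%:R^-1 < eps.
Proof.
move=> eps0; have [n hn] := @ltr_add_invr R 0 eps eps0.
by exists n; rewrite add0r in hn.
Qed.

Let ratio_near (eps : R) : 0 < eps -> \forall N \near \oo,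
  [/\ 0 < psi N, (1 - eps) * psi N < phi N & phi N < (1 + eps) * psi N].
Proof.
move=> eps0; near=> N.
have p0 : 0 < psi N by near: N.
have : `|1 - phi N / psi N| < eps.
  by near: N; move/cvgrPdist_lt : ratio => /(_ _ eps0).
rewrite ltr_norml => /andP[h1 h2]; split => //.
  by rewrite -ltr_pdivlMr//; lra.
by rewrite -ltr_pdivrMr//; lra.
Unshelve. all: by end_near. Qed.

(** Every limit point z satisfies Re (q z) <= |q| for the Gaussian rationals q;
    taking q close to the conjugate of z gives |z|^2 <= |z|. *)
Lemma cluster_in_disc (k : nat -> nat) (z : R[i]) : {homo k : m n / (m < n)%N} ->
  v (k n).+1 @[n --> \oo] --> z -> modulus z <= 1.
Proof.
move=> kinc kz.
have kge n : (n <= k n)%N.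
  elim: n => [//|n IH]; apply: leq_ltn_trans IH _; exact: kinc.
have half p : Re (gauss_rat R p * z) <= modulus (gauss_rat R p).
  set q := gauss_rat R p; set m := modulus q.
  have m0 : 0 <= m := modulus_ge0 q.
  apply/ler_addgt0Pr => e e0.
  pose d := Num.min (1 / 2) (e / (8 * (m + 1))).
  have d0 : 0 < d by rewrite lt_min divr_gt0//= divr_gt0// mulr_gt0//; lra.
  have d2 : d <= 1 / 2 by rewrite ge_min lexx.
  have dm : d * (m + 1) <= e / 8.
    have h1 : d <= e / (8 * (m + 1)) by rewrite ge_min lexx orbT.
    have m1 : 0 < m + 1 by lra.
    have := ler_wpM2r (ltW m1) h1.
    by rewrite (_ : e / (8 * (m + 1)) * (m + 1) = e / 8)//; field; lra.
  have [j hj] := inv_small d0.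
  have [N1 _ h1] := ratio_near d0; have [N2 _ h2] := upper p j.
  have [N3 _ h3] := (complex_cvgP _ _).1 kz d d0.
  pose n := maxn N1 (maxn N2 N3).
  have n1 : (N1 <= n)%N by rewrite leq_maxl.
  have n2 : (N2 <= n)%N by rewrite !leq_max leqnn orbT.
  have n3 : (N3 <= n)%N by rewrite !leq_max leqnn !orbT.
  have kn : (n <= (k n).+1)%N by apply: leqW.
  have [p0 p1 p2] := h1 _ (leq_trans n1 kn).
  have := h2 _ (leq_trans n2 kn); have := h3 _ n3.
  rewrite /= -/q -/m; set N := (k n).+1 in p0 p1 p2 *; move=> vz up.
  have ph0 : 0 < phi N by apply: le_lt_trans p1; rewrite mulr_ge0// ?ltW//; lra.
  have uE : u N = (phi N)%:C * v N.
    by rewrite /v mulrC divfK// -(rmorph0 (real_complex R)) (inj_eq (@complexI R)) gt_eqF.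
  have Rv : Re (q * v N) <= (1 + 4 * d) * m.
    rewrite -(ler_pM2l ph0) -Re_scale mulrCA -uE; apply: (le_trans up).
    rewrite mulrAC mulrA ler_wpM2r//.
    have h5 : (1 + j.+1%:R^-1) * psi N <= (1 + d) * psi N by rewrite ler_pM2r// lerD2l ltW.
    apply: (le_trans h5); rewrite mulrC.
    apply: (@le_trans _ _ ((1 - d) * psi N * (1 + 4 * d))); last first.
      by rewrite ler_wpM2r//; lra.
    rewrite mulrAC mulrC ler_pM2r//; have : d * d <= 1 / 2 * d by rewrite ler_pM2r.
    lra.
  have Rz : Re (q * (z - v N)) <= m * d.
    by rewrite (le_trans (ReleM _))// modulusM ler_wpM2l// ltW.
  have -> : q * z = q * v N + q * (z - v N) by ring.
  rewrite Re_add; lra.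
rewrite leNgt; apply/negP => z1.
set m := modulus z in z1.
pose e := (m * m - m) / (2 * (1 + m)).
have e0 : 0 < e by rewrite divr_gt0//; [nra|lra].
have [p hp] := gauss_rat_dense z^* e0.
have hq := half p; set q := gauss_rat R p in hp hq.
have qm : modulus q <= m + e.
  rewrite (_ : q = z^* - (z^* - q)); last by ring.
  by rewrite (le_trans (modulusB _ _))// modulus_conj lerD2l ltW.
have zz : Re (z^* * z) = m * m.
  by rewrite -expr2 /m modulus_sqr Re_mul Re_conjc Im_conjc; ring.
have : Re ((z^* - q) * z) <= e * m.
  by rewrite (le_trans (ReleM _))// modulusM ler_wpM2r ?modulus_ge0// ltW.
rewrite mulrBl Re_sub zz => h.
have eE : e * (2 * (1 + m)) = m * m - m by rewrite /e divfK// gt_eqF//; lra.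
nra.
Qed.

(** A point of the closed disc is shrunk slightly and then approximated by a
    Gaussian rational of the open disc, which the sequence approaches infinitely
    often. *)
Lemma disc_approx (z : R[i]) (eps : R) : modulus z <= 1 -> 0 < eps ->
  forall K, exists2 N, (K <= N)%N & modulus (z - v N.+1) < eps.
Proof.
move=> z1 eps0 K.
pose d := Num.min (1 / 2) (eps / 16).
have d0 : 0 < d by rewrite lt_min !divr_gt0.
have d2 : d <= 1 / 2 by rewrite ge_min lexx.
have de : d <= eps / 16 by rewrite ge_min lexx orbT.
have [p hp] := gauss_rat_dense ((1 - d)%:C * z) d0.
set q := gauss_rat R p in hp.
have q1 : modulus q < 1.
  rewrite (_ : q = (1 - d)%:C * z - ((1 - d)%:C * z - q)); last by ring.
  apply: le_lt_trans (modulusB _ _) _.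
  have : modulus ((1 - d)%:C * z) <= 1 - d.
    by rewrite modulusM modulusC ger0_norm ?ler_piMr//; lra.
  lra.
have zq : modulus (z - q) <= 2 * d.
  rewrite (_ : z - q = d%:C * z + ((1 - d)%:C * z - q)); last first.
    by rewrite rmorphB rmorph1; ring.
  apply: (le_trans (modulusD _ _)); rewrite modulusM modulusC (ger0_norm (ltW d0)).
  have : d * modulus z <= d by rewrite ler_piMr// ltW.
  lra.
have [j hj] := inv_small d0.
have [N1 _ h1] := ratio_near d0.
have [N hN hu] := lower j q1 (maxn N1 K.+1).
have [NN1 NK] : (N1 <= N)%N /\ (K.+1 <= N)%N.
  by move: hN; rewrite geq_max => /andP.
have [p0 p1 p2] := h1 N NN1.
exists N.-1; first by rewrite -ltnS prednK//; exact: leq_ltn_trans NK.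
have N0 : (0 < N)%N by exact: leq_ltn_trans NK.
rewrite prednK//.
have ph0 : 0 < phi N by apply: le_lt_trans p1; rewrite mulr_ge0// ?ltW//; lra.
have phi0 : (phi N)%:C != 0.
  by rewrite -(rmorph0 (real_complex R)) (inj_eq (@complexI R)) gt_eqF.
have : phi N * modulus (z - v N) < phi N * eps.
  rewrite -[X in X * modulus _](ger0_norm (ltW ph0)) -modulusC -modulusM.
  rewrite /v mulrBr (mulrC (u N)) mulVKf//.
  rewrite (_ : (phi N)%:C * z - u N = (phi N)%:C * (z - q) + q * (phi N - psi N)%:C
      - (u N - q * (psi N)%:C)); last by rewrite rmorphB; ring.
  apply: le_lt_trans (modulusB _ _) _.
  apply: (@le_lt_trans _ _ (phi N * (2 * d) + d * psi N + d * psi N)).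
    apply: lerD; last by apply: (le_trans hu); rewrite ler_pM2r// ltW.
    apply: (le_trans (modulusD _ _)); rewrite !modulusM !modulusC (ger0_norm (ltW ph0)).
    apply: lerD; first by rewrite ler_pM2l.
    rewrite -[leRHS]mul1r; apply: ler_pM => //; [exact: modulus_ge0|exact: ltW|].
    by rewrite ler_norml; apply/andP; split; lra.
  have h7 : d * psi N <= 1 / 2 * psi N by rewrite ler_pM2r.
  have pp : psi N <= 2 * phi N by lra.
  have : d * psi N <= d * (2 * phi N) by rewrite ler_pM2l.
  have : d * phi N <= eps / 16 * phi N by rewrite ler_pM2r.
  have : 0 < eps * phi N by rewrite mulr_gt0.
  lra.
by rewrite ltr_pM2l.
Qed.

Theorem cluster_setE :
  subsequential_limits (fun N => u N.+1 / (phi N.+1)%:C) = [set z : R[i] | `|z| <= 1].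
Proof.
apply/seteqP; split => z /=.
  by move=> [k kinc kz]; rewrite norm_le1; exact: cluster_in_disc kz.
rewrite norm_le1 => z1.
have ex (p : nat * nat) : exists N, (p.1 <= N)%N /\ modulus (z - v N.+1) < p.2.+1%:R^-1.
  have [N h1 h2] := @disc_approx z p.2.+1%:R^-1 z1 ltac:(by rewrite invr_gt0) p.1.
  by exists N.
have [f hf] := choice ex.
pose k := fix k n := if n is n'.+1 then f ((k n').+1, n) else f (0%N, 0%N).
have kS n : (k n < k n.+1)%N by have [] := hf ((k n).+1, n.+1).
exists k; first by apply: homo_ltn kS; exact: ltn_trans.
apply/complex_cvgP => eps eps0.
have [j hj] := inv_small eps0.
exists j => // n /= jn.
have h : modulus (z - v (k n).+1) < n.+1%:R^-1.
  by case: n {jn} => [|n]; [have [] := hf (0, 0)%N|have [] := hf ((k n).+1, n.+1)].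
apply: lt_trans h _; apply: le_lt_trans hj.
by rewrite lef_pV2 ?posrE ?ltr0n// ler_nat.
Qed.

End cluster_set.

(** * The law of the iterated logarithm for circle systems *)

Lemma ae_forall_count d (Om : measurableType d) (R : realType)
    (mu : {measure set Om -> \bar R}) (I : countType) (Q : I -> Om -> Prop) :
  (forall i, {ae mu, forall w, Q i w}) -> {ae mu, forall w, forall i, Q i w}.
Proof.
move=> h.
have : {ae mu, forall w, forall n : nat, if unpickle n is Some i then Q i w else True}.
  apply/ae_foralln => n; case: (unpickle n) => [i|]; first exact: h.
  exact: aeW.
by apply: filterS => w hw i; have := hw (pickle i); rewrite pickleK.
Qed.

Section circle_system_lil.
Context d (Om : measurableType d) (R : realType) (P : probability Om R).
Variables (T : Om -> Om) (X : Om -> R[i]) (l a : R[i]) (b : nat -> R[i]).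
Hypothesis cs : circle_system P T X l a.
Hypothesis B_infty : sqnorm_sum b N @[N --> \oo] --> +oo.
Hypothesis b_small : sqnorm_max b N * L (L (sqnorm_sum b N)) / sqnorm_sum b N
    @[N --> \oo] --> (0 : R).
Local Notation A := (energy l b).
Local Notation psi := (lil_scale l b).
Local Notation S := (orbit_sum T X b).
Let l1 := csl cs.

Let s N := mean P (fun w => modulus (S N w) ^+ 2).

(** The variance is A_N + |l c_N|^2, and the last term is o(A_N). *)
Lemma variance_ratio : Num.sqrt (s N * L (L (s N))) / psi N @[N --> \oo] --> (1 : R).
Proof.
apply/cvgrPdist_le => eps eps0.
have [N0 _ hN0] := cpre_small l1 B_infty b_small eps0.
have [N1 _ hN1] := energy_gt0 cs B_infty.
exists (maxn N0 N1) => // N /=; rewrite geq_max => /andP[h0 h1].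
have A0 := hN1 N h1.
have LL1 := lil_time_ge1 l b N.
have hc : modulus (cpre l b N) ^+ 2 <= eps * A N.
  by apply: le_trans (hN0 N h0 N (leqnn N)); rewrite ler_peMr ?sqr_ge0.
have sE : s N = A N + modulus (l * cpre l b N) ^+ 2 by exact: (mean_sqr_orbit_sum b cs).
have s1 : A N <= s N by rewrite sE lerDl sqr_ge0.
have s2 : s N <= (1 + eps) * A N.
  rewrite sE mulrDl mul1r lerD2l; apply: le_trans hc.
  rewrite lerXn2r ?nnegrE ?modulus_ge0// modulusM ler_piMl ?modulus_ge0//.
  exact: ltW.
have psi0 : 0 < psi N by rewrite sqrtr_gt0 mulr_gt0// (lt_le_trans ltr01).
have e1 : 0 <= 1 + eps by lra.
have LLs : 0 <= L (L (s N)) by rewrite ltW// L_gt0.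
have s0 : 0 <= s N by apply: le_trans s1; apply: ltW.
have up : Num.sqrt (s N * L (L (s N))) <= (1 + eps) * psi N.
  rewrite -(@ler_pXn2r _ 2)// ?nnegrE ?sqrtr_ge0//; last by rewrite mulr_ge0// ltW.
  rewrite exprMn sqr_sqrtr ?mulr_ge0// (lil_scale_sqr b cs).
  rewrite (_ : _ * (A N * _) = ((1 + eps) * A N) * ((1 + eps) * L (L (A N)))); last first.
    by rewrite /lil_time; ring.
  apply: ler_pM => //; apply: le_trans (LL_scale _ (ltW eps0)).
  exact/le_L/le_L.
have lo : psi N <= Num.sqrt (s N * L (L (s N))).
  apply: ler_wsqrtr; apply: ler_pM => //; first exact: ltW.
    by rewrite (le_trans ler01).
  exact/le_L/le_L.
rewrite distrC ger0_norm; last by rewrite subr_ge0 ler_pdivlMr// mul1r.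
by rewrite lerBlDr ler_pdivrMr// addrC.
Qed.

Theorem circle_system_lil : {ae P, forall w,
  subsequential_limits (fun N => S N.+1 w /
    (Num.sqrt (s N.+1 * L (L (s N.+1))))%:C) = [set z : R[i] | `|z| <= 1]}.
Proof.
have psi0 : \forall N \near \oo, 0 < psi N.
  have := energy_gt0 cs B_infty; apply: filterS => N A0.
  by rewrite sqrtr_gt0 mulr_gt0// (lt_le_trans ltr01)// lil_time_ge1.
have psi_ge0 := lil_scale_ge0 l b.
have inv1 (j : nat) : 0 < j.+1%:R^-1 :> R /\ j.+1%:R^-1 <= 1 :> R.
  by split; [rewrite invr_gt0|rewrite invf_le1 ?ler1n ?ltr0n].
have up (x : (rat * rat) * nat) : {ae P, forall w, \forall N \near \oo,
    Re (gauss_rat R x.1 * S N w) <=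
    (1 + x.2.+1%:R^-1) * modulus (gauss_rat R x.1) * psi N}.
  case: x => p j /=; set q := gauss_rat R p.
  have [q0|q0] := eqVneq q 0.
    apply: aeW => w; apply: nearW => N.
    by rewrite q0 mul0r modulus0 mulr0 mul0r.
  have m0 : 0 < modulus q.
    by rewrite lt_def modulus_ge0 andbT; apply: contra_neq q0 => /modulus_eq0.
  have e1 : modulus (((modulus q)^-1)%:C * q) = 1.
    by rewrite modulusM modulusC ger0_norm ?invr_ge0 ?modulus_ge0// mulVf// gt_eqF.
  have [j0 j1] := inv1 j.
  have := lil_upper cs B_infty b_small e1 j0 j1.
  apply: filterS => w; apply: filterS => N.
  rewrite -mulrA Re_scale ler_pdivrMl// => h; apply: le_trans h _.
  by rewrite mulrCA mulrA.
have lo (x : (rat * rat) * nat) : {ae P, forall w, modulus (gauss_rat R x.1) < 1 ->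
    forall K, exists2 N, (K <= N)%N &
    modulus (S N w - gauss_rat R x.1 * (psi N)%:C) <= x.2.+1%:R^-1 * psi N}.
  case: x => p j /=; set q := gauss_rat R p.
  have [q1|q1] := ltP (modulus q) 1; last by apply: aeW => w //.
  have [j0 j1] := inv1 j.
  pose eps := Num.min (j.+1%:R^-1 / 3) ((1 - modulus q ^+ 2) / 3).
  have q2 : modulus q ^+ 2 < 1 by rewrite expr_lt1// modulus_ge0.
  have eps0 : 0 < eps by rewrite lt_min !divr_gt0//= subr_gt0.
  have epsj : 3 * eps <= j.+1%:R^-1.
    by rewrite mulrC -ler_pdivlMr// ge_min lexx.
  have epsq : modulus q ^+ 2 + 3 * eps <= 1.
    have : eps <= (1 - modulus q ^+ 2) / 3 by rewrite ge_min lexx orbT.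
    lra.
  have := lil_lower cs B_infty b_small eps0 epsq.
  apply: filterS => w hw _ K; have [N KN h] := hw K; exists N => //.
  by apply: (le_trans h); rewrite ler_wpM2r.
have UP := ae_forall_count up; have LO := ae_forall_count lo.
near=> w.
have UPw : forall x : (rat * rat) * nat, \forall N \near \oo,
    Re (gauss_rat R x.1 * S N w) <=
    (1 + x.2.+1%:R^-1) * modulus (gauss_rat R x.1) * psi N by near: w.
have LOw : forall x : (rat * rat) * nat, modulus (gauss_rat R x.1) < 1 ->
    forall K, exists2 N, (K <= N)%N &
    modulus (S N w - gauss_rat R x.1 * (psi N)%:C) <= x.2.+1%:R^-1 * psi N by near: w.
apply: (@cluster_setE R (fun N => S N w) psi
  (fun N => Num.sqrt (s N * L (L (s N)))) psi0 variance_ratio).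
  by move=> p j; exact: (UPw (p, j)).
by move=> p j; exact: (LOw (p, j)).
Unshelve. all: by end_near. Qed.

End circle_system_lil.

(** * Closed forms on rectangles *)

Section interval_integral.
Variable R : realType.
Implicit Types (f g : R -> R) (a b m k e : R).

Definition rint f a b : R := \int[@lebesgue_measure R]_(x in `[a, b]) f x.

Definition continuous_btw f a b := {in `[a, b], continuous f}.

Lemma continuous_btw_integrable f a b : continuous_btw f a b ->
  (@lebesgue_measure R).-integrable `[a, b] (EFin \o f).
Proof.
move=> cf; apply: (@continuous_compact_integrable R); first exact: segment_compact.
by apply: continuous_in_subspaceT => x /set_mem; exact: cf.
Qed.

Lemma continuous_btwB f g a b : continuous_btw f a b -> continuous_btw g a b ->
  continuous_btw (fun x => f x - g x) a b.
Proof. by move=> cf cg x xab; apply: cvgB; [exact: cf|exact: cg]. Qed.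

Lemma rint_cat f a m b : a <= m -> m <= b -> continuous_btw f a b ->
  rint f a b = rint f a m + rint f m b.
Proof.
move=> am mb cf; have fi := continuous_btw_integrable cf.
have := @Rintegral_itvB R f (BLeft a) (BRight b) m fi.
rewrite !bnd_simp am mb => /(_ isT isT) h.
have := @Rintegral_itv_obnd_cbnd R m (BRight b) f.
have fi' : (@lebesgue_measure R).-integrable `]m, b] (EFin \o f).
  by apply: integrableS fi => //; apply: subset_itv => //; rewrite bnd_simp.
move=> /(_ fi') h'.
by rewrite /rint -h' -h addrC subrK.
Qed.

Lemma rintD f g a b : continuous_btw f a b -> continuous_btw g a b ->
  rint (fun x => f x + g x) a b = rint f a b + rint g a b.
Proof.
by move=> cf cg; rewrite /rint RintegralD//; exact: continuous_btw_integrable.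
Qed.

Lemma rintB f g a b : continuous_btw f a b -> continuous_btw g a b ->
  rint (fun x => f x - g x) a b = rint f a b - rint g a b.
Proof.
by move=> cf cg; rewrite /rint RintegralB//; exact: continuous_btw_integrable.
Qed.

Lemma rint_cst k a b : a <= b -> rint (fun=> k) a b = k * (b - a).
Proof.
move=> ab; rewrite /rint Rintegral_cst; last exact: measurable_itv.
have := @lebesgue_measure_itv R `[a, b]; rewrite /= lte_fin => ->.
case: ltP => [_|ba] //=.
have -> : a = b by apply/eqP; rewrite eq_le ab ba.
by rewrite subrr.
Qed.

Lemma rint_near_cst f a b k e : a <= b -> continuous_btw f a b ->
  (forall x, a <= x <= b -> `|f x - k| <= e) ->
  `|rint f a b - k * (b - a)| <= e * (b - a).
Proof.
move=> ab cf h.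
have cc c : continuous_btw (fun=> c) a b by move=> x _; exact: cvg_cst.
rewrite ler_distl; apply/andP; split.
  rewrite -mulrBl -(rint_cst _ ab) /rint; apply: le_Rintegral => //.
  - exact: continuous_btw_integrable.
  - exact: continuous_btw_integrable.
  - move=> x /=; rewrite in_itv /= => /h; rewrite ler_distl => /andP[h1 h2].
    by move: h1; lra.
rewrite -mulrDl -(rint_cst _ ab) /rint; apply: le_Rintegral => //.
- exact: continuous_btw_integrable.
- exact: continuous_btw_integrable.
- move=> x /=; rewrite in_itv /= => /h; rewrite ler_distl => /andP[h1 h2].
  by move: h2; lra.
Qed.

End interval_integral.

Section closed_form.
Variable R : realType.
Implicit Types (p q : R -> R -> R) (a b c d m s t : R).

(** Differentiability of p at (s0, t0) with partial derivatives u and v. *)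
Definition affine_near p s0 t0 (u v : R) := forall e, 0 < e -> exists2 del, 0 < del &
  forall s t, `|s - s0| <= del -> `|t - t0| <= del ->
    `|p s t - p s0 t0 - (u * (s - s0) + v * (t - t0))| <= e * (`|s - s0| + `|t - t0|).

(** p and q are differentiable and dp/dt = dq/ds at the point. The derivatives
    are taken at single points, as in the lemma of Goursat. *)
Definition closed_at p q s t := exists u v w,
  affine_near p s t u v /\ affine_near q s t v w.

Definition closed_on p q a b c d := forall s t, a <= s <= b -> c <= t <= d ->
  closed_at p q s t.

(** The integral of p ds + q dt over the counterclockwise boundary of the
    rectangle. *)
Definition boundary p q a b c d : R :=
  rint (fun s => p s c - p s d) a b + rint (fun t => q b t - q a t) c d.

Lemma affine_near_flip p s t u v : affine_near p s t u v ->
  affine_near (fun t s => p s t) t s v u.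
Proof.
move=> h e /h[del del0 hd]; exists del => // t' s' ht hs.
by have := hd s' t' hs ht; rewrite (addrC (u * _)) (addrC (`|s' - s|)).
Qed.

Lemma affine_near_continuous p s t u v : affine_near p s t u v ->
  {for s, continuous (p^~ t)}.
Proof.
move=> h; apply/cvgrPdist_le => e e0.
have [del del0 hd] := h 1 ltr01.
have k0 : 0 < e / (`|u| + 1) by rewrite divr_gt0// ltr_wpDl.
near=> x.
have xs : `|x - s| <= Num.min del (e / (`|u| + 1)).
  rewrite distrC; near: x; apply: cvgr_dist_le; first exact: cvg_id.
  by rewrite lt_min del0.
move: xs; rewrite le_min => /andP[xd xe].
have := hd x t xd; rewrite subrr normr0 mulr0 !addr0 mul1r => /(_ (ltW del0)) h1.
rewrite distrC.
have -> : p x t - p s t = (p x t - p s t - u * (x - s)) + u * (x - s) by ring.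
apply: (le_trans (ler_normD _ _)); rewrite normrM.
apply: (@le_trans _ _ ((`|u| + 1) * `|x - s|)); first by move: h1; lra.
by move: xe; rewrite ler_pdivlMr ?ltr_wpDl// mulrC.
Unshelve. all: by end_near. Qed.

Lemma closed_at_flip p q s t : closed_at p q s t ->
  closed_at (fun t s => q s t) (fun t s => p s t) t s.
Proof.
move=> [u [v [w [hp hq]]]]; exists w, v, u.
by split; exact: affine_near_flip.
Qed.

Lemma closed_on_flip p q a b c d : closed_on p q a b c d ->
  closed_on (fun t s => q s t) (fun t s => p s t) c d a b.
Proof. by move=> h s t hs ht; apply: closed_at_flip; exact: h. Qed.

Lemma closed_on_sub p q a b c d a' b' c' d' :
  a <= a' -> b' <= b -> c <= c' -> d' <= d ->
  closed_on p q a b c d -> closed_on p q a' b' c' d'.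
Proof.
move=> aa bb cc dd h s t /andP[h1 h2] /andP[h3 h4]; apply: h; apply/andP; split.
- exact: le_trans h1.
- exact: le_trans bb.
- exact: le_trans h3.
- exact: le_trans dd.
Qed.

Lemma closed_on_continuous p q a b c d t : closed_on p q a b c d -> c <= t <= d ->
  continuous_btw (p^~ t) a b.
Proof.
move=> h ht s; rewrite in_itv /= => hs; have [u [v [w [hp _]]]] := h s t hs ht.
exact: affine_near_continuous hp.
Qed.

Lemma closed_on_continuous2 p q a b c d s : closed_on p q a b c d -> a <= s <= b ->
  continuous_btw (q s) c d.
Proof. by move=> /closed_on_flip h hs; exact: (closed_on_continuous h hs). Qed.

(** Exchanging the coordinates reverses the orientation. It reduces statements
    about cutting a rectangle horizontally to vertical cuts. *)
Lemma boundary_flip p q a b c d : a <= b -> c <= d -> closed_on p q a b c d ->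
  boundary p q a b c d =
    - boundary (fun t s => q s t) (fun t s => p s t) c d a b.
Proof.
move=> ab cd h.
have cc : c <= c <= d by rewrite lexx.
have dd : c <= d <= d by rewrite lexx andbT.
have aa : a <= a <= b by rewrite lexx.
have bb : a <= b <= b by rewrite lexx andbT.
have pc := closed_on_continuous h cc.
have pd := closed_on_continuous h dd.
have qa := closed_on_continuous2 h aa.
have qb := closed_on_continuous2 h bb.
by rewrite /boundary !rintB//; ring.
Qed.

Lemma boundary_cat p q a m b c d : a <= m -> m <= b -> c <= d ->
  closed_on p q a b c d ->
  boundary p q a b c d = boundary p q a m c d + boundary p q m b c d.
Proof.
move=> am mb cd h.
have ab := le_trans am mb.
have cc : c <= c <= d by rewrite lexx.
have dd : c <= d <= d by rewrite lexx andbT.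
have aa : a <= a <= b by rewrite lexx.
have bb : a <= b <= b by rewrite lexx andbT.
have mm : a <= m <= b by rewrite am.
have pc := closed_on_continuous h cc.
have pd := closed_on_continuous h dd.
have qa := closed_on_continuous2 h aa.
have qb := closed_on_continuous2 h bb.
have qm := closed_on_continuous2 h mm.
rewrite /boundary (rint_cat am mb); last exact: continuous_btwB.
by rewrite !(rintB (f := q _))//; ring.
Qed.

Lemma half_boundary p q x y W d e : 0 <= W -> y <= d ->
  closed_on p q x (x + W) y d -> e <= `|boundary p q x (x + W) y d| ->
  exists x', [/\ x <= x', x' + W / 2 <= x + W &
    e / 2 <= `|boundary p q x' (x' + W / 2) y d|].
Proof.
move=> W0 yd h he.
have W2 : 0 <= W / 2 by rewrite divr_ge0.
have hW : x + W = x + W / 2 + W / 2 by field.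
have xm : x <= x + W / 2 by rewrite lerDl.
have mb : x + W / 2 <= x + W by rewrite hW lerDl.
rewrite (boundary_cat xm mb yd h) in he.
have {}he := le_trans he (ler_normD _ _).
case: (lerP (e / 2) `|boundary p q x (x + W / 2) y d|) => h1.
  by exists x.
exists (x + W / 2); rewrite -hW; split => //.
by move: he h1; lra.
Qed.

Lemma quarter_boundary p q x y W H e : 0 <= W -> 0 <= H ->
  closed_on p q x (x + W) y (y + H) -> e <= `|boundary p q x (x + W) y (y + H)| ->
  exists x' y', [/\ x <= x', x' + W / 2 <= x + W, y <= y', y' + H / 2 <= y + H &
    e / 4 <= `|boundary p q x' (x' + W / 2) y' (y' + H / 2)|].
Proof.
move=> W0 H0 h he.
have yH : y <= y + H by rewrite lerDl.
have [x' [xx xW he']] := half_boundary W0 yH h he.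
have xx' : x' <= x' + W / 2 by rewrite lerDl divr_ge0.
have h' := closed_on_sub xx xW (lexx y) (lexx _) h.
rewrite (boundary_flip xx' yH h') normrN in he'.
have h'' := closed_on_flip h'.
have [y' [yy yH' he'']] := half_boundary H0 xx' h'' he'.
exists x', y'; split => //.
have yy' : y' <= y' + H / 2 by rewrite lerDl divr_ge0.
rewrite (boundary_flip xx' yy').
  by rewrite normrN; move: he''; lra.
exact: (closed_on_sub _ _ yy yH' h').
Qed.

(** The affine part of a closed form integrates to 0 around the rectangle, as
    the two mixed derivatives agree; the error is a fraction e of the squared
    size. *)
Lemma small_boundary p q s t u v e del x y W H :
  let near p k l := forall s' t', `|s' - s| <= del -> `|t' - t| <= del ->
    `|p s' t' - p s t - (k * (s' - s) + l * (t' - t))| <= e * (`|s' - s| + `|t' - t|) in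
  forall w, near p u v -> near q v w -> 0 <= e -> 0 <= W <= del -> 0 <= H <= del ->
  x <= s <= x + W -> y <= t <= y + H -> closed_on p q x (x + W) y (y + H) ->
  `|boundary p q x (x + W) y (y + H)| <= 2 * e * (W + H) ^+ 2.
Proof.
move=> near w hp hq e0 /andP[W0 Wd] /andP[H0 Hd] /andP[s1 s2] /andP[t1 t2] hc.
have xW : x <= x + W by rewrite lerDl.
have yH : y <= y + H by rewrite lerDl.
have hs s' : x <= s' <= x + W -> `|s' - s| <= W.
  by move=> /andP[h1 h2]; rewrite ler_norml; apply/andP; split; lra.
have ht t' : y <= t' <= y + H -> `|t' - t| <= H.
  by move=> /andP[h1 h2]; rewrite ler_norml; apply/andP; split; lra.
have hh (r : R -> R -> R) k l s' t' : near r k l -> x <= s' <= x + W -> y <= t' <= y + H ->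
    `|r s' t' - r s t - (k * (s' - s) + l * (t' - t))| <= e * (W + H).
  move=> hr /hs h1 /ht h2; apply: (le_trans (hr _ _ (le_trans h1 Wd) (le_trans h2 Hd))).
  by apply: ler_wpM2l => //; apply: lerD.
have yy : y <= y <= y + H by rewrite lexx.
have yy' : y <= y + H <= y + H by rewrite lexx andbT.
have xx : x <= x <= x + W by rewrite lexx.
have xx' : x <= x + W <= x + W by rewrite lexx andbT.
have c1 := continuous_btwB (closed_on_continuous hc yy) (closed_on_continuous hc yy').
have c2 := continuous_btwB (closed_on_continuous2 hc xx') (closed_on_continuous2 hc xx).
have b1 : forall s', x <= s' <= x + W ->
    `|p s' y - p s' (y + H) - (- (v * H))| <= 2 * e * (W + H).
  move=> s' hs'; have h1 := hh p u v s' y hp hs' yy; have h2 := hh p u v s' (y + H) hp hs' yy'.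
  rewrite ler_norml in h1; rewrite ler_norml in h2.
  by rewrite ler_norml; clear -h1 h2; move: h1 h2 => /andP[h1 h2] /andP[h3 h4]; apply/andP; split; lra.
have b2 : forall t', y <= t' <= y + H ->
    `|q (x + W) t' - q x t' - v * W| <= 2 * e * (W + H).
  move=> t' ht'; have h1 := hh q v w (x + W) t' hq xx' ht'; have h2 := hh q v w x t' hq xx ht'.
  rewrite ler_norml in h1; rewrite ler_norml in h2.
  by rewrite ler_norml; clear -h1 h2; move: h1 h2 => /andP[h1 h2] /andP[h3 h4]; apply/andP; split; lra.
have := rint_near_cst xW c1 b1; have := rint_near_cst yH c2 b2.
rewrite -/(boundary p q x (x + W) y (y + H)) /boundary.
set I1 := rint _ _ _; set I2 := rint _ _ _ => h1 h2.
have -> : I2 + I1 = (I2 - - (v * H) * (x + W - x)) + (I1 - v * W * (y + H - y)) by ring.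
apply: (le_trans (ler_normD _ _)).
have -> : 2 * e * (W + H) ^+ 2 = 2 * e * (W + H) * (x + W - x) + 2 * e * (W + H) * (y + H - y).
  by ring.
exact: lerD.
Qed.

Lemma nested_intervals (x : nat -> R) (w : R) : 0 <= w -> (forall n, x n <= x n.+1) ->
  (forall n, x n.+1 + w / 2 ^+ n.+1 <= x n + w / 2 ^+ n) ->
  exists l, forall n, x n <= l <= x n + w / 2 ^+ n.
Proof.
move=> w0 inc dec.
have incx := iffLR (nondecreasing_seqP x) inc.
have decx (i j : nat) : (i <= j)%N -> x j + w / 2 ^+ j <= x i + w / 2 ^+ i.
  elim: j => [|j IH]; first by rewrite leqn0 => /eqP ->.
  by rewrite leq_eqVlt ltnS => /predU1P[->//|/IH]; apply: le_trans.
have ub (i j : nat) : x j <= x i + w / 2 ^+ i.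
  apply: (@le_trans _ _ (x (maxn i j))); first exact/incx/leq_maxr.
  apply: (le_trans _ (decx _ _ (leq_maxl i j))).
  by rewrite lerDl divr_ge0// exprn_ge0.
exists (sup (range x)) => n; apply/andP; split.
  apply: ub_le_sup; last by exists n.
  by exists (x 0%N + w / 2 ^+ 0) => _ [k _ <-].
by apply: ge_sup; [exists (x 0%N); exists 0%N|move=> _ [k _ <-]].
Qed.

(** Repeated quadrisection: if the integral were not 0, some quarter would keep
    a quarter of it, and near the common point of the nested rectangles this
    contradicts small_boundary, as the squared size also shrinks by 4. *)
Theorem boundary0 p q a b c d : a <= b -> c <= d -> closed_on p q a b c d ->
  boundary p q a b c d = 0.
Proof.
move=> ab cd hc.
apply/eqP; rewrite -normr_eq0; apply/negP => /negP J0.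
have eta0 : 0 < `|boundary p q a b c d| by rewrite lt_def J0 normr_ge0.
pose W := b - a; pose H := d - c; pose eta := `|boundary p q a b c d|.
have W0 : 0 <= W by rewrite subr_ge0.
have H0 : 0 <= H by rewrite subr_ge0.
have ha n (x : R) : 0 <= x -> 0 <= x / 2 ^+ n by move=> x0; rewrite divr_ge0// exprn_ge0.
pose bad n (z : R * R) := [/\ a <= z.1, z.1 + W / 2 ^+ n <= b, c <= z.2,
  z.2 + H / 2 ^+ n <= d &
  eta / 4 ^+ n <= `|boundary p q z.1 (z.1 + W / 2 ^+ n) z.2 (z.2 + H / 2 ^+ n)|].
pose sub n (z z' : R * R) := [/\ z.1 <= z'.1,
  z'.1 + W / 2 ^+ n.+1 <= z.1 + W / 2 ^+ n, z.2 <= z'.2 &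
  z'.2 + H / 2 ^+ n.+1 <= z.2 + H / 2 ^+ n].
have /choice[F HF] : forall nz : nat * (R * R), exists z', bad nz.1 nz.2 ->
    bad nz.1.+1 z' /\ sub nz.1 nz.2 z'.
  move=> [n z] /=; have [bz|] := pselect (bad n z); last by exists z.
  case: (bz) => z1 z2 z3 z4 z5.
  have hc' := closed_on_sub z1 z2 z3 z4 hc.
  have [x' [y' [h1 h2 h3 h4 h5]]] := quarter_boundary (ha n W W0) (ha n H H0) hc' z5.
  exists (x', y') => _; rewrite /bad /sub !exprSr !invfM !mulrA /=; split; split => //.
  - exact: le_trans h1.
  - exact: le_trans z2.
  - exact: le_trans h3.
  - exact: le_trans z4.
pose z := fix z n := if n is n'.+1 then F (n', z n') else (a, c).
have badz n : bad n (z n).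
  elim: n => [|n IH]; last by have [] := HF (n, z n) IH.
  by rewrite /bad /z /= !expr0 !divr1 /W /H !(addrC _ (_ - _)) !subrK.
have subz n : sub n (z n) (z n.+1) by have [] := HF (n, z n) (badz n).
have [s hs] : exists l, forall n, (z n).1 <= l <= (z n).1 + W / 2 ^+ n.
  by apply: nested_intervals => // n; case: (subz n).
have [t ht] : exists l, forall n, (z n).2 <= l <= (z n).2 + H / 2 ^+ n.
  by apply: nested_intervals => // n; case: (subz n).
have hst : closed_at p q s t.
  have [h1 h2 h3 h4 _] := badz 0%N; apply: hc.
    by have /andP[h5 h6] := hs 0%N; rewrite (le_trans h1 h5) (le_trans h6 h2).
  by have /andP[h5 h6] := ht 0%N; rewrite (le_trans h3 h5) (le_trans h6 h4).
have [u [v [w [hp hq]]]] := hst.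
(* With this e the bound of small_boundary is less than eta / 4^n. *)
pose e := eta / (4 * ((W + H) ^+ 2 + 1)).
have e0 : 0 < e by rewrite divr_gt0// mulr_gt0// ltr_wpDl// exprn_ge0// addr_ge0.
have [d1 d10 hd1] := hp e e0; have [d2 d20 hd2] := hq e e0.
pose del := Num.min d1 d2.
have del0 : 0 < del by rewrite lt_min d10.
have [n hn] : exists n, (W + H) / 2 ^+ n <= del.
  have := @cvg_geometric R (W + H) (2^-1).
  rewrite gtr0_norm// invf_lt1// ltr1n => /(_ isT) /cvgrPdist_le /(_ del del0) [n _ /(_ n (leqnn n))].
  rewrite sub0r normrN /geometric /= exprVn ger0_norm => [h|]; first by exists n.
  by apply: ha; rewrite addr_ge0.
have [z1 z2 z3 z4 z5] := badz n.
have hc' := closed_on_sub z1 z2 z3 z4 hc.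
have := small_boundary (s := s) (t := t) (u := u) (v := v) (e := e) (del := del)
  (w := w) _ _ (ltW e0) _ _ (hs n) (ht n) hc'.
have hWn : 0 <= W / 2 ^+ n <= del.
  by rewrite ha//= (le_trans _ hn)// ler_wpM2r// ?invr_ge0 ?exprn_ge0// lerDl.
have hHn : 0 <= H / 2 ^+ n <= del.
  by rewrite ha//= (le_trans _ hn)// ler_wpM2r// ?invr_ge0 ?exprn_ge0// lerDr.
have f1 : forall s' t' : R, `|s' - s| <= del -> `|t' - t| <= del -> `|s' - s| <= d1 /\ `|t' - t| <= d1.
  by move=> s' t'; rewrite !le_min => /andP[-> _] /andP[-> _].
have f2 : forall s' t' : R, `|s' - s| <= del -> `|t' - t| <= del -> `|s' - s| <= d2 /\ `|t' - t| <= d2.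
  by move=> s' t'; rewrite !le_min => /andP[_ ->] /andP[_ ->].
move=> /(_ _ _ hWn hHn) h.
have {}h := le_trans z5 (h (fun s' t' h1 h2 => hd1 s' t' (f1 s' t' h1 h2).1 (f1 s' t' h1 h2).2)
  (fun s' t' h1 h2 => hd2 s' t' (f2 s' t' h1 h2).1 (f2 s' t' h1 h2).2)).
move: h; rewrite -mulrDl expr_div_n -exprM mulnC exprM.
have -> : (2 : R) ^+ 2 = 4 by ring.
rewrite mulrA ler_pM2r ?invr_gt0 ?exprn_gt0// => h.
have K0 : 0 <= (W + H) ^+ 2 by rewrite exprn_ge0// addr_ge0.
have he : e * (4 * ((W + H) ^+ 2 + 1)) = eta.
  by rewrite /e divfK// gt_eqF// mulr_gt0// ltr_wpDl.
have e1 := ltW e0.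
have := mulr_ge0 e1 K0.
have eta' : 0 < eta by [].
move: h he e0 K0 eta'; clear; move: eta e; set k := (W + H) ^+ 2; move: k => k eta e; nra.
Qed.

End closed_form.

(** * Complex differentiability and circle averages *)

Section complex_differentiability.
Variable R : realType.
Implicit Types (h g : R[i] -> R[i]) (z w c : R[i]).

(** An explicit form of complex differentiability, closed under products and
    quotients by direct estimates, and ready to be split into real and imaginary
    parts. *)
Definition cdiff h z := exists c, forall e : R, 0 < e ->
  exists2 del : R, 0 < del & forall w, modulus (w - z) <= del ->
    modulus (h w - h z - c * (w - z)) <= e * modulus (w - z).

Lemma derivable_cdiff h z : derivable h z 1 -> cdiff h z.
Proof.
move=> /cvg_ex[c hc]; exists c => e e0.
have [del /= del0 hd] := iffLR (@complex_cvgP R _ _ _ _ c) hc e e0.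
exists (Re del / 2).
  by rewrite divr_gt0//; move: del0; rewrite ltcE /= => /andP[].
move=> w hw.
have delE : del = (Re del)%:C.
  by apply/eqP; rewrite eq_complex /= eqxx /=; move: del0; rewrite ltcE /= => /andP[/eqP ->].
have [->|wz] := eqVneq w z; first by rewrite !subrr mulr0 subrr modulus0 mulr0.
have wz0 : w - z != 0 by rewrite subr_eq0.
have m0 : 0 < modulus (w - z).
  by rewrite lt_def modulus_ge0 andbT; apply: contra wz0 => /eqP/modulus_eq0 ->.
have Rd : 0 < Re del by rewrite -ltcR -delE.
have := hd (w - z); rewrite /ball_ /= sub0r normrN => /(_ _ wz0) h1.
have {h1} : modulus (c - (w - z)^-1 * (h w - h z)) < e.
  have -> : h w = h ((w - z) *: 1 + z) by congr h; rewrite /GRing.scale /= mulr1 subrK.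
  apply: h1; rewrite normE delE ltcR; apply: (le_lt_trans hw).
  by rewrite gtr_pMr// invf_lt1// ltr1n.
move=> h1.
have -> : h w - h z - c * (w - z) = - ((c - (w - z)^-1 * (h w - h z)) * (w - z)).
  by rewrite mulrBl mulrAC mulVf// mul1r opprB.
by rewrite modulusN modulusM ler_pM2r// ltW.
Qed.

Lemma cdiff_lip h z : cdiff h z -> exists2 K : R, 0 < K & exists2 del : R, 0 < del &
  forall w, modulus (w - z) <= del -> modulus (h w - h z) <= K * modulus (w - z).
Proof.
move=> [c hc]; have [del del0 hd] := hc 1 ltr01.
exists (modulus c + 1); first by rewrite ltr_wpDl// modulus_ge0.
exists del => // w /hd h1.
have -> : h w - h z = c * (w - z) + (h w - h z - c * (w - z)) by ring.
by apply: (le_trans (modulusD _ _)); rewrite mulrDl -modulusM lerD2l.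
Qed.

Lemma cdiff_continuous h z : cdiff h z -> h w @[w --> z] --> h z.
Proof.
move=> /cdiff_lip[K K0 [del del0 hd]]; apply/(complex_cvgP (F := nbhs z)) => e e0.
have r0 : 0 < Num.min del (e / (2 * K)) by rewrite lt_min del0 divr_gt0// mulr_gt0.
have hz : \forall x \near z, modulus (z - x) < Num.min del (e / (2 * K)).
  by apply: (iffLR (complex_cvgP (F := nbhs z) id z)) => //; exact: cvg_id.
near=> w; have : modulus (z - w) < Num.min del (e / (2 * K)) by near: w.
move=> /=; rewrite lt_min modulus_distC => /andP[h1 h2].
rewrite modulus_distC; apply: (le_lt_trans (hd w (ltW h1))).
rewrite -ltr_pdivlMl//; apply: (lt_le_trans h2).
have := divr_gt0 e0 K0; rewrite invfM mulrCA (mulrC K^-1); lra.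
Unshelve. all: by end_near. Qed.

Lemma cdiff_cst k z : cdiff (fun=> k) z.
Proof.
exists 0 => e e0; exists 1 => // w _; rewrite subrr mul0r subrr modulus0.
by rewrite mulr_ge0 ?modulus_ge0// ltW.
Qed.

Lemma cdiff_id z : cdiff id z.
Proof.
exists 1 => e e0; exists 1 => // w _; rewrite mul1r subrr modulus0.
by rewrite mulr_ge0 ?modulus_ge0// ltW.
Qed.

Lemma cdiffD h g z : cdiff h z -> cdiff g z -> cdiff (fun w => h w + g w) z.
Proof.
move=> [c hc] [d hd]; exists (c + d) => e e0.
have e2 : 0 < e / 2 by rewrite divr_gt0.
have [d1 d10 h1] := hc _ e2; have [d2 d20 h2] := hd _ e2.
exists (Num.min d1 d2); first by rewrite lt_min d10.
move=> w; rewrite le_min => /andP[/h1 {}h1 /h2 {}h2].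
have -> : h w + g w - (h z + g z) - (c + d) * (w - z) =
  (h w - h z - c * (w - z)) + (g w - g z - d * (w - z)) by ring.
by apply: (le_trans (modulusD _ _)); lra.
Qed.

Lemma cdiffM h g z : cdiff h z -> cdiff g z -> cdiff (fun w => h w * g w) z.
Proof.
move=> dh dg; have [K K0 [dl dl0 hl]] := cdiff_lip dh.
have [K' K'0 [dl' dl'0 hl']] := cdiff_lip dg.
move: dh dg => [c hc] [d hd]; exists (c * g z + h z * d) => e e0.
pose m := modulus (g z) + modulus (h z) + 1.
have m0 : 0 < m by rewrite ltr_wpDl// addr_ge0// modulus_ge0.
have em : 0 < e / (2 * m) by rewrite divr_gt0// mulr_gt0.
have eK : 0 < e / (2 * (K * K')) by rewrite divr_gt0// !mulr_gt0.
have [d1 d10 h1] := hc _ em; have [d2 d20 h2] := hd _ em.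
exists (Num.min (Num.min d1 d2) (Num.min (Num.min dl dl') (e / (2 * (K * K'))))).
  by rewrite !lt_min d10 d20 dl0 dl'0.
move=> w; rewrite !le_min => /andP[/andP[/h1 {}h1 /h2 {}h2] /andP[/andP[/hl {}hl /hl' {}hl'] h3]].
have -> : h w * g w - h z * g z - (c * g z + h z * d) * (w - z) =
  (h w - h z - c * (w - z)) * g z + h z * (g w - g z - d * (w - z)) +
  (h w - h z) * (g w - g z) by ring.
have x0 := modulus_ge0 (w - z).
apply: (le_trans (modulusD _ _)); apply: (@le_trans _ _
  (e / (2 * m) * modulus (w - z) * m + e / 2 * modulus (w - z))); last first.
  by rewrite mulrAC (invfM 2 m) mulrA divfK ?gt_eqF// -mulrDl -splitr.
apply: lerD.
  apply: (le_trans (modulusD _ _)); rewrite !modulusM /m.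
  have y0 := modulus_ge0 (g z); have t0 := modulus_ge0 (h z).
  have := ler_wpM2r y0 h1; have := ler_wpM2l t0 h2.
  have : 0 <= e / (2 * m) * modulus (w - z) by rewrite mulr_ge0// ltW.
  by rewrite /m; lra.
rewrite modulusM; apply: (@le_trans _ _ (K * modulus (w - z) * (K' * modulus (w - z)))).
  by apply: ler_pM; rewrite ?modulus_ge0.
rewrite mulrACA mulrA; apply: ler_wpM2r => //.
rewrite -ler_pdivlMl ?mulr_gt0//.
by rewrite mulrC -mulrA -invfM.
Qed.

Lemma cdiffX h z n : cdiff h z -> cdiff (fun w => h w ^+ n) z.
Proof.
move=> dh; elim: n => [|n IH].
  by have -> : (fun w => h w ^+ 0) = (fun=> 1) by []; exact: cdiff_cst.
by under eq_fun do rewrite exprS; exact: cdiffM.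
Qed.

Lemma cdiffV z : z != 0 -> cdiff (fun w : R[i] => w^-1) z.
Proof. by move=> z0; apply: derivable_cdiff; exact: derivableV. Qed.

End complex_differentiability.

Section polar.
Variable R : realType.
Implicit Types (s t x y : R).

Lemma derivable0_approx (f : R -> R) (df : R) : is_derive (0 : R) (1 : R) f df -> forall e, 0 < e ->
  exists2 del : R, 0 < del & forall x, `|x| <= del -> `|f x - f 0 - df * x| <= e * `|x|.
Proof.
move=> [df0 dfE] e e0; move/cvg_ex : df0 => [c hc].
have cE : c = df by rewrite -dfE; apply/esym/cvg_lim.
rewrite cE in hc.
move/cvgrPdist_lt : hc => /(_ e e0)[del /= del0 hd].
exists (del / 2); first by rewrite divr_gt0.
move=> x hx; have [->|x0] := eqVneq x 0; first by rewrite subrr mulr0 subrr normr0 mulr0.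
have := hd x; rewrite /ball_ /= sub0r normrN => /(_ _ x0) h1.
have {h1} : `|df - x^-1 * (f x - f 0)| < e.
  have := h1 _; rewrite /GRing.scale /= mulr1 addr0; apply.
  by apply: (le_lt_trans hx); rewrite gtr_pMr// invf_lt1// ltr1n.
have -> : f x - f 0 - df * x = - ((df - x^-1 * (f x - f 0)) * x).
  by rewrite mulrBl mulrAC mulVf// mul1r opprB.
by move=> h1; rewrite normrN normrM ler_wpM2r// ltW.
Qed.

(** The exponential of 2 pi (s + i t): it turns annuli into rectangles, and is
    conformal, so it preserves closed forms. *)
Definition polar s t : R[i] := (expR (2 * pi * s))%:C * circle_param t.

Lemma circle_paramD t t' : circle_param (t + t') = circle_param t * circle_param t' :> R[i].
Proof.
rewrite /circle_param mulrDr cosD sinD; apply/eqP; rewrite eq_complex /=.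
by rewrite eqxx /= addrC.
Qed.

Lemma modulus_circle_param t : modulus (circle_param t : R[i]) = 1.
Proof. by rewrite modulusE /= cos2Dsin2 sqrtr1. Qed.

Lemma polarD s t s' t' : polar (s + s') (t + t') = polar s t * polar s' t'.
Proof. by rewrite /polar circle_paramD mulrDr expRD rmorphM mulrACA. Qed.

Lemma modulus_polar s t : modulus (polar s t) = expR (2 * pi * s).
Proof. by rewrite modulusM modulus_circle_param mulr1 modulusC gtr0_norm// expR_gt0. Qed.

Lemma exp_approx e : 0 < e -> exists2 del : R, 0 < del & forall x y,
  `|x| <= del -> `|y| <= del ->
  modulus ((expR x * cos y - 1 - x) +i* (expR x * sin y - y)) <= e * (`|x| + `|y|).
Proof.
move=> e0.
pose n := Num.min e 1 / 8.
have n0 : 0 < n by rewrite divr_gt0// lt_min e0 ltr01.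
have [ne n1] : 8 * n <= e /\ 8 * n <= 1.
  by rewrite /n mulrCA divff// mulr1 !ge_min !lexx orbT.
have [d1 d10 h1] := derivable0_approx (@is_derive_sin R 0) n0.
have [d2 d20 h2] := derivable0_approx (@is_derive_cos R 0) n0.
have [d3 d30 h3] := derivable0_approx (@is_derive_expR R 0) n0.
exists (Num.min (Num.min d1 d2) (Num.min d3 (n / 4))).
  by rewrite !lt_min d10 d20 d30 divr_gt0.
move=> x y; rewrite !le_min => /andP[_ /andP[/h3 {}h3 x2]] /andP[/andP[/h1 {}h1 /h2 {}h2] _].
move: h1 h2 h3; rewrite sin0 cos0 expR0 oppr0 mul0r !subr0 !mul1r !addr0 => h1 h2 h3.
have ax := normr_ge0 x; have ay := normr_ge0 y.
have nx : n * `|x| <= 1 * `|x| by rewrite ler_wpM2r//; move: n0 n1; lra.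
have ny : n * `|y| <= 1 * `|y| by rewrite ler_wpM2r//; move: n0 n1; lra.
have hx2 : `|expR x - 1| <= 2 * `|x|.
  have -> : expR x - 1 = (expR x - 1 - x) + x by ring.
  by apply: (le_trans (ler_normD _ _)); move: h3 nx; lra.
have hx3 : `|expR x| <= 2.
  have -> : expR x = (expR x - 1) + 1 by ring.
  by apply: (le_trans (ler_normD _ _)); rewrite normr1; move: hx2 x2 n1; lra.
have hs : `|sin y| <= 2 * `|y|.
  have -> : sin y = (sin y - y) + y by ring.
  by apply: (le_trans (ler_normD _ _)); move: h1 ny; lra.
have p1 : `|expR x * (cos y - 1)| <= 2 * (n * `|y|).
  by rewrite normrM; apply: ler_pM.
have p2 : `|(expR x - 1) * sin y| <= n * `|y|.
  rewrite normrM; apply: (@le_trans _ _ (n / 2 * (2 * `|y|))).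
    by apply: ler_pM => //; move: hx2 x2; lra.
  by rewrite mulrA divfK.
apply: (le_trans (modulus_le_ReIm _)) => /=.
have -> : expR x * cos y - 1 - x = (expR x - 1 - x) + expR x * (cos y - 1) by ring.
have -> : expR x * sin y - y = (sin y - y) + (expR x - 1) * sin y by ring.
have := ler_normD (expR x - 1 - x) (expR x * (cos y - 1)).
have := ler_normD (sin y - y) ((expR x - 1) * sin y).
have := ler_wpM2r ax ne; have := ler_wpM2r ay ne.
have := mulr_ge0 (ltW n0) ax; have := mulr_ge0 (ltW n0) ay.
by move: h1 h3 p1 p2; clear; lra.
Qed.

Lemma norm_2pi u : `|2 * pi * u| = 2 * pi * `|u| :> R.
Proof.
have tp : 0 <= 2 * pi :> R by rewrite mulr_ge0// pi_ge0.
by rewrite normrM [X in X * _]ger0_norm.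
Qed.

Lemma polar_approx s t e : 0 < e -> exists2 del : R, 0 < del & forall s' t',
  `|s' - s| <= del -> `|t' - t| <= del ->
  modulus (polar s' t' - polar s t -
    polar s t * ((2 * pi * (s' - s)) +i* (2 * pi * (t' - t)))) <= e * (`|s' - s| + `|t' - t|).
Proof.
move=> e0; have tp : 0 < 2 * pi :> R by rewrite mulr_gt0// pi_gt0.
pose K := expR (2 * pi * s) * (2 * pi).
have K0 : 0 < K by rewrite mulr_gt0// expR_gt0.
have eK : 0 < e / K by rewrite divr_gt0.
have [del del0 hd] := exp_approx eK.
exists (del / (2 * pi)); first by rewrite divr_gt0.
move=> s' t'; rewrite !ler_pdivlMr// => hs ht.
have := hd (2 * pi * (s' - s)) (2 * pi * (t' - t)).
have nE (u : R) : `|2 * pi * u| = `|u| * (2 * pi) by rewrite norm_2pi mulrC.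
rewrite !nE => /(_ hs ht) h.
have -> : polar s' t' - polar s t -
    polar s t * ((2 * pi * (s' - s)) +i* (2 * pi * (t' - t))) = polar s t *
  ((expR (2 * pi * (s' - s)) * cos (2 * pi * (t' - t)) - 1 - 2 * pi * (s' - s)) +i*
   (expR (2 * pi * (s' - s)) * sin (2 * pi * (t' - t)) - 2 * pi * (t' - t))).
  have -> : polar s' t' = polar s t * polar (s' - s) (t' - t) by rewrite -polarD !subrKC.
  have -> : polar (s' - s) (t' - t) = (expR (2 * pi * (s' - s)) * cos (2 * pi * (t' - t)))
      +i* (expR (2 * pi * (s' - s)) * sin (2 * pi * (t' - t))).
    by rewrite /polar /circle_param; apply/eqP; rewrite eq_complex /= !mul0r subr0 addr0 !eqxx.
  set P := polar s t.
  rewrite -{2}[P]mulr1 -!mulrBr; congr (_ * _); apply/eqP; rewrite eq_complex /=.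
  by rewrite subr0 !eqxx.
rewrite modulusM modulus_polar; apply: (@le_trans _ _ (expR (2 * pi * s) *
  (e / K * (`|s' - s| * (2 * pi) + `|t' - t| * (2 * pi))))).
  by rewrite ler_wpM2l// expR_ge0.
rewrite -mulrDl mulrCA (mulrC _ (2 * pi)) [X in _ * X]mulrA -/K mulrA divfK// gt_eqF//.
Qed.

End polar.

Section polar_form.
Variable R : realType.
Implicit Types (h : R[i] -> R[i]) (s t r : R).

(** The derivative of h o polar is the multiplication by a complex number 2 pi
    k; the Cauchy-Riemann equations between its real and imaginary parts are the
    closedness of the form. *)
Lemma closed_polar h s t : cdiff h (polar s t) ->
  closed_at (fun s t => Im (h (polar s t))) (fun s t => Re (h (polar s t))) s t.
Proof.
move=> [c hc]; have tp : 0 < 2 * pi :> R by rewrite mulr_gt0// pi_gt0.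
pose k := c * polar s t.
have main (e : R) : 0 < e -> exists2 del : R, 0 < del & forall s' t',
    `|s' - s| <= del -> `|t' - t| <= del ->
    modulus (h (polar s' t') - h (polar s t) -
      k * ((2 * pi * (s' - s)) +i* (2 * pi * (t' - t)))) <= e * (`|s' - s| + `|t' - t|).
  move=> e0; pose M := modulus (polar s t) * (2 * pi) + 1.
  have M0 : 0 < M by rewrite ltr_wpDl// mulr_ge0// ?modulus_ge0// ltW.
  have [d1 d10 h1] := hc (e / (2 * M)) ltac:(by rewrite divr_gt0// mulr_gt0).
  have C0 : 0 < modulus c + 1 by rewrite ltr_wpDl// modulus_ge0.
  pose e1 := Num.min 1 (e / (2 * (modulus c + 1))).
  have e10 : 0 < e1 by rewrite lt_min ltr01 divr_gt0// mulr_gt0.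
  have [d2 d20 h2] := polar_approx s t e10.
  exists (Num.min d2 (d1 / (2 * M))); first by rewrite lt_min d20 divr_gt0// mulr_gt0.
  move=> s' t'; rewrite !le_min => /andP[hs2 hs1] /andP[ht2 ht1].
  have {}h2 := h2 s' t' hs2 ht2.
  set x := `|s' - s| in hs1 h2 *; set y := `|t' - t| in ht1 h2 *.
  set q := _ +i* _ in h2 *.
  have x0 : 0 <= x by exact: normr_ge0.
  have y0 : 0 <= y by exact: normr_ge0.
  have hq : modulus q <= 2 * pi * (x + y).
    apply: (le_trans (modulus_le_ReIm _)) => /=.
    by rewrite !norm_2pi -/x -/y -(mulrDr (2 * pi) x y); exact: lexx.
  have hE : modulus (polar s' t' - polar s t) <= M * (x + y).
    have -> : polar s' t' - polar s t =
      (polar s' t' - polar s t - polar s t * q) + polar s t * q by ring.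
    apply: (le_trans (modulusD _ _)).
    have := ler_wpM2l (modulus_ge0 (polar s t)) hq.
    rewrite -modulusM => hq'.
    have h3 : e1 * (x + y) <= 1 * (x + y).
      by rewrite ler_wpM2r ?addr_ge0// ge_min lexx.
    rewrite /M mulrDl; apply: (le_trans (lerD h2 hq')).
    by rewrite addrC -!mulrA lerD2l.
  have hE1 : modulus (polar s' t' - polar s t) <= d1.
    apply: (le_trans hE); rewrite -ler_pdivlMl// mulrC.
    have -> : d1 / M = d1 / (2 * M) + d1 / (2 * M) by field; rewrite gt_eqF.
    exact: lerD.
  have {}h1 := h1 _ hE1.
  have -> : h (polar s' t') - h (polar s t) - k * q =
    (h (polar s' t') - h (polar s t) - c * (polar s' t' - polar s t)) +
    c * (polar s' t' - polar s t - polar s t * q) by rewrite /k; ring.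
  apply: (le_trans (modulusD _ _)); rewrite modulusM (splitr e) mulrDl; apply: lerD.
    apply: (le_trans h1); apply: (@le_trans _ _ (e / (2 * M) * (M * (x + y)))).
      by rewrite ler_wpM2l// divr_ge0 ?(ltW e0)// mulr_ge0// ltW.
    by rewrite mulrA (invfM 2 M) mulrA divfK// gt_eqF.
  apply: (@le_trans _ _ ((modulus c + 1) * (e / (2 * (modulus c + 1)) * (x + y)))).
    apply: ler_pM; rewrite ?modulus_ge0 ?lerDl//.
    apply: (le_trans h2); rewrite ler_wpM2r ?addr_ge0// ge_min lexx orbT //.
  have -> : (modulus c + 1) * (e / (2 * (modulus c + 1)) * (x + y)) = e / 2 * (x + y).
    by field; rewrite gt_eqF.
  exact: lexx.
exists (2 * pi * Im k), (2 * pi * Re k), (2 * pi * (- Im k)); split.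
  move=> e /main[del del0 hd]; exists del => // s' t' hs ht.
  apply: le_trans (hd s' t' hs ht).
  have := Im_le_modulus (h (polar s' t') - h (polar s t) -
      k * ((2 * pi * (s' - s)) +i* (2 * pi * (t' - t)))).
  rewrite !Im_sub Im_mul /=; congr (`|_ - _| <= _).
  by ring.
move=> e /main[del del0 hd]; exists del => // s' t' hs ht.
apply: le_trans (hd s' t' hs ht).
have := Re_le_modulus (h (polar s' t') - h (polar s t) -
    k * ((2 * pi * (s' - s)) +i* (2 * pi * (t' - t)))).
rewrite !Re_sub Re_mul /=; congr (`|_ - _| <= _).
by ring.
Qed.

Lemma circle_param1 : circle_param 1 = circle_param 0 :> R[i].
Proof. by rewrite /circle_param mulr1 mulr0 mulr_natl mulr2n cosDpi sinDpi cospi sinpi cos0 sin0 opprK oppr0. Qed.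

Definition circle_avg h r : R := rint (fun t => Re (h (r%:C * circle_param t))) 0 1.

(** On the rectangle ln r <= 2 pi s <= ln r', 0 <= t <= 1, the form Im h ds + Re
    h dt is closed. The sides t = 0 and t = 1 cancel by periodicity, and the
    other two are the circle averages. *)
Lemma circle_avg_const h r r' : (forall z, 0 < modulus z < 1 -> cdiff h z) ->
  0 < r -> r <= r' -> r' < 1 -> circle_avg h r = circle_avg h r'.
Proof.
move=> dh r0 rr r1; have tp : 0 < 2 * pi :> R by rewrite mulr_gt0// pi_gt0.
have r'0 := lt_le_trans r0 rr.
pose lg (x : R) := ln x / (2 * pi).
have lgK x : 0 < x -> expR (2 * pi * lg x) = x.
  by move=> x0; rewrite /lg mulrCA divff ?gt_eqF// mulr1 lnK.
have lgle : lg r <= lg r' by rewrite /lg ler_pM2r ?invr_gt0// ler_ln.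
have hc : closed_on (fun s t => Im (h (polar s t))) (fun s t => Re (h (polar s t)))
    (lg r) (lg r') 0 1.
  move=> s t /andP[_ hs] _; apply: closed_polar; apply: dh.
  rewrite modulus_polar expR_gt0 /=; apply: le_lt_trans r1.
  by rewrite -(lgK _ r'0) ler_expR ler_pM2l.
have := boundary0 lgle ler01 hc; rewrite /boundary.
have -> : (fun s => Im (h (polar s 0)) - Im (h (polar s 1))) = fun=> 0.
  by apply/funext => s; rewrite /polar circle_param1 subrr.
rewrite rint_cst// mul0r add0r rintB; last 2 first.
- by apply: (closed_on_continuous2 hc); rewrite lgle lexx.
- by apply: (closed_on_continuous2 hc); rewrite lgle lexx.
by rewrite /polar !lgK// => /eqP; rewrite subr_eq0 => /eqP/esym.
Qed.

End polar_form.

(** * The circle measure *)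

Section circle_mean.
Variable R : realType.
Local Notation P := (circle_measure R).
Implicit Types (g : R[i] -> R) (t : R).

Let nu : {measure set (measurableTypeR R) -> \bar R} :=
  mrestr (@lebesgue_measure R) (measurable_itv `[0, 1[%R).

Let C : {mfun measurableTypeR R >-> R[i]} := HB.pack (@circle_param R)
    (isMeasurableFun.Build _ _ (measurableTypeR R) R[i] (@circle_param R)
      (@measurable_circle_param R)).

Lemma ge0_integral_circle (f : R[i] -> \bar R) : measurable_fun setT f ->
  (forall z, 0 <= f z)%E ->
  (\int[P]_z f z = \int[@lebesgue_measure R]_(t in `[0%R, 1%R[) f (circle_param t))%E.
Proof.
move=> mf f0.
have -> : (\int[P]_z f z = \int[pushforward nu C]_z f z)%E.
  exact: eq_measure_integral.
rewrite ge0_integral_pushforward// preimage_setT.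
have mD : measurable (`[0, 1[ : set (measurableTypeR R)) by exact: measurable_itv.
have mfC : measurable_fun setT (f \o C) by exact: measurableT_comp.
rewrite (@ge0_negligible_integral _ _ _ nu setT (~` `[0, 1[)) //; last 3 first.
- by apply: measurableC.
- by move=> t _; exact: f0.
- by rewrite /nu /= /mrestr setICl measure0.
rewrite setTD setCK; apply: eq_measure_integral => A mA A01.
by rewrite /nu /= /mrestr; congr (lebesgue_measure _); apply: setIidl.
Qed.

Lemma mean_circle g : bmeas g -> (forall t, {for t, continuous (fun t => g (circle_param t))}) ->
  mean P g = rint (fun t => g (circle_param t)) 0 1.
Proof.
move=> bg cg; have [mg [M gM]] := bg.
have bh : bmeas (fun z => g z + M) by apply: bmeasD => //; exact: bmeas_cst.
have ch : continuous_btw (fun t => g (circle_param t) + M) 0 1.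
  by move=> t _; apply: cvgD; [exact: cg|exact: cvg_cst].
have hM : mean P (fun z => g z + M) = rint (fun t => g (circle_param t) + M) 0 1.
  rewrite /mean /rint /Rintegral (@ge0_integral_circle (fun z => (g z + M)%:E)) //=.
  - rewrite -[LHS]/(\int[_]_(_ in _) _) -[RHS]/(\int[_]_(_ in _) _).
    apply: (@Rintegral_itv_bndo_bndc R (BLeft 0) 1 (fun t => g (circle_param t) + M)).
    apply: integrableS (continuous_btw_integrable ch) => //.
    by apply: subset_itv; rewrite bnd_simp.
  - by apply/measurable_EFinP; case: bh.
  - by move=> z; rewrite lee_fin -lerBlDr sub0r; have := gM z; rewrite ler_norml => /andP[].
move: hM; rewrite (meanD P bg (bmeas_cst _ M)) rintD; last 2 first.
- by move=> t _; exact: cg.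
- by move=> t _; exact: cvg_cst.
by rewrite (rint_cst _ ler01) subr0 mulr1 mean_cst => /addIr.
Qed.

Lemma mean_cvg {d} {Om : measurableType d} (Q : probability Om R) (u : nat -> Om -> R) (g : Om -> R) (M : R) :
  (forall n, bmeas (u n)) -> bmeas g -> (forall n w, `|u n w| <= M) ->
  {ae Q, forall w, u n w @[n --> \oo] --> g w} ->
  mean Q (u n) @[n --> \oo] --> mean Q g.
Proof.
move=> bu bg uM ug.
have mu n : measurable_fun setT (EFin \o u n) by apply/measurable_EFinP; case: (bu n).
have mg : measurable_fun setT (EFin \o g) by apply/measurable_EFinP; case: bg.
have ug' : {ae Q, forall w, setT w -> (EFin \o u n) w @[n --> \oo] --> (EFin \o g) w}.
  by apply: filterS ug => w h _; apply: cvg_EFin; [exact: nearW|exact: h].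
have uM' : {ae Q, forall w n, setT w -> (`|(EFin \o u n) w| <= (EFin \o cst M) w)%E}.
  by apply: aeW => w n _; rewrite /= lee_fin.
have iM := bmeas_integrable Q (bmeas_cst _ M).
have [_ _ h] := @dominated_convergence _ _ _ Q setT measurableT _ _ _ mu mg ug' iM uM'.
apply: fine_cvg; rewrite /mean /Rintegral fineK; first exact: h.
by apply: integrable_fin_num => //; exact: bmeas_integrable.
Qed.

End circle_mean.

(** * Borel functions on the circle and trigonometric moments *)

Section complex_borel.
Variable R : realType.
Implicit Types (c z : R[i]) (s : R).

Definition half_plane c s : set R[i] := [set z | Re (c * z) < s].

Definition half_planes : set (set R[i]) := [set A | exists c s, A = half_plane c s].

Lemma continuous_Re_scale c : continuous (fun z : R[i] => Re (c * z)).
Proof.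
move=> z; apply/(cvgrPdist_lt (FF := nbhs_filter z)) => e e0.
have r0 : 0 < e / (modulus c + 1) by rewrite divr_gt0// ltr_wpDl// modulus_ge0.
have hz : \forall x \near z, modulus (z - x) < e / (modulus c + 1).
  by apply: (iffLR (complex_cvgP (F := nbhs z) id z)) => //; exact: cvg_id.
near=> w.
have h : modulus (z - w) < e / (modulus c + 1) by near: w.
rewrite -Re_sub -mulrBr; apply: (le_lt_trans (Re_le_modulus _)); rewrite modulusM.
apply: (@le_lt_trans _ _ ((modulus c + 1) * modulus (z - w))).
  by rewrite ler_wpM2r ?modulus_ge0// lerDl.
by rewrite -ltr_pdivlMl ?ltr_wpDl ?modulus_ge0// mulrC.
Unshelve. all: by end_near. Qed.

Lemma open_half_plane c s : open (half_plane c s).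
Proof.
have -> : half_plane c s = (fun z => Re (c * z)) @^-1` [set x | x < s] by [].
by apply: open_comp; [move=> z _; exact: continuous_Re_scale|exact: open_lt].
Qed.

(** An open set is a countable union of the rational squares it contains, and a
    square is an intersection of four half-planes. Generating the Borel sets by
    half-planes reduces measurability to real and imaginary parts, and
    indicators to inequalities between trigonometric monomials. *)
Lemma open_sigma_half_planes (U : set R[i]) : open U -> <<s half_planes >> U.
Proof.
move=> oU; pose r (n : nat) : R := n.+1%:R^-1.
pose S (q : (rat * rat) * nat) := [set z : R[i] |
  [/\ Re (z - gauss_rat R q.1) < r q.2, - Re (z - gauss_rat R q.1) < r q.2,
   Im (z - gauss_rat R q.1) < r q.2 & - Im (z - gauss_rat R q.1) < r q.2]].
have mS q : measurable (S q : set (g_sigma_algebraType half_planes)).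
  have mh c s : measurable (half_plane c s : set (g_sigma_algebraType half_planes)).
    by apply: sub_gen_smallest; exists c, s.
  set p := gauss_rat R q.1; pose d : R := r q.2.
  have -> : S q = half_plane 1 (d + Re p) `&` half_plane (-1) (d - Re p) `&`
     (half_plane (- 'i) (d + Im p) `&` half_plane 'i (d - Im p)).
    apply/seteqP; split => z; rewrite /S /half_plane /= !Re_mul !Re_sub !Im_sub -/p -/d /=.
      by move=> [h1 h2 h3 h4]; split; split; lra.
    by move=> [[h1 h2] [h3 h4]]; split; lra.
  by apply: measurableI; apply: measurableI; exact: mh.
have -> : U = \bigcup_q (if `[< S q `<=` U >] then S q else set0).
  apply/seteqP; split => [z Uz|z [q _]]; last by case: asboolP => // h /h.
  have [e /= e0 hU] : exists2 e : R, 0 < e & forall w, modulus (z - w) < e -> U w.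
    have [e /= e0 h] := oU z Uz; exists (Re e).
      by move: e0; rewrite ltcE /= => /andP[].
    move=> w hw; apply: h; rewrite /ball_ /= normE.
    by move: e0 hw; case: e => a b /=; rewrite !ltcE /= => /andP[/eqP <- _] ->; rewrite eqxx.
  have [n hn] := inv_small (eps := e / 4) ltac:(lra).
  rewrite -/(r n) in hn.
  have [p hp] := gauss_rat_dense z (eps := r n) ltac:(by rewrite invr_gt0).
  have hR := Re_le_modulus (z - gauss_rat R p); have hI := Im_le_modulus (z - gauss_rat R p).
  rewrite ler_norml in hR; rewrite ler_norml in hI.
  move: hR hI => /andP[hR1 hR2] /andP[hI1 hI2].
  have hz : S (p, n) z.
    by split; apply: le_lt_trans hp; rewrite // lerNl.
  exists (p, n) => //; case: asboolP => [_|[]]; first exact: hz.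
  move=> w [] /= h1 h2 h3 h4; apply: hU; apply: (le_lt_trans (modulus_le_ReIm _)).
  rewrite !Re_sub !Im_sub in h1 h2 h3 h4 hR1 hR2 hI1 hI2 *.
  have hR : `|Re z - Re w| <= 2 * r n by rewrite ler_norml; apply/andP; split; lra.
  have hI : `|Im z - Im w| <= 2 * r n by rewrite ler_norml; apply/andP; split; lra.
  by lra.
apply: (@countable_bigcupT_measurable _ (g_sigma_algebraType half_planes)).
  exact: countableP.
by move=> q; case: asboolP => // _; exact: mS.
Qed.

Lemma borel_half_planes : <<s @open R[i] >> = <<s half_planes >>.
Proof.
apply/seteqP; split; apply: smallest_sub; try exact: smallest_sigma_algebra.
  by move=> U; exact: open_sigma_half_planes.
by move=> _ [c [s ->]]; apply: sub_gen_smallest; exact: open_half_plane.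
Qed.

Lemma measurable_complex_fun d (Om : measurableType d) (X : Om -> R[i]) :
  measurable_fun setT (fun w => Re (X w)) -> measurable_fun setT (fun w => Im (X w)) ->
  measurable_fun setT X.
Proof.
move=> mR mI; apply: (@measurability _ _ _ _ _ _ half_planes); first exact: borel_half_planes.
move=> _ [_ [c [s ->]] <-]; rewrite setTI.
have m : measurable_fun setT (fun w => Re (c * X w)).
  under eq_fun do rewrite Re_mul.
  by apply: measurable_funB; apply: measurable_funM.
have := m measurableT _ (@measurable_itv R `]-oo, s[); rewrite setTI.
by congr measurable; apply/seteqP; split => w /=; rewrite in_itv.
Qed.

Lemma measurable_ReM c : measurable_fun setT (fun z : R[i] => Re (c * z)).
Proof.
apply: (@measurability _ _ _ _ _ _ (@RGenOpens.G R)); first exact: RGenOpens.measurableE.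
move=> _ [_ [x [y ->]] <-]; rewrite setTI; apply: sub_gen_smallest.
by apply: open_comp; [move=> z _; exact: continuous_Re_scale|exact: interval_open].
Qed.

Lemma measurable_Re : measurable_fun setT (fun z : R[i] => Re z).
Proof. by have := measurable_ReM 1; under eq_fun do rewrite mul1r. Qed.

Lemma measurable_Im : measurable_fun setT (fun z : R[i] => Im z).
Proof.
have := measurable_ReM (- 'i).
by under eq_fun do rewrite Re_mul /= oppr0 mul0r sub0r mulN1r opprK.
Qed.

Lemma measurable_complex_pow d (Om : measurableType d) (W : Om -> R[i]) k :
  measurable_fun setT W -> measurable_fun setT (fun w => Re (W w ^+ k)) /\
    measurable_fun setT (fun w => Im (W w ^+ k)).
Proof.
move=> mW.
have mR : measurable_fun setT (fun w => Re (W w)) by apply: measurableT_comp mW; exact: measurable_Re.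
have mI : measurable_fun setT (fun w => Im (W w)) by apply: measurableT_comp mW; exact: measurable_Im.
elim: k => [|k [IHR IHI]].
  by under eq_fun do rewrite expr0; under [X in _ /\ measurable_fun _ X]eq_fun do rewrite expr0.
split.
  under eq_fun do rewrite exprS Re_mul.
  by apply: measurable_funB; apply: measurable_funM.
under eq_fun do rewrite exprS Im_mul.
by apply: measurable_funD; apply: measurable_funM.
Qed.

(** Almost everywhere equal to the identity for the circle measure, but
    unimodular everywhere, so that no exceptional set has to be carried along. *)
Definition circle_retract z : R[i] := if modulus z == 1 then z else 1.

Lemma modulus_circle_retract z : modulus (circle_retract z) = 1.
Proof. by rewrite /circle_retract; case: eqP => // _; rewrite modulus1. Qed.

Lemma circle_retract_id z : modulus z = 1 -> circle_retract z = z.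
Proof. by move=> h; rewrite /circle_retract h eqxx. Qed.

Lemma measurable_modulus : measurable_fun setT (fun z : R[i] => modulus z).
Proof.
under eq_fun do rewrite modulusE.
apply: measurableT_comp; first exact: (continuous_measurable_fun (@sqrt_continuous R)).
by apply: measurable_funD; apply: measurable_funX; [exact: measurable_Re|exact: measurable_Im].
Qed.

Lemma measurable_circle : measurable [set z : R[i] | modulus z = 1].
Proof.
have := measurable_modulus measurableT (@measurable_set1 R 1); rewrite setTI.
by congr measurable.
Qed.

Lemma measurable_circle_retract : measurable_fun setT circle_retract.
Proof.
have mb : measurable_fun setT (fun z : R[i] => modulus z == 1).
  apply: (measurable_fun_bool true); rewrite setTI.
  have := measurable_circle; congr measurable.
  by apply/seteqP; split => z /=; [move=> ->; rewrite eqxx|move/eqP].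
apply: measurable_complex_fun.
  have -> : (fun w => Re (circle_retract w)) = fun w => if modulus w == 1 then Re w else Re (1 : R[i]).
    by apply/funext => w; rewrite /circle_retract; case: ifP.
  by apply: measurable_fun_ifT => //; exact: measurable_Re.
have -> : (fun w => Im (circle_retract w)) = fun w => if modulus w == 1 then Im w else Im (1 : R[i]).
  by apply/funext => w; rewrite /circle_retract; case: ifP.
by apply: measurable_fun_ifT => //; exact: measurable_Im.
Qed.

End complex_borel.

Section baire.
Variable R : realType.
Local Notation X := (@circle_retract R).
Implicit Types (g h : R[i] -> R) (A : set R[i]).

(** The smallest class of functions on the circle that contains the
    trigonometric monomials and is closed under sums and bounded pointwise
    limits. Equality of moments propagates to it by induction, and it contains
    all the bounded Borel functions. *)
Inductive baire : (R[i] -> R) -> Prop :=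
| baire_monomial c k : baire (fun z => Re (c * X z ^+ k))
| baireD g h : baire g -> baire h -> baire (fun z => g z + h z)
| baire_lim (u : nat -> R[i] -> R) g (M : R) : (forall n, baire (u n)) ->
    (forall n z, `|u n z| <= M) -> (forall z, u n z @[n --> \oo] --> g z) -> baire g.

Lemma baire_eq g h : baire g -> g =1 h -> baire h.
Proof. by move=> bg /funext <-. Qed.

Lemma baire_bounded g : baire g -> exists M : R, forall z, `|g z| <= M.
Proof.
elim=> [c k|{}g h _ [M gM] _ [N hN]|u {}g M _ _ uM ug].
- exists (modulus c) => z; apply: (le_trans (Re_le_modulus _)).
  by rewrite modulusM modulusX modulus_circle_retract expr1n mulr1.
- by exists (M + N) => z; apply: (le_trans (ler_normD _ _)); apply: lerD.
- exists M => z; apply: (@closed_cvg _ _ \oo _ (fun n => u n z) (fun x => `|x| <= M)) (ug z).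
    rewrite [X in closed X](_ : _ = `[- M, M]%classic); first exact: interval_closed.
    by apply/seteqP; split => x /=; rewrite in_itv /= ler_norml.
  exact: nearW.
Qed.

Lemma baire_cst (c : R) : baire (fun=> c).
Proof.
by apply: (baire_eq (baire_monomial c%:C 0)) => z; rewrite expr0 mulr1.
Qed.

Lemma baireZ (c : R) g : baire g -> baire (fun z => c * g z).
Proof.
elim=> [d k|{}g h _ bg _ bh|u {}g M _ bu uM ug].
- by apply: (baire_eq (baire_monomial (c%:C * d) k)) => z; rewrite -mulrA Re_scale.
- by apply: (baire_eq (baireD bg bh)) => z; rewrite mulrDr.
- apply: (baire_lim (M := `|c| * M) bu) => [n z|z]; first by rewrite normrM ler_wpM2l.
  by apply: cvgMr; exact: ug.
Qed.

Lemma baireB g h : baire g -> baire h -> baire (fun z => g z - h z).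
Proof.
move=> bg bh; apply: (baire_eq (baireD bg (baireZ (-1) bh))) => z.
by rewrite mulN1r.
Qed.

(** A product of two monomials is a combination of two monomials, since conj X
    is the inverse of X. Linearity and bounded limits extend this to one factor
    and then to the other. *)
Lemma baireM g h : baire g -> baire h -> baire (fun z => g z * h z).
Proof.
move=> bg bh; elim: bg => [c k|{}g g' _ bg _ bg'|u {}g M _ bu uM ug]; last 2 first.
- by apply: (baire_eq (baireD bg bg')) => z; rewrite mulrDl.
- have [N hN] := baire_bounded bh.
  apply: (baire_lim (M := M * N) bu) => [n z|z]; first by rewrite normrM ler_pM.
  by apply: cvgMl; exact: ug.
elim: bh => [d j|{}g g' _ bg _ bg'|u {}g M _ bu uM ug]; last 2 first.
- by apply: (baire_eq (baireD bg bg')) => z; rewrite mulrDr.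
- apply: (baire_lim (M := modulus c * M) bu) => [n z|z].
    rewrite normrM ler_pM//; apply: (le_trans (Re_le_modulus _)).
    by rewrite modulusM modulusX modulus_circle_retract expr1n mulr1.
  by apply: cvgMr; exact: ug.
have XX z : X z * (X z)^* = 1.
  have X1 := modulus_circle_retract z.
  rewrite -(mulfV (_ : X z != 0)); last by apply: modulus_gt0_neq0; rewrite X1.
  by congr (_ * _); exact: conj_unimodular.
have [jk|kj] := leqP j k.
  apply: (baire_eq (baireZ (1 / 2) (baireD (baire_monomial (c * d) (k + j))
    (baire_monomial (c * d^*) (k - j))))) => z.
  rewrite ReRe_mul exprD mulrACA; congr (_ * (_ + Re _)).
  rewrite rmorphM rmorphXn -{2}(subnK jk) exprD mulrACA; congr (_ * _).
  by rewrite -mulrA -exprMn XX expr1n mulr1.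
apply: (baire_eq (baireZ (1 / 2) (baireD (baire_monomial (c * d) (k + j))
  (baire_monomial (c^* * d) (j - k))))) => z.
rewrite ReRe_mul exprD mulrACA; congr (_ * (_ + _)).
rewrite -[RHS]Re_conjc; congr Re.
rewrite !rmorphM /= !rmorphXn /= !conjcK -{2}(subnK (ltnW kj)) exprD mulrACA; congr (_ * _).
by rewrite mulrCA -exprMn [_^* * _]mulrC XX expr1n mulr1.
Qed.

Lemma baireX g n : baire g -> baire (fun z => g z ^+ n).
Proof.
move=> bg; elim: n => [|n IH]; first exact: baire_cst.
by apply: (baire_eq (baireM bg IH)) => z; rewrite exprS.
Qed.

Lemma baire_sum (F : nat -> R[i] -> R) n : (forall k, baire (F k)) ->
  baire (fun z => \sum_(0 <= k < n) F k z).
Proof.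
move=> bF; elim: n => [|n IH].
  by apply: (baire_eq (baire_cst 0)) => z; rewrite big_nil.
by apply: (baire_eq (baireD IH (bF n))) => z; rewrite big_nat_recr.
Qed.

Lemma baire_prod (F : nat -> R[i] -> R) n : (forall k, baire (F k)) ->
  baire (fun z => \prod_(0 <= k < n) F k z).
Proof.
move=> bF; elim: n => [|n IH].
  by apply: (baire_eq (baire_cst 1)) => z; rewrite big_nil.
by apply: (baire_eq (baireM IH (bF n))) => z; rewrite big_nat_recr.
Qed.

Lemma baire_exp g : baire g -> baire (fun z => expR (g z)).
Proof.
move=> bg; have [M gM] := baire_bounded bg.
apply: (baire_lim (u := fun n z => \sum_(0 <= k < n) exp_coeff (g z) k) (M := expR M)).
- move=> n; apply: baire_sum => k.
  by apply: (baire_eq (baireZ (k`!%:R^-1) (baireX k bg))) => z; rewrite mulrC.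
- move=> n z; apply: (@le_trans _ _ (series (exp_coeff `|g z|) n)).
    apply: (le_trans (ler_norm_sum _ _ _)); apply: ler_sum => k _.
    by rewrite /exp_coeff /= normrM normrX normfV normr_nat.
  apply: (@le_trans _ _ (expR `|g z|)); last by rewrite ler_expR.
  rewrite /expR; apply: nondecreasing_cvgn_le; last exact: is_cvg_series_exp_coeff.
  by apply: nondecreasing_series => k _ _; exact: exp_coeff_ge0.
- by move=> z; exact: is_cvg_series_exp_coeff.
Qed.

Lemma inv_nat_cvg : (n%:R^-1 : R) @[n --> \oo] --> (0 : R).
Proof. by rewrite -(cvg_shiftS (fun n : nat => n%:R^-1 : R)); exact: cvg_harmonic. Qed.

(** The inner term n exp (n y) tends to 0 if y < 0, and is at least n otherwise:
    indicators of strict inequalities are limits of functions in an algebra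
    closed under the exponential. *)
Lemma exp_exp_cvg (y : R) :
  expR (- (n%:R * expR (n%:R * y))) @[n --> \oo] --> ((y < 0)%R%:R : R).
Proof.
have sq (x : R) : 0 <= x -> x ^+ 2 / 4 <= expR x.
  move=> x0; have -> : expR x = expR (x / 2) ^+ 2 by rewrite expr2 -expRD -splitr.
  have -> : x ^+ 2 / 4 = (x / 2) ^+ 2 by rewrite expr_div_n; congr (_ / _); ring.
  rewrite lerXn2r ?nnegrE ?divr_ge0 ?expR_ge0//.
  by apply: le_trans (expR_ge1Dx _); rewrite lerDr.
case: ltP => [y0|y0].
  rewrite [X in _ --> X](_ : _ = expR (- 0)); last by rewrite oppr0 expR0.
  apply: continuous_cvg; first exact: continuous_expR.
  apply: cvgN; apply: (@squeeze_cvgr _ _ _ _ (fun=> 0) (fun n : nat => 4 / y ^+ 2 * n%:R^-1)).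
  - near=> n; rewrite mulr_ge0 ?expR_ge0//=.
    have n0 : (0 < n)%N by near: n; exists 1%N.
    have n0' : 0 < n%:R :> R by rewrite ltr0n.
    have -> : n%:R * y = - (n%:R * - y) by rewrite mulrN opprK.
    have ny0 : 0 < n%:R * - y by rewrite mulr_gt0// oppr_gt0.
    have := sq _ (ltW ny0); rewrite expRN => h.
    have q0 : 0 < (n%:R * - y) ^+ 2 / 4 by rewrite divr_gt0// exprn_gt0.
    apply: (@le_trans _ _ (n%:R * ((n%:R * - y) ^+ 2 / 4)^-1)).
      by rewrite ler_wpM2l// lef_pV2// posrE expR_gt0.
    rewrite le_eqVlt; apply/orP; left; apply/eqP; field.
    by rewrite gt_eqF//= lt_eqF.
  - exact: cvg_cst.
  - rewrite -[X in _ --> X](mulr0 (4 / y ^+ 2)); apply: cvgMr.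
    exact: inv_nat_cvg.
apply: (@squeeze_cvgr _ _ _ _ (fun=> 0) (fun n : nat => n%:R^-1)); last 2 first.
- exact: cvg_cst.
- exact: inv_nat_cvg.
near=> n; rewrite expR_ge0 expRN /=.
have n0 : (0 < n)%N by near: n; exists 1%N.
have n0' : 0 < n%:R :> R by rewrite ltr0n.
rewrite lef_pV2 ?posrE ?expR_gt0//.
have h1 : 1 <= expR (n%:R * y) by rewrite -expR0 ler_expR mulr_ge0.
have h2 : n%:R <= n%:R * expR (n%:R * y) by rewrite ler_peMr// ltW.
by apply: (le_trans _ (expR_ge1Dx _)); apply: (le_trans h2); rewrite lerDr.
Unshelve. all: by end_near. Qed.


Lemma baire_lt0 g : baire g -> baire (fun z => (g z < 0)%R%:R).
Proof.
move=> bg; apply: (baire_lim (u := fun n z => expR (- (n%:R * expR (n%:R * g z)))) (M := 1)).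
- move=> n; apply: baire_exp.
  apply: (baire_eq (baireZ (-1) (baireZ n%:R (baire_exp (baireZ n%:R bg))))) => z.
  by rewrite mulN1r.
- move=> n z; rewrite ger0_norm; last exact: expR_ge0.
  have h : 0 <= n%:R * expR (n%:R * g z) by apply: mulr_ge0 => //; exact: expR_ge0.
  by rewrite -[leRHS]expR0 ler_expR oppr_le0.
- by move=> z; exact: exp_exp_cvg.
Qed.

(** Sets whose indicator is of the class form a sigma-algebra, and it contains
    the half-planes by baire_lt0. *)
Lemma baire_borel A : measurable A -> baire (fun z => \1_A (X z)).
Proof.
suff : <<s @half_planes R >> `<=` [set B | baire (fun z => \1_B (X z))].
  by move=> h; rewrite /measurable /= borel_half_planes; exact: h.
have baireC B : baire (fun z => \1_B (X z)) -> baire (fun z => \1_(~` B) (X z)).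
  move=> bB; apply: (baire_eq (baireB (baire_cst 1) bB)) => z.
  by rewrite !indicE in_setC; case: (_ \in _); rewrite /= ?subrr ?subr0.
apply: smallest_sub; last first.
  move=> _ [c [s ->]]; apply: (baire_eq (baire_lt0 (baireB (baire_monomial c 1) (baire_cst s)))) => z.
  by rewrite indicE expr1 subr_lt0; congr (_%:R); congr nat_of_bool; apply/idP/idP => [h|/set_mem//]; exact: mem_set.
split.
- by apply: (baire_eq (baire_cst 0)) => z; rewrite indic0.
- by move=> B; rewrite setTD; exact: baireC.
- move=> F bF; apply: (baire_lim (M := 1)
    (u := fun n z => 1 - \prod_(0 <= k < n) (1 - \1_(F k) (X z)))).
  + move=> n; apply: baireB; first exact: baire_cst.
    by apply: baire_prod => k; apply: baireB; [exact: baire_cst|exact: bF].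
  + move=> n z; suff: 0 <= \prod_(0 <= k < n) (1 - \1_(F k) (X z) : R) <= 1.
      by move=> /andP[h1 h2]; rewrite ger0_norm ?subr_ge0// gerBl.
    elim: n => [|n /andP[h1 h2]]; first by rewrite big_nil ler01 lexx.
    rewrite big_nat_recr//= indicE; case: (_ \in _); rewrite ?subrr ?subr0 ?mulr0 ?mulr1 ?ler01 ?lexx//.
    by rewrite h1.
  + move=> z; rewrite indicE; case: (boolP (_ \in _)) => [|h].
      move=> /set_mem[k _ Fk]; apply: cvg_near_cst; near=> n.
      have kn : (k < n)%N by near: n; exists k.+1.
      rewrite (big_cat_nat (n := k.+1)) //= (big_nat_recr k)//= indicE mem_set//.
      by rewrite subrr mulr0 mul0r subr0.
    apply: cvg_near_cst; near=> n.
    rewrite big1 ?subrr// => k _; rewrite indicE memNset ?subr0// => Fk.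
    by apply/negP : h; rewrite negbK; apply: mem_set; exists k.
Unshelve. all: by end_near. Qed.

(** The sum is the integer part of x. It discretises a bounded function into
    finitely many indicators. *)
Lemma count_le (x : R) m : 0 <= x <= m%:R ->
  x - 1 <= \sum_(0 <= k < m) (k.+1%:R <= x)%R%:R <= x.
Proof.
elim: m => [|m IH] /andP[x0 xm].
  rewrite big_nil; have -> : x = 0 by apply/eqP; rewrite eq_le x0 xm.
  by rewrite sub0r lerN10 lexx.
rewrite big_nat_recr//=; case: (lerP m.+1%:R x) => h.
  have -> : x = m.+1%:R by apply/eqP; rewrite eq_le xm h.
  rewrite (eq_big_nat _ _ (F2 := fun=> 1)); last first.
    by move=> k /andP[_ km]; rewrite ler_nat ltnS ltnW.
  by rewrite big_const_nat subn0 iter_addr_0 -natr1 addrK lexx ler_wpDr.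
rewrite addr0; case: (lerP x m%:R) => h'; first by apply: IH; rewrite x0.
rewrite (eq_big_nat _ _ (F2 := fun=> 1)); last first.
  by move=> k /andP[_ km]; rewrite (le_trans _ (ltW h'))// ler_nat.
rewrite big_const_nat subn0 iter_addr_0 (ltW h') andbT lerBlDr natr1.
exact: ltW.
Qed.

Lemma baire_bmeas g : bmeas g -> baire (fun z => g (X z)).
Proof.
move=> [mg [M gM]].
pose K := 2 * M + 1; pose y z := (g z + M) / K.
have M0 : 0 <= M by apply: le_trans (gM 0).
have K0 : 0 < K by rewrite ltr_wpDl// mulr_ge0.
have y01 z : 0 <= y z <= 1.
  have := gM z; rewrite ler_norml => /andP[h1 h2].
  by rewrite /y divr_ge0 ?(ltW K0)//= ?ler_pdivrMr// ?mul1r /K; move: h1 h2; lra.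
suff by_ : baire (fun z => y (X z)).
  apply: (baire_eq (baireB (baireZ K by_) (baire_cst M))) => z.
  by rewrite /y mulrC divfK ?gt_eqF// addrK.
have my : measurable_fun setT y.
  by apply: measurable_funM => //; apply: measurable_funD.
pose S (n : nat) z := \sum_(0 <= k < n.+1) (k.+1%:R <= n.+1%:R * y z)%R%:R : R.
have hS n z : y z - n.+1%:R^-1 <= n.+1%:R^-1 * S n z <= y z.
  have n0 : 0 < n.+1%:R :> R by [].
  have /andP[y0 y1] := y01 z.
  have := @count_le (n.+1%:R * y z) n.+1.
  rewrite mulr_ge0//= ler_piMr// => /(_ isT) /andP[h1 h2].
  rewrite mulrC ler_pdivrMr// ler_pdivlMr// mulrBl mulVf ?gt_eqF// mulrC.
  by rewrite h1 /=.
apply: (baire_lim (M := 1) (u := fun n z => n.+1%:R^-1 * S n (X z))).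
- move=> n; apply: baireZ; apply: baire_sum => k.
  pose B : set R[i] := [set w | k.+1%:R / n.+1%:R <= y w].
  have mB : measurable B.
    have := my measurableT _ (@measurable_itv R `[k.+1%:R / n.+1%:R, +oo[); rewrite setTI.
    by congr measurable; apply/seteqP; split => w /=; rewrite in_itv /= andbT.
  apply: (baire_eq (baire_borel mB)) => z.
  rewrite indicE mulrC -ler_pdivrMr//; congr (_%:R); congr nat_of_bool.
  by apply/idP/idP => [/set_mem//|h]; exact: mem_set.
- move=> n z; have /andP[y0 y1] := y01 (X z); have /andP[h1 h2] := hS n (X z).
  rewrite ger0_norm; first exact: le_trans y1.
  by rewrite mulr_ge0// sumr_ge0.
- move=> z; apply: (@squeeze_cvgr _ _ _ _ (fun n : nat => y (X z) - n.+1%:R^-1) (fun=> y (X z))).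
  + by near=> n; exact: hS.
  + rewrite -[X in _ --> X]subr0; apply: cvgB; first exact: cvg_cst.
    exact: cvg_harmonic.
  + exact: cvg_cst.
Unshelve. all: by end_near. Qed.

End baire.

Section circle_uniqueness.
Variables (R : realType) (d : measure_display) (Om : measurableType d)
  (Q : probability Om R).
Local Notation X := (@circle_retract R).

(** Both sides of the conclusion are linear in g and continuous under bounded
    limits, so the equality propagates from the monomials to the class baire.
    The weights F1 and F2 are what turns this into a statement on conditional
    expectations. *)
Theorem circle_uniqueness (T Y : Om -> R[i]) (F1 F2 : Om -> R) :
  measurable_fun setT T -> measurable_fun setT Y ->
  (forall w, modulus (T w) = 1) -> (forall w, modulus (Y w) = 1) ->
  bmeas F1 -> bmeas F2 ->
  (forall c k, mean Q (fun w => F1 w * Re (c * T w ^+ k)) =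
    mean Q (fun w => F2 w * Re (c * Y w ^+ k))) ->
  forall g, bmeas g -> mean Q (fun w => F1 w * g (T w)) = mean Q (fun w => F2 w * g (Y w)).
Proof.
move=> mT mY T1 Y1 bF1 bF2 mom g bg.
have TX w : X (T w) = T w by exact: circle_retract_id.
have YX w : X (Y w) = Y w by exact: circle_retract_id.
suff main h : baire h -> bmeas h /\
    mean Q (fun w => F1 w * h (T w)) = mean Q (fun w => F2 w * h (Y w)).
  have [_] := main _ (baire_bmeas bg).
  by under [X in mean _ X = _ -> _]eq_fun do rewrite TX;
    under [X in _ = mean _ X -> _]eq_fun do rewrite YX.
elim=> [c k|{}h h' _ [bh Eh] _ [bh' Eh']|u {}h M bu IH uM uh].
- split.
    split; last first.
      exists (modulus c) => z; apply: (le_trans (Re_le_modulus _)).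
      by rewrite modulusM modulusX modulus_circle_retract expr1n mulr1.
    under eq_fun do rewrite Re_mul.
    by have [h1 h2] := measurable_complex_pow k (@measurable_circle_retract R); apply: measurable_funB; apply: measurable_funM.
  under [X in mean _ X = _]eq_fun do rewrite TX.
  by under [X in _ = mean _ X]eq_fun do rewrite YX.
- have bhT := bmeas_comp mT bh; have bhT' := bmeas_comp mT bh'.
  have bhY := bmeas_comp mY bh; have bhY' := bmeas_comp mY bh'.
  split; first exact: bmeasD.
  under [X in mean _ X = _]eq_fun do rewrite mulrDr.
  under [X in _ = mean _ X]eq_fun do rewrite mulrDr.
  rewrite (meanD Q (bmeasM bF1 bhT) (bmeasM bF1 bhT')) Eh Eh'.
  by rewrite (meanD Q (bmeasM bF2 bhY) (bmeasM bF2 bhY')).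
- have bh : bmeas h.
    split; first by apply: (measurable_fun_cvg (h := u)) => [n|z _]; [case: (IH n) => -[]|exact: uh].
    by apply: baire_bounded; exact: baire_lim uM uh.
  split => //.
  have [M1 hM1] := bF1.2; have [M2 hM2] := bF2.2.
  have c1 : mean Q (fun w => F1 w * u n (T w)) @[n --> \oo] --> mean Q (fun w => F1 w * h (T w)).
    apply: (mean_cvg (M := M1 * M)).
    + by move=> n; apply: bmeasM => //; apply: bmeas_comp => //; case: (IH n).
    + by apply: bmeasM => //; apply: bmeas_comp.
    + by move=> n w; rewrite normrM ler_pM.
    + by apply: aeW => w; apply: cvgMr; exact: uh.
  have c2 : mean Q (fun w => F2 w * u n (Y w)) @[n --> \oo] --> mean Q (fun w => F2 w * h (Y w)).
    apply: (mean_cvg (M := M2 * M)).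
    + by move=> n; apply: bmeasM => //; apply: bmeas_comp => //; case: (IH n).
    + by apply: bmeasM => //; apply: bmeas_comp.
    + by move=> n w; rewrite normrM ler_pM.
    + by apply: aeW => w; apply: cvgMr; exact: uh.
  have e n : mean Q (fun w => F1 w * u n (T w)) = mean Q (fun w => F2 w * u n (Y w)).
    by case: (IH n).
  apply: (cvg_unique _ c1); first exact: Rhausdorff.
  by rewrite /=; under eq_fun do rewrite e.
Qed.

End circle_uniqueness.

(** * The mean value property on the punctured disc *)

Section circle_sections.
Variable R : realType.
Local Notation P := (circle_measure R).
Local Notation X := (@circle_retract R).
Implicit Types (h : R[i] -> R[i]) (z v c : R[i]) (r e : R).

Lemma continuous_Re : continuous (fun z : R[i] => Re z).
Proof.
have -> : (fun z : R[i] => Re z) = fun z => Re (1 * z) by apply/funext => z; rewrite mul1r.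
exact: continuous_Re_scale.
Qed.

(** Holomorphic on the punctured disc; the bounds on circles make the means of h
    over them meaningful. *)
Definition tame h := (forall z, 0 < modulus z < 1 -> cdiff h z) /\
  (forall r, 0 < r < 1 -> exists M : R, forall z, modulus z = r -> modulus (h z) <= M).

Lemma tame_scale v h : tame h -> tame (fun z => v * h z).
Proof.
move=> [dh bh]; split=> [z hz|r hr].
  by apply: cdiffM; [exact: cdiff_cst|exact: dh].
have [M hM] := bh r hr; exists (modulus v * M) => z hz.
by rewrite modulusM ler_wpM2l ?modulus_ge0// hM.
Qed.

Lemma modulus_section r z : 0 < r -> modulus (r%:C * X z) = r.
Proof.
by move=> r0; rewrite modulusM modulusC gtr0_norm// modulus_circle_retract mulr1.
Qed.

Lemma open_punctured_disc : open [set z : R[i] | 0 < modulus z < 1].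
Proof.
have cm : continuous (@modulus R).
  move=> z; apply/(cvgrPdist_lt (FF := nbhs_filter z)) => e e0.
  have hz : \forall x \near z, modulus (z - x) < e.
    by apply: (iffLR (complex_cvgP (F := nbhs z) id z)) => //; exact: cvg_id.
  near=> w; have h : modulus (z - w) < e by near: w.
  apply: le_lt_trans h; rewrite ler_norml; apply/andP; split.
    rewrite lerNl opprB lerBlDr modulus_distC.
    by apply: le_trans (modulusD _ _); rewrite subrK.
  by rewrite lerBlDr; apply: le_trans (modulusD _ _); rewrite subrK.
have -> : [set z : R[i] | 0 < modulus z < 1] = (@modulus R) @^-1` `]0, 1[%classic.
  by apply/seteqP; split => z /=; rewrite in_itv.
by apply: open_comp => [z _|]; [exact: cm|exact: interval_open].
Unshelve. all: by end_near. Qed.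

Lemma measurable_section r : measurable_fun setT (fun z => r%:C * X z).
Proof.
have mX := @measurable_circle_retract R.
apply: measurable_complex_fun.
  under eq_fun do rewrite Re_scale.
  by apply: measurable_funM => //; apply: measurableT_comp mX; exact: measurable_Re.
under eq_fun do rewrite Im_mul /= mul0r addr0.
by apply: measurable_funM => //; apply: measurableT_comp mX; exact: measurable_Im.
Qed.

Lemma bmeas_section h r : tame h -> 0 < r < 1 ->
  bmeas (fun z => Re (h (r%:C * X z))).
Proof.
move=> [dh bh] /andP[r0 r1]; split; last first.
  have [M hM] := bh r ltac:(by rewrite r0).
  exists M => z; apply: (le_trans (Re_le_modulus _)); apply: hM.
  exact: modulus_section.
pose D : set R[i] := [set z | 0 < modulus z < 1].
have oD : open D by exact: open_punctured_disc.
have mD : measurable D by exact: sub_gen_smallest.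
have cD : {in D, continuous (fun z => Re (h z))}.
  move=> z /set_mem hz; have := cdiff_continuous (dh z hz) => ch.
  apply: (@continuous_comp _ _ _ h (fun w : R[i] => Re w)) => //.
  exact: continuous_Re.
apply: (@measurable_comp _ _ _ _ _ _ D (fun z => Re (h z)) setT (fun z => r%:C * X z)) => //.
- by move=> _ [z _ <-]; rewrite /D /= modulus_section// r0.
- apply: (@measurability _ _ _ _ _ _ (@RGenOpens.G R)); first exact: RGenOpens.measurableE.
  move=> _ [_ [x [y ->]] <-]; apply: sub_gen_smallest.
  by apply: (iffLR (continuous_inP _ oD)) => //; exact: interval_open.
- exact: measurable_section.
Qed.

Lemma continuous_section h r t : tame h -> 0 < r < 1 ->
  {for t, continuous (fun t => Re (h (r%:C * X (circle_param t))))}.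
Proof.
move=> [dh bh] /andP[r0 r1].
have XC t' : X (circle_param t') = circle_param t'.
  by apply: circle_retract_id; exact: modulus_circle_param.
have -> : (fun t => Re (h (r%:C * X (circle_param t)))) =
    fun t => Re (h (r%:C * circle_param t)) by apply/funext => t'; rewrite XC.
apply: (@continuous_comp _ _ _ (fun t => r%:C * circle_param t) (fun w : R[i] => Re (h w))).
  by apply: cvgMr; exact: continuous_circle_param.
apply: (@continuous_comp _ _ _ h (fun w : R[i] => Re w)).
  apply: cdiff_continuous; apply: dh.
  by rewrite modulusM modulusC gtr0_norm// modulus_circle_param mulr1 r0.
exact: continuous_Re.
Qed.

Lemma mean_section_avg h r : tame h -> 0 < r < 1 ->
  mean P (fun z => Re (h (r%:C * X z))) = circle_avg h r.
Proof.
move=> th hr; rewrite mean_circle; last 2 first.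
- exact: bmeas_section.
- by move=> t; exact: continuous_section.
rewrite /circle_avg; congr rint; apply/funext => t.
by rewrite circle_retract_id//; exact: modulus_circle_param.
Qed.

Lemma mean_section_const h r r' : tame h -> 0 < r -> r <= r' -> r' < 1 ->
  mean P (fun z => Re (h (r%:C * X z))) = mean P (fun z => Re (h (r'%:C * X z))).
Proof.
move=> th r0 rr r1; rewrite !mean_section_avg//; last 2 first.
- by rewrite (lt_le_trans r0 rr).
- by rewrite r0 (le_lt_trans rr).
by case: th => dh _; exact: circle_avg_const.
Qed.

(** Convergence as z tends to 0 through nonzero values: the functions considered
    may be undefined at 0, as z^(-1) f(z) is. *)
Definition lim0 h c := forall e, 0 < e -> exists2 del : R, 0 < del &
  forall z, 0 < modulus z < del -> modulus (h z - c) <= e.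

(** The mean over the circle of radius r is that over an arbitrarily small
    circle, where h is close to its limit. *)
Lemma mean_section h c r : tame h -> lim0 h c -> 0 < r < 1 ->
  mean P (fun z => Re (h (r%:C * X z))) = Re c.
Proof.
move=> th lh /andP[r0 r1].
have key e : 0 < e -> `|mean P (fun z => Re (h (r%:C * X z))) - Re c| <= e.
  move=> e0; have [del del0 hd] := lh e e0.
  pose r' := Num.min r (del / 2).
  have r'0 : 0 < r' by rewrite lt_min r0 divr_gt0.
  have r'r : r' <= r by rewrite ge_min lexx.
  have r'd : r' < del.
    by apply: (@le_lt_trans _ _ (del / 2)); [rewrite ge_min lexx orbT|rewrite gtr_pMr// invf_lt1// ltr1n].
  rewrite -(mean_section_const th r'0 r'r r1).
  have bs : bmeas (fun z => Re (h (r'%:C * X z))).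
    by apply: bmeas_section => //; rewrite r'0 (le_lt_trans r'r).
  have bc := bmeas_cst (complex_complex__canonical__measurable_structure_Measurable R).
  have hz z : `|Re (h (r'%:C * X z)) - Re c| <= e.
    rewrite -Re_sub; apply: (le_trans (Re_le_modulus _)); apply: hd.
    by rewrite modulus_section// r'0.
  rewrite ler_norml; apply/andP; split.
    rewrite lerBrDr -(mean_cst P (- e + Re c)); apply: le_mean => // z.
    by have := hz z; rewrite ler_norml lerBrDr => /andP[].
  rewrite lerBlDr -(mean_cst P (e + Re c)); apply: le_mean => // z.
  by have := hz z; rewrite ler_norml lerBlDr => /andP[].
apply/eqP; rewrite -subr_eq0 -normr_le0; apply/ler_addgt0Pl => e e0.
by rewrite addr0; exact: key.
Qed.

Lemma lim0M h g c d : lim0 h c -> lim0 g d -> lim0 (fun z => h z * g z) (c * d).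
Proof.
move=> hh hg e e0.
pose m := modulus c + modulus d + 1.
have m0 : 0 < m by rewrite ltr_wpDl// addr_ge0// modulus_ge0.
pose e1 := Num.min 1 (e / m).
have e10 : 0 < e1 by rewrite lt_min ltr01 divr_gt0.
have [d1 d10 h1] := hh e1 e10; have [d2 d20 h2] := hg e1 e10.
exists (Num.min d1 d2); first by rewrite lt_min d10.
move=> z /andP[z0]; rewrite lt_min => /andP[z1 z2].
have {}h1 := h1 z ltac:(by rewrite z0); have {}h2 := h2 z ltac:(by rewrite z0).
have -> : h z * g z - c * d = (h z - c) * (g z - d) + ((h z - c) * d + c * (g z - d)) by ring.
have c0 := modulus_ge0 c; have d0 := modulus_ge0 d.
apply: (@le_trans _ _ (e1 * m)).
  apply: (le_trans (modulusD _ _)); have -> : e1 * m = e1 * 1 + (e1 * modulus c + e1 * modulus d) by rewrite /m; ring.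
  apply: lerD.
    rewrite modulusM; apply: ler_pM; rewrite ?modulus_ge0//.
    by apply: (le_trans h2); rewrite ge_min lexx.
  apply: (le_trans (modulusD _ _)); rewrite modulusM (modulusM c) addrC; apply: lerD.
    by rewrite mulrC ler_wpM2r.
  by rewrite ler_wpM2r.
by rewrite -ler_pdivlMr// ge_min lexx orbT.
Qed.

Lemma lim0_cst c : lim0 (fun=> c) c.
Proof.
by move=> e e0; exists 1 => // z _; rewrite subrr modulus0 ltW.
Qed.

Lemma lim0X h c k : lim0 h c -> lim0 (fun z => h z ^+ k) (c ^+ k).
Proof.
move=> hh; elim: k => [|k IH]; first exact: lim0_cst.
by under eq_fun do rewrite exprS; rewrite exprS; exact: lim0M.
Qed.

Lemma lim0_cdiff h : cdiff h 0 -> lim0 h (h 0).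
Proof.
move=> /cdiff_lip[K K0 [del del0 hd]] e e0.
exists (Num.min del (e / K)); first by rewrite lt_min del0 divr_gt0.
move=> z /andP[_]; rewrite lt_min => /andP[z1 z2].
have := hd z; rewrite subr0 => /(_ (ltW z1)) h1; apply: (le_trans h1).
by rewrite -ler_pdivlMl// mulrC ltW.
Qed.

Lemma lim0_eq h g c : (forall z, z != 0 -> h z = g z) -> lim0 h c -> lim0 g c.
Proof.
move=> hg hh e e0; have [del del0 hd] := hh e e0; exists del => // z hz.
rewrite -hg; first exact: hd.
by apply/eqP => z0; move: hz; rewrite z0 modulus0 ltxx.
Qed.

End circle_sections.

(** * Moments of the boundary map *)

Section powers.
Variable R : realType.
Implicit Types (z v : R[i]) (r : R).

(** z^i or z^(-i). One family of powers with a sign covers the positive and the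
    negative Fourier modes. *)
Definition spow {F : fieldType} (inv : bool) (i : nat) (z : F) : F :=
  if inv then z^-1 ^+ i else z ^+ i.

Lemma spowM {F : fieldType} inv i (z w : F) : spow inv i (z * w) = spow inv i z * spow inv i w.
Proof. by rewrite /spow; case: inv; rewrite ?invfM exprMn. Qed.

Lemma spowC inv i r : spow inv i (r%:C) = (spow inv i r)%:C.
Proof. by rewrite /spow; case: inv; rewrite ?rmorphXn ?fmorphV. Qed.

Lemma spow_gt0 inv i r : 0 < r -> 0 < spow inv i r.
Proof. by move=> r0; rewrite /spow; case: inv; rewrite exprn_gt0// invr_gt0. Qed.

Lemma modulus_spow inv i z : modulus (spow inv i z) = spow inv i (modulus z).
Proof. by rewrite /spow; case: inv; rewrite modulusX ?modulusV. Qed.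

(** On the circle of radius r the factor z^(+-i) is X^(+-i) up to the power of
    r, which the opposite power cancels. *)
Lemma spow_section inv i r v z w : 0 < r -> Re (v * (spow inv i z * w)) =
  spow (~~ inv) i r * Re (v * (spow inv i (r%:C * z) * w)).
Proof.
move=> r0.
have -> : v * (spow inv i (r%:C * z) * w) = (spow inv i r)%:C * (v * (spow inv i z * w)).
  by rewrite spowM spowC; ring.
rewrite Re_scale [RHS]mulrA.
have -> : spow (~~ inv) i r * spow inv i r = 1.
  by rewrite /spow; case: inv => /=; rewrite -exprMn ?mulfV ?mulVf ?gt_eqF// expr1n.
by rewrite mul1r.
Qed.

Lemma cdiff_spow inv i z : z != 0 -> cdiff (spow inv i) z.
Proof.
move=> z0; rewrite /spow; case: inv.
  by apply: (@cdiffX R (fun w => w^-1)); exact: cdiffV.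
by apply: (@cdiffX R id); exact: cdiff_id.
Qed.

Lemma spow_cvg1 inv i (u : nat -> R) : u n @[n --> \oo] --> (1 : R) ->
  spow inv i (u n) @[n --> \oo] --> (1 : R).
Proof.
move=> u1; rewrite /spow; case: inv; rewrite -(expr1n _ i).
  have := @continuous_cvg _ _ _ _ _ _ (fun x : R => x ^+ i) 1 (@exprn_continuous R i 1) .
  by apply; rewrite -[X in _ --> X]invr1; apply: cvgV => //; exact: oner_neq0.
by have := @continuous_cvg _ _ _ _ _ _ (fun x : R => x ^+ i) 1 (@exprn_continuous R i 1); apply.
Qed.

Definition radii (n : nat) : R := 1 - n.+2%:R^-1.

Lemma radii01 n : 0 < radii n < 1.
Proof.
rewrite /radii subr_gt0 invf_lt1// ltr1n /= ltrBlDr ltrDl invr_gt0.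
by [].
Qed.

Lemma radii_cvg : radii n @[n --> \oo] --> (1 : R).
Proof.
rewrite -[X in _ --> X]subr0; apply: cvgB; first exact: cvg_cst.
by have := @inv_nat_cvg R; rewrite -(cvg_shiftS) -cvg_shiftS.
Qed.

End powers.

Section moments.
Variable R : realType.
Local Notation P := (circle_measure R).
Local Notation X := (@circle_retract R).
Variables (f : R[i] -> R[i]).
Hypothesis df : forall z, modulus z < 1 -> cdiff f z.
Hypothesis f1 : forall z, modulus z < 1 -> modulus (f z) < 1.

Lemma tame_spow inv i k : tame (fun z => spow inv i z * f z ^+ k).
Proof.
split=> [z /andP[z0 z1]|r /andP[r0 r1]].
  by apply: cdiffM; [apply/cdiff_spow/modulus_gt0_neq0|apply: cdiffX; exact: df].
exists (spow inv i r) => z zr; rewrite modulusM modulus_spow zr modulusX.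
apply: ler_piMr; first exact/ltW/spow_gt0.
by apply: exprn_ile1; rewrite ?modulus_ge0//; apply/ltW/f1; rewrite zr.
Qed.

Hypothesis f0 : f 0 = 0.

Lemma lim0_quotient : exists lam, lim0 (fun z => z^-1 * f z) lam.
Proof.
have [c hc] := df (z := 0) ltac:(by rewrite modulus0).
exists c => e e0; have [del del0 hd] := hc e e0; exists del => // z /andP[z0 z1].
have zn0 := modulus_gt0_neq0 z0.
have := hd z; rewrite !subr0 f0 subr0 => /(_ (ltW z1)) h.
have -> : z^-1 * f z - c = z^-1 * (f z - c * z).
  by rewrite mulrBr mulrCA mulVf// mulr1.
by rewrite modulusM modulusV ler_pdivrMl// [leRHS]mulrC.
Qed.

Variable T : R[i] -> R[i].
Hypothesis mT : measurable_fun setT T.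
Hypothesis T1 : forall z, modulus (T z) = 1.
Hypothesis fT : {ae P, forall z, f ((radii R n)%:C * X z) @[n --> \oo] --> T z}.

Lemma bmeas_Re_spow (Y Z : R[i] -> R[i]) v inv i k : measurable_fun setT Y ->
  measurable_fun setT Z -> (forall z, modulus (Y z) = 1) -> (forall z, modulus (Z z) = 1) ->
  bmeas (fun z => Re (v * (spow inv i (Y z) * Z z ^+ k))).
Proof.
move=> mY mZ Y1 Z1.
split; last first.
  exists (modulus v) => z; apply: (le_trans (Re_le_modulus _)).
  by rewrite modulusM modulusM modulus_spow modulusX Y1 Z1 /spow; case: inv; rewrite ?invr1 !expr1n !mulr1.
have mYc : measurable_fun setT (fun z => (Y z)^-1).
  have e z : (Y z)^-1 = (Y z)^* by rewrite conj_unimodular.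
  apply: measurable_complex_fun.
    under eq_fun do rewrite e Re_conjc.
    by apply: measurableT_comp mY; exact: measurable_Re.
  under eq_fun do rewrite e Im_conjc.
  by apply: measurableT_comp => //; apply: measurableT_comp mY; exact: measurable_Im.
have [m1 m2] : measurable_fun setT (fun z => Re (spow inv i (Y z))) /\
    measurable_fun setT (fun z => Im (spow inv i (Y z))).
  by rewrite /spow; case: inv; apply: measurable_complex_pow.
have [m3 m4] := measurable_complex_pow k mZ.
under eq_fun do rewrite Re_mul Re_mul Im_mul.
apply: measurable_funB; apply: measurable_funM => //.
  by apply: measurable_funB; exact: measurable_funM.
by apply: measurable_funD; exact: measurable_funM.
Qed.

(** The mean over the circle of radius r is the value at 0 by mean_section; as r
    tends to 1 along the radii, f tends to its boundary value almost everywhere,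
    and dominated convergence applies. *)
Lemma moment inv i k c v : lim0 (fun z => spow inv i z * f z ^+ k) c ->
  mean P (fun z => Re (v * (spow inv i (X z) * T z ^+ k))) = Re (v * c).
Proof.
move=> hc.
have mX := @measurable_circle_retract R.
have X1 := @modulus_circle_retract R.
have hvc : lim0 (fun z => v * (spow inv i z * f z ^+ k)) (v * c) by exact/lim0M/hc/lim0_cst.
have th := tame_scale v (tame_spow inv i k).
have e n : mean P (fun z => Re (v * (spow inv i (X z) * f ((radii R n)%:C * X z) ^+ k))) =
    spow (~~ inv) i (radii R n) * Re (v * c).
  have r01 := radii01 R n; have /andP[r0 r1] := r01.
  rewrite -(mean_section th hvc r01) -(meanZ P _ (bmeas_section th r01)).
  by congr (mean P _); apply/funext => z; exact: spow_section.
have c1 : mean P (fun z => Re (v * (spow inv i (X z) * f ((radii R n)%:C * X z) ^+ k)))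
    @[n --> \oo] --> mean P (fun z => Re (v * (spow inv i (X z) * T z ^+ k))).
  apply: (mean_cvg (M := modulus v)).
  - move=> n.
    have e' : (fun z => Re (v * (spow inv i (X z) * f ((radii R n)%:C * X z) ^+ k))) =
      fun z => spow (~~ inv) i (radii R n) *
        Re ((fun z => v * (spow inv i z * f z ^+ k)) ((radii R n)%:C * X z)).
      have /andP[r0 r1] := radii01 R n.
      by apply/funext => z; exact: spow_section.
    by rewrite e'; apply: bmeasZ; exact: (bmeas_section th (radii01 R n)).
  - exact: bmeas_Re_spow.
  - move=> n z; apply: (le_trans (Re_le_modulus _)).
    rewrite modulusM modulusM modulus_spow X1 modulusX.
    have /andP[r0 r1] := radii01 R n.
    have h : modulus (f ((radii R n)%:C * X z)) ^+ k <= 1.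
      by rewrite exprn_ile1// ?modulus_ge0// ltW// f1// modulus_section.
    have -> : spow inv i (1 : R) = 1 by rewrite /spow invr1 expr1n if_same.
    by rewrite mul1r ler_piMr ?modulus_ge0.
  - apply: filterS fT => z hz.
    have -> : (fun n => Re (v * (spow inv i (X z) * f ((radii R n)%:C * X z) ^+ k))) =
      (fun w => Re (v * spow inv i (X z) * w ^+ k)) \o (fun n => f ((radii R n)%:C * X z)).
      by apply/funext => n /=; rewrite mulrA.
    rewrite mulrA; apply: (cvg_comp _ _ hz).
    have ck : cdiff (fun w => v * spow inv i (X z) * w ^+ k) (T z).
      by apply: cdiffM; [exact: cdiff_cst|apply: (@cdiffX R id); exact: cdiff_id].
    exact: (cvg_comp _ _ (cdiff_continuous ck) (@continuous_Re R _)).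
have c2 : spow (~~ inv) i (radii R n) * Re (v * c) @[n --> \oo] --> Re (v * c).
  rewrite -[X in _ --> X]mul1r; apply: cvgMl; apply: spow_cvg1.
  exact: radii_cvg.
apply: (cvg_unique _ c1); first exact: Rhausdorff.
by rewrite /=; under eq_fun do rewrite e.
Qed.

(** The holomorphic function z^i f(z)^k vanishes at 0. *)
Lemma moment_pos i k v : (0 < i + k)%N ->
  mean P (fun z => Re (v * (X z ^+ i * T z ^+ k))) = 0.
Proof.
move=> ik; rewrite (moment (inv := false) (c := 0)) ?mulr0//.
have := @lim0_cdiff R (fun z => z ^+ i * f z ^+ k).
rewrite f0 -exprD expr0n gtn_eqF//; apply; apply: cdiffM.
  by apply: (@cdiffX R id); exact: cdiff_id.
by apply: cdiffX; apply: df; rewrite modulus0.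
Qed.

(** z^(-i) f(z)^(i+j) is (f(z)/z)^i f(z)^j, with limit lam^i if j = 0, and 0
    otherwise. *)
Lemma moment_neg lam i j v : lim0 (fun z => z^-1 * f z) lam ->
  mean P (fun z => Re (v * ((X z)^-1 ^+ i * T z ^+ (i + j)))) = Re (v * (lam ^+ i * (j == 0)%N%:R)).
Proof.
move=> hl; rewrite (moment (inv := true) (c := lam ^+ i * (j == 0)%N%:R))//.
have h1 := lim0X i hl.
have h2 : lim0 (fun z => f z ^+ j) ((j == 0)%N%:R).
  have := @lim0_cdiff R (fun z => f z ^+ j); rewrite f0 expr0n; apply.
  by apply: cdiffX; apply: df; rewrite modulus0.
apply: lim0_eq (lim0M h1 h2) => z z0.
by rewrite /spow exprMn exprD mulrA.
Qed.

End moments.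

(** * The multiplier at the fixed point *)

Section zero_on_circle.
Variable R : realType.
Local Notation P := (circle_measure R).
Local Notation X := (@circle_retract R).
Implicit Types (h : R[i] -> R[i]) (z v c : R[i]) (r e : R).

Lemma circle_param_surj z : modulus z = 1 ->
  exists2 t : R, 0 <= t <= 1 & circle_param t = z.
Proof.
case: z => x y /(congr1 (fun t => t ^+ 2)); rewrite modulus_sqr expr1n /= => xy1.
have tp : 0 < 2 * pi :> R by rewrite mulr_gt0// pi_gt0.
have x1 : -1 <= x <= 1.
  by rewrite -ler_norml -ler_sqr ?nnegrE// expr1n real_normK ?num_real//; have := sqr_ge0 y; lra.
have ca : cos (acos x) = x by apply: acosK; rewrite in_itv.
have a0 := acos_ge0 x1; have api := acos_lepi x1.
have sa0 : 0 <= sin (acos x) by apply: sin_ge0_pi; rewrite a0.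
have sa : sin (acos x) ^+ 2 = y ^+ 2.
  by have := cos2Dsin2 (acos x); rewrite ca; lra.
pose t := acos x / (2 * pi).
have tE : 2 * pi * t = acos x by rewrite /t mulrCA divff ?gt_eqF// mulr1.
have t0 : 0 <= t by rewrite /t divr_ge0// ltW.
have t1 : t <= 1 by rewrite /t ler_pdivrMr// mul1r; have := @pi_gt0 R; lra.
have [y0|y0] := lerP 0 y.
  exists t; first by rewrite t0.
  rewrite /circle_param tE ca; congr (_ +i* _).
  by apply/eqP; rewrite -(eqrXn2 (n := 2)) // sa.
exists (1 - t); first by rewrite subr_ge0 t1 gerBl.
have -> : circle_param (1 - t) = circle_param (- t) :> R[i].
  rewrite circle_paramD circle_param1 {1}/circle_param mulr0 cos0 sin0.
  by rewrite -[RHS]mul1r; congr (_ * _).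
rewrite /circle_param mulrN tE cosN sinN ca; congr (_ +i* _).
have yn : 0 <= - y by lra.
by apply/eqP; rewrite eqr_oppLR -(eqrXn2 (n := 2)) // sa sqrrN.
Qed.

Lemma rint_eq0 (g : R -> R) : (forall t, {for t, continuous g}) -> (forall t, 0 <= g t) ->
  rint g 0 1 = 0 -> forall t, 0 <= t <= 1 -> g t = 0.
Proof.
move=> cg g0 Ig t /andP[t0 t1]; apply/eqP; apply/negP => /negP gt0.
have gp : 0 < g t by rewrite lt_def gt0 g0.
have cgb a b : continuous_btw g a b by move=> x _; exact: cg.
have Ige a b : 0 <= rint g a b by apply: Rintegral_ge0 => x _; exact: g0.
have e0 : 0 < g t / 2 by rewrite divr_gt0.
have [del /= del0 hd] : \forall x \near t, `|g t - g x| < g t / 2.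
  by have /cvgrPdist_lt := cg t; apply.
pose d := Num.min (del / 2) (1 / 2).
have d0 : 0 < d by rewrite lt_min !divr_gt0.
have dd : d < del by apply: (@le_lt_trans _ _ (del / 2)); [rewrite ge_min lexx|lra].
have d1 : d <= 1 / 2 by rewrite ge_min lexx orbT.
have near x : `|x - t| <= d -> g t / 2 <= g x.
  move=> hx; have := hd x; rewrite /ball_ /= distrC => /(_ (le_lt_trans hx dd)).
  by rewrite ltr_norml => /andP[h1 h2]; lra.
have pos a b : 0 <= a -> a < b -> b <= 1 -> t - d <= a -> b <= t + d -> False.
  move=> a0 ab b1 ta tb.
  have h1 : rint g 0 1 = rint g 0 a + (rint g a b + rint g b 1).
    rewrite (rint_cat a0 (le_trans (ltW ab) b1) (cgb _ _)).
    by rewrite (rint_cat (ltW ab) b1 (cgb _ _)).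
  have h2 : g t / 2 * (b - a) <= rint g a b.
    rewrite -(rint_cst _ (ltW ab)) /rint; apply: le_Rintegral => //.
    - by apply: continuous_btw_integrable => x _; exact: cvg_cst.
    - exact: continuous_btw_integrable.
    - move=> x /=; rewrite in_itv /= => /andP[ax xb]; apply: near.
      by move: ax xb ta tb; rewrite ler_norml; clear; move=> ax xb ta tb; apply/andP; split; lra.
  have h3 : 0 < g t / 2 * (b - a) by rewrite mulr_gt0// subr_gt0.
  by have := Ige 0 a; have := Ige b 1; move: h1 h2 h3 Ig; clear; lra.
have [th|th] := lerP t (1 / 2).
  by apply: (pos t (t + d)); move: t0 t1 th d0 d1; clear; lra.
by apply: (pos (t - d) t); move: t0 t1 th d0 d1; clear; lra.
Qed.

Lemma section_eq0 h r : tame h -> 0 < r < 1 ->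
  mean P (fun z => Re (h (r%:C * X z)) * Re (h (r%:C * X z))) = 0 ->
  forall z, modulus z = r -> Re (h z) = 0.
Proof.
move=> th hr h0 z zr; have bh := bmeas_section th hr; have /andP[r0 r1] := hr.
have ch (t : R) : {for t, continuous (fun t => Re (h (r%:C * X (circle_param t))))}.
  exact: continuous_section.
rewrite mean_circle in h0; last 2 first.
- exact: bmeasM.
- by move=> t; apply: cvgM; exact: ch.
have r0' : r%:C != 0 :> R[i] by rewrite eq_complex /= gt_eqF.
have zu : modulus (z / r%:C) = 1.
  by rewrite modulusM modulusV modulusC gtr0_norm// zr mulfV// gt_eqF.
have [t t01 tE] := circle_param_surj zu.
have : Re (h (r%:C * X (circle_param t))) * Re (h (r%:C * X (circle_param t))) = 0.
  apply: (rint_eq0 _ _ h0 t01) => t'; last by rewrite -expr2 sqr_ge0.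
  by apply: cvgM; exact: ch.
rewrite tE circle_retract_id// mulrCA mulfV// mulr1 => /eqP.
by rewrite mulf_eq0 orbb => /eqP.
Qed.

End zero_on_circle.

Section contraction.
Variable R : realType.
Local Notation P := (circle_measure R).
Local Notation X := (@circle_retract R).
Implicit Types (h g : R[i] -> R[i]) (z v c : R[i]) (r e : R).

Lemma tameM h g : tame h -> tame g -> tame (fun z => h z * g z).
Proof.
move=> [dh bh] [dg bg]; split=> [z hz|r hr]; first by apply: cdiffM; [exact: dh|exact: dg].
have [M hM] := bh r hr; have [N hN] := bg r hr; exists (M * N) => z zr.
by rewrite modulusM ler_pM ?modulus_ge0 ?hM ?hN.
Qed.

Lemma tameDc h c : tame h -> tame (fun z => h z + c).
Proof.
move=> [dh bh]; split=> [z hz|r hr].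
  by apply: cdiffD; [exact: dh|exact: cdiff_cst].
have [M hM] := bh r hr; exists (M + modulus c) => z zr.
by apply: (le_trans (modulusD _ _)); rewrite lerD2r hM.
Qed.

Lemma tame_spow1 inv i : tame (@spow R[i] inv i).
Proof.
split=> [z /andP[z0 _]|r hr]; first exact/cdiff_spow/modulus_gt0_neq0.
by exists (spow inv i r) => z zr; rewrite modulus_spow zr.
Qed.

(** By circle_uniqueness, vanishing of all the Laurent coefficients on a circle
    makes the mean of h against every bounded Borel function vanish, in
    particular against its own real part. *)
Lemma laurent_eq0 h r : tame h -> 0 < r < 1 ->
  (forall inv i v, mean P (fun z => Re (v * (spow inv i (X z) * h (r%:C * X z)))) = 0) ->
  forall z, modulus z = r -> h z = 0.
Proof.
move=> th hr mom.
have mX := @measurable_circle_retract R.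
have X1 := @modulus_circle_retract R.
have bmom inv i v : bmeas (fun z => Re (v * (spow inv i (X z) * h (r%:C * X z)))).
  have t1 : tame (fun z => v * (spow inv i z * h z)).
    by apply/tame_scale/tameM => //; exact: tame_spow1.
  have := bmeasZ (spow (~~ inv) i r) (bmeas_section t1 hr).
  have /andP[r0 _] := hr.
  have -> // : (fun w => spow (~~ inv) i r * Re ((fun z => v * (spow inv i z * h z)) (r%:C * X w))) =
     fun z => Re (v * (spow inv i (X z) * h (r%:C * X z))).
  by apply/funext => w; rewrite [RHS](spow_section _ _ _ _ _ r0).
have key v z : modulus z = r -> Re (v * h z) = 0.
  have tv := tame_scale v th; have bv := bmeas_section tv hr.
  apply: (section_eq0 tv hr).
  have b0 := bmeas_cst (complex_complex__canonical__measurable_structure_Measurable R) (0 : R).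
  have := @circle_uniqueness R _ _ P X X (fun z => Re (v * h (r%:C * X z))) (fun=> 0) mX mX X1 X1 bv b0.
  have XX w : X (X w) = X w by apply: circle_retract_id.
  have mom' c k : mean P (fun w => Re (v * h (r%:C * X w)) * Re (c * X w ^+ k)) =
      mean P (fun w => 0 * Re (c * X w ^+ k)).
    have -> : (fun w => 0 * Re (c * X w ^+ k)) = fun=> 0 by apply/funext => w; rewrite mul0r.
    rewrite (mean_cst P 0).
    have -> : (fun w => Re (v * h (r%:C * X w)) * Re (c * X w ^+ k)) =
      fun w => 1 / 2 * (Re (v * c * (spow false k (X w) * h (r%:C * X w))) +
        Re (v * c^* * (spow true k (X w) * h (r%:C * X w)))).
      apply/funext => w; rewrite ReRe_mul /spow -(conj_unimodular (X1 w)).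
      congr (_ * (Re _ + Re _)); first by ring.
      rewrite rmorphM rmorphXn; ring.
    rewrite (meanZ P); last by apply: bmeasD; exact: bmom.
    by rewrite (meanD P) ?mom ?addr0 ?mulr0//; exact: bmom.
  move=> /(_ mom' _ bv) /=.
  have -> : (fun w => 0 * Re (v * h (r%:C * X (X w)))) = fun=> 0.
    by apply/funext => w; rewrite mul0r.
  rewrite (mean_cst P 0) => <-; congr (mean P _); apply/funext => w.
  by rewrite XX.
move=> z zr; have h1 := key 1 z zr; have h2 := key (- 'i) z zr.
rewrite mul1r in h1; rewrite Re_mul /= oppr0 mul0r sub0r mulN1r opprK in h2.
by apply/eqP; rewrite eq_complex h1 h2 eqxx.
Qed.

Variable f : R[i] -> R[i].
Hypothesis df : forall z, modulus z < 1 -> cdiff f z.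
Hypothesis f1 : forall z, modulus z < 1 -> modulus (f z) < 1.
Hypothesis f0 : f 0 = 0.
Variable lam : R[i].
Hypothesis hl : lim0 (fun z => z^-1 * f z) lam.

(* The quotient f(z) / z, written with spow in order to apply the results on
   moments. *)
Let phi z := spow true 1 z * f z ^+ 1.

Let tphi : tame phi. Proof. exact: (tame_spow df f1). Qed.

Let lphi : lim0 phi lam. Proof. exact: hl. Qed.

Let phi_le r z : 0 < r < 1 -> modulus (phi (r%:C * X z)) <= r^-1.
Proof.
move=> /andP[r0 r1]; rewrite modulusM modulus_spow modulus_section// /spow !expr1.
by rewrite ler_piMr// ?invr_ge0 1?ltW// f1// modulus_section.
Qed.

Let mean_phi v r : 0 < r < 1 -> mean P (fun z => Re (v * phi (r%:C * X z))) = Re (v * lam).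
Proof.
move=> hr; rewrite (mean_section (tame_scale v tphi) (c := v * lam) _ hr)//.
by apply: lim0M => //; exact: lim0_cst.
Qed.

(** The Schwarz lemma: the mean of f(z)/z over the circle of radius r is lam,
    while its modulus is at most 1 / r there. *)
Lemma multiplier_le1 : modulus lam <= 1.
Proof.
rewrite leNgt; apply/negP => l1; have l0 := lt_trans ltr01 l1.
pose r := (1 + (modulus lam)^-1) / 2.
have li : (modulus lam)^-1 < 1 by rewrite invf_lt1.
have li0 : 0 < (modulus lam)^-1 by rewrite invr_gt0.
have hr : 0 < r < 1 by rewrite /r; apply/andP; split; lra.
have : Re (lam^* * lam) <= modulus lam * r^-1.
  rewrite -(mean_phi _ hr) -(mean_cst P (modulus lam * r^-1)); apply: le_mean.
  - exact: (bmeas_section (tame_scale _ tphi) hr).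
  - exact: bmeas_cst.
  - move=> z; apply: (le_trans (ReleM _)); rewrite modulusM modulus_conj.
    by rewrite ler_wpM2l ?modulus_ge0// phi_le.
have -> : Re (lam^* * lam) = modulus lam ^+ 2.
  by rewrite Re_mul Re_conjc Im_conjc modulus_sqr; ring.
rewrite expr2 ler_pM2l//; have /andP[r0 r1] := hr.
move=> h; have := ler_wpM2r (ltW r0) h; rewrite mulVf ?gt_eqF//.
have -> : modulus lam * r = (modulus lam + 1) / 2 by rewrite /r; field; rewrite gt_eqF.
by lra.
Qed.

(** If |lam| = 1, the mean of |f(z)/z - lam|^2 over the circle of radius s is at
    most s^(-2) - 1, which tends to 0 as s tends to 1. The Laurent coefficients
    of f(z)/z - lam do not depend on s, up to powers of s, so they all vanish
    and f is a rotation. *)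
Lemma multiplier_lt1 : ~ (exists2 c, modulus c = 1 & forall z, modulus z < 1 -> f z = c * z) ->
  modulus lam < 1.
Proof.
move=> nrot; rewrite lt_neqAle multiplier_le1 andbT; apply/eqP => l1; apply: nrot.
exists lam => // z z1.
have [->|z0] := eqVneq z 0; first by rewrite f0 mulr0.
suff u0 : phi z + - lam = 0.
  move/eqP : u0; rewrite subr_eq0 => /eqP <-.
  by rewrite /phi /spow !expr1 mulrAC mulVf// mul1r.
pose u z := phi z + - lam; have tu : tame u by exact: tameDc.
pose r := modulus z; have hr : 0 < r < 1 by rewrite /r neq0_modulus_gt0.
apply: (@laurent_eq0 u r) => // inv i v.
pose h z := v * (spow inv i z * u z).
have th : tame h by apply/tame_scale/tameM => //; exact: tame_spow1.
(* The inequality m <= (e + m^2 / e) / 2 bounds the first moment by the second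
   without square roots. W is the expansion of |phi - lam|^2, with |phi|^2
   replaced by its upper bound. *)
have bnd s e : 0 < s < 1 -> 0 < e -> `|mean P (fun z => Re (h (s%:C * X z)))| <=
    spow inv i s * modulus v * ((e + (s^-1 ^+ 2 - 1) / e) / 2).
  move=> hs e0; have /andP[s0 s1] := hs.
  pose W z := s^-1 ^+ 2 + 1 + Re ((- 2)%:C * lam^* * phi (s%:C * X z)).
  have bW0 := bmeas_section (tame_scale ((- 2)%:C * lam^*) tphi) hs.
  have bW : bmeas W by apply: bmeasD => //; exact: bmeas_cst.
  have mW : mean P W = s^-1 ^+ 2 - 1.
    rewrite /W (meanD P (bmeas_cst _ (s^-1 ^+ 2 + 1)) bW0) mean_cst mean_phi//.
    have -> : Re ((- 2)%:C * lam^* * lam) = - 2.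
      have := modulus_sqr lam; rewrite l1 expr1n => h1.
      by rewrite -mulrA Re_scale Re_mul Re_conjc Im_conjc; lra.
    by rewrite -addrA; congr (_ + _); rewrite -natr1; ring.
  have uW z' : modulus (u (s%:C * X z')) ^+ 2 <= W z'.
    have := phi_le z' hs; rewrite -(ler_pXn2r (n := 2)) ?nnegrE ?modulus_ge0 ?invr_ge0 ?(ltW s0)//.
    rewrite /W /u; set p := phi _ => hp.
    have := modulus_sqr lam; rewrite l1 expr1n => h1.
    have -> : Re ((- 2)%:C * lam^* * p) = - 2 * (Re lam * Re p + Im lam * Im p).
      by rewrite -mulrA Re_scale Re_mul Re_conjc Im_conjc; ring.
    rewrite modulus_sqr in hp; rewrite modulus_sqr !Re_add !Im_add Re_opp Im_opp.
    have -> : (Re p - Re lam) ^+ 2 + (Im p - Im lam) ^+ 2 = (Re p ^+ 2 + Im p ^+ 2) +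
      (Re lam ^+ 2 + Im lam ^+ 2) - 2 * (Re lam * Re p + Im lam * Im p) by ring.
    by move: hp; rewrite -h1; lra.
  have pt z' : `|Re (h (s%:C * X z'))| <= spow inv i s * modulus v * ((e + W z' / e) / 2).
    apply: (le_trans (Re_le_modulus _)).
    rewrite modulusM modulusM modulus_spow modulus_section// mulrCA mulrA.
    apply: ler_wpM2l; first by rewrite mulr_ge0 ?modulus_ge0// ltW// spow_gt0.
    apply: (@le_trans _ _ ((e + modulus (u (s%:C * X z')) ^+ 2 / e) / 2)); last first.
      by rewrite ler_pM2r ?invr_gt0// lerD2l ler_pM2r ?invr_gt0.
    set m := modulus _.
    have -> : (e + m ^+ 2 / e) / 2 = m + (m - e) ^+ 2 / (2 * e) by field; rewrite gt_eqF.
    by rewrite lerDl divr_ge0 ?sqr_ge0// mulr_ge0// ltW.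
  have bE : bmeas (fun z' => spow inv i s * modulus v * ((e + W z' / e) / 2)).
    apply: bmeasZ; under eq_fun do rewrite mulrC.
    apply: bmeasZ; apply: bmeasD; first exact: bmeas_cst.
    by under eq_fun do rewrite mulrC; exact: bmeasZ.
  have mE : mean P (fun z' => spow inv i s * modulus v * ((e + W z' / e) / 2)) =
      spow inv i s * modulus v * ((e + (s^-1 ^+ 2 - 1) / e) / 2).
    pose K := spow inv i s * modulus v.
    have -> : (fun z' => spow inv i s * modulus v * ((e + W z' / e) / 2)) =
      fun z' => K * e / 2 + (K / e / 2) * W z'.
      by apply/funext => z'; rewrite /K; field; rewrite gt_eqF.
    rewrite (meanD P (bmeas_cst _ (K * e / 2)) (bmeasZ _ bW)) mean_cst (meanZ P _ bW) mW /K.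
    by field; rewrite (gt_eqF e0) (gt_eqF s0).
  rewrite -mE ler_norml; apply/andP; split.
    rewrite -(meanN P bE); apply: le_mean.
    - exact: bmeasN.
    - exact: (bmeas_section th hs).
    - by move=> z'; have := pt z'; rewrite ler_norml => /andP[].
  apply: le_mean => //; first exact: (bmeas_section th hs).
  by move=> z'; have := pt z'; rewrite ler_norml => /andP[].
have B0 : mean P (fun z => Re (h (r%:C * X z))) = 0.
  apply/eqP; rewrite -normr_le0; apply/ler_addgt0Pl => e e0; rewrite addr0.
  have v0 : 0 < modulus v + 1 by rewrite ltr_wpDl// modulus_ge0.
  pose e1 := e / (modulus v + 1); have e10 : 0 < e1 by rewrite divr_gt0.
  have c1 : spow inv i (radii R n) * modulus v * ((e1 + ((radii R n)^-1 ^+ 2 - 1) / e1) / 2)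
      @[n --> \oo] --> 1 * modulus v * ((e1 + (1 - 1) / e1) / 2).
    have rc := @radii_cvg R.
    apply: cvgM; first by apply: cvgMl; exact: spow_cvg1.
    apply: cvgMl; apply: cvgD; first exact: cvg_cst.
    apply: cvgMl; apply: cvgB; last exact: cvg_cst.
    by have := @spow_cvg1 R true 2 _ rc; rewrite /spow.
  apply: (@le_trans _ _ (1 * modulus v * ((e1 + (1 - 1) / e1) / 2))).
    apply: (cvgr_to_ge c1); near=> n.
    have rn : r <= radii R n.
      have /andP[_ r1] := hr; apply: ltW; near: n.
      exact: (cvgr_gt _ (@radii_cvg R)).
    have h01 := radii01 R n; have /andP[_ n1] := h01; have /andP[r0 _] := hr.
    by rewrite (mean_section_const th r0 rn n1) bnd.
  rewrite mul1r subrr mul0r addr0 mulrA ler_pdivrMr// /e1 mulrA ler_pdivrMr//.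
  have := modulus_ge0 v => m0; have := mulr_ge0 (ltW e0) m0; move: e0; nra.
have /andP[r0 _] := hr.
have bh := bmeas_section th hr.
have -> : (fun z => Re (v * (spow inv i (X z) * u (r%:C * X z)))) =
   fun z => spow (~~ inv) i r * Re (h (r%:C * X z)).
  by apply/funext => w; rewrite [LHS](spow_section _ _ _ _ _ r0).
by rewrite (meanZ P _ bh) B0 mulr0.
Unshelve. all: by end_near. Qed.

End contraction.

(** * Inner functions give circle systems *)

Section inner_circle_system.
Variable R : realType.
Local Notation P := (circle_measure R).
Local Notation X := (@circle_retract R).
Implicit Types (v c w : R[i]).

Lemma ae_circle : {ae P, forall z, modulus z = 1}.
Proof.
exists (~` [set z : R[i] | modulus z = 1]); split.
- by apply: measurableC; exact: measurable_circle.
- rewrite /circle_measure /= /pushforward /mrestr.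
  have -> : (@circle_param R) @^-1` (~` [set z : R[i] | modulus z = 1]) = set0.
    by apply/seteqP; split => // t /=; rewrite modulus_circle_param.
  by rewrite set0I measure0.
- by [].
Qed.

Variable f : R[i] -> R[i].
Hypothesis df : forall z, modulus z < 1 -> cdiff f z.
Hypothesis f1 : forall z, modulus z < 1 -> modulus (f z) < 1.
Hypothesis f0 : f 0 = 0.
Variable T : R[i] -> R[i].
Hypothesis mT : measurable_fun setT T.
Hypothesis T1 : forall z, modulus (T z) = 1.
Hypothesis fT : {ae P, forall z, f ((radii R n)%:C * X z) @[n --> \oo] --> T z}.
Variable lam : R[i].
Hypothesis hl : lim0 (fun z => z^-1 * f z) lam.

Let mX := @measurable_circle_retract R.
Let X1 := @modulus_circle_retract R.

Let X0 z : X z != 0. Proof. by apply: modulus_gt0_neq0; rewrite X1. Qed.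

Lemma fourier i k w : mean P (fun z => Re (w * ((X z)^-1 ^+ i * X z ^+ k))) =
  if i == k then Re w else 0.
Proof.
have pos j u : (0 < j)%N -> mean P (fun z => Re (u * X z ^+ j)) = 0.
  move=> j0; have := moment_pos df f1 f0 mT T1 fT (i := j) (k := 0) u.
  rewrite addn0 => /(_ j0) <-.
  by congr (mean P _); apply/funext => z; rewrite expr0 mulr1.
case: ltngtP => ik.
- have -> : (fun z => Re (w * ((X z)^-1 ^+ i * X z ^+ k))) = fun z => Re (w * X z ^+ (k - i)).
    apply/funext => z; congr (Re (w * _)).
    by rewrite -{1}(subnKC (ltnW ik)) exprD mulrA -exprMn mulVf// expr1n mul1r.
  by apply: pos; rewrite subn_gt0.
- have -> : (fun z => Re (w * ((X z)^-1 ^+ i * X z ^+ k))) = fun z => Re (w^* * X z ^+ (i - k)).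
    apply/funext => z; have -> : (X z)^-1 ^+ i * X z ^+ k = (X z)^-1 ^+ (i - k).
      by rewrite -{1}(subnK (ltnW ik)) exprD -mulrA -exprMn mulVf// expr1n mulr1.
    rewrite -[RHS]Re_conjc; congr Re.
    by rewrite rmorphM rmorphXn /= conjcK conj_unimodular.
  by apply: pos; rewrite subn_gt0.
- have -> : (fun z => Re (w * ((X z)^-1 ^+ i * X z ^+ k))) = fun=> Re w.
    by apply/funext => z; rewrite ik -exprMn mulVf// expr1n mulr1.
  by rewrite mean_cst.
Qed.

(** The coefficient of z^2 in f, in the form of the mean of X^(-2) T, which
    bounds it by 1 at once. *)
Definition second_moment : R[i] :=
  mean P (fun z => Re (1 * (spow true 2 (X z) * T z ^+ 1))) +i*
  mean P (fun z => Re (- 'i * (spow true 2 (X z) * T z ^+ 1))).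

Lemma second_momentE v :
  mean P (fun z => Re (v * (spow true 2 (X z) * T z ^+ 1))) = Re (v * second_moment).
Proof.
have b1 := bmeas_Re_spow 1 true 2 1 mX mT X1 T1.
have b2 := bmeas_Re_spow (- 'i) true 2 1 mX mT X1 T1.
rewrite Re_mul /second_moment /= -(meanZ P _ b1) -(meanZ P _ b2).
rewrite -(meanB P (bmeasZ _ b1) (bmeasZ _ b2)); congr (mean P _); apply/funext => z.
by rewrite Re_mul mul1r Re_mulNi.
Qed.

Lemma second_moment_le1 : modulus second_moment <= 1.
Proof.
set a := second_moment.
have b1 := bmeas_Re_spow a^* true 2 1 mX mT X1 T1.
have : Re (a^* * a) <= modulus a.
  rewrite -second_momentE -(mean_cst P (modulus a)); apply: le_mean => //.
    exact: bmeas_cst.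
  move=> z; apply: (le_trans (ReleM _)).
  by rewrite modulusM modulusM modulus_spow modulusX X1 T1 modulus_conj /spow invr1 !expr1n !mulr1.
have -> : Re (a^* * a) = modulus a * modulus a.
  by rewrite Re_mul Re_conjc Im_conjc -(expr2 (modulus a)) modulus_sqr; ring.
have := modulus_ge0 a; case: (ltP 0 (modulus a)) => [a0 _|a0 _ _]; last exact: le_trans ler01.
by rewrite ger_pMr.
Qed.

Let bXX v inv i k := bmeas_Re_spow v inv i k mX mX X1 X1.

Lemma mean_on_circle (F g : R[i] -> R) : bmeas F -> bmeas g ->
  mean P (fun z => F z * g (X z)) = mean P (fun z => F z * g z).
Proof.
move=> bF bg; apply: eq_mean_ae.
- by apply: bmeasM => //; exact: bmeas_comp.
- exact: bmeasM.
- by apply: filterS ae_circle => z z1; rewrite circle_retract_id.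
Qed.

(** A function F1 with the same moments against T as F2 against X has
    conditional expectation F2 o T given T. *)
Lemma moments_determine (F1 F2 : R[i] -> R) : bmeas F1 -> bmeas F2 ->
  (forall c k, mean P (fun z => F1 z * Re (c * T z ^+ k)) =
    mean P (fun z => F2 z * Re (c * X z ^+ k))) ->
  forall g, bmeas g -> mean P (fun z => F1 z * g (T z)) = mean P (fun z => F2 z * g z).
Proof.
move=> b1 b2 mom g bg.
by rewrite (circle_uniqueness mT mX T1 X1 b1 b2 mom bg) mean_on_circle.
Qed.

(** A product of two real parts splits into moments with a positive and with a
    negative power of X, which moment_pos and moment_neg evaluate. *)
Lemma mean_prod (Y : R[i] -> R[i]) v c i k : measurable_fun setT Y -> (forall z, modulus (Y z) = 1) ->
  mean P (fun z => Re (v * X z ^+ i) * Re (c * Y z ^+ k)) =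
  1 / 2 * (mean P (fun z => Re (c * v * (X z ^+ i * Y z ^+ k))) +
    mean P (fun z => Re (c * v^* * ((X z)^-1 ^+ i * Y z ^+ k)))).
Proof.
move=> mY Y1.
have b1 := bmeas_Re_spow (c * v) false i k mX mY X1 Y1.
have b2 := bmeas_Re_spow (c * v^*) true i k mX mY X1 Y1.
rewrite -(meanD P b1 b2) -(meanZ P _ (bmeasD b1 b2)); congr (mean P _); apply/funext => z.
rewrite [LHS]mulrC ReRe_mul /spow -(conj_unimodular (X1 z)).
congr (_ * (Re _ + Re _)); first by ring.
by rewrite rmorphM rmorphXn; ring.
Qed.

(** By moments_determine each conditional expectation is a comparison of
    moments. The mean of X^(-1) T^k is lam for k = 1 and 0 otherwise; that of
    X^(-2) T^k is second_moment for k = 1, lam^2 for k = 2, and 0 otherwise.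
    These are the moments against X^k of the functions on the right-hand sides,
    and the means of X^i T^k with i > 0 vanish on both sides. *)
Theorem inner_circle_system :
  modulus lam < 1 -> circle_system P T X lam^*%C second_moment^*%C.
Proof.
move=> lam1; move: second_momentE second_moment_le1.
move: second_moment => a2 a2E a2le.
have bX v i : bmeas (fun z => Re (v * X z ^+ i)).
  by have := bXX v false i 0; under eq_fun do rewrite expr0 mulr1.
have pT i k w : (0 < i + k)%N -> mean P (fun z => Re (w * (X z ^+ i * T z ^+ k))) = 0.
  exact: (moment_pos df f1 f0 mT T1 fT).
have pX i k w : (0 < i + k)%N -> mean P (fun z => Re (w * (X z ^+ i * X z ^+ k))) = 0.
  move=> ik; have := fourier 0 (i + k) w; rewrite eq_sym gtn_eqF// => <-.
  by congr (mean P _); apply/funext => z; rewrite expr0 mul1r exprD.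
have nT0 i w : (0 < i)%N -> mean P (fun z => Re (w * ((X z)^-1 ^+ i * T z ^+ 0))) = 0.
  by move=> i0; have := fourier i 0 w; rewrite gtn_eqF.
split.
- exact: mT.
- by apply: measurableT_comp mX; exact: measurable_Re.
- by apply: measurableT_comp mX; exact: measurable_Im.
- exact: X1.
- by rewrite modulus_conj.
- by rewrite modulus_conj; exact: a2le.
- move=> g bg.
  have b1 := bmeas_cst (complex_complex__canonical__measurable_structure_Measurable R) (1 : R).
  have mom c k : mean P (fun z => cst 1 z * Re (c * T z ^+ k)) =
      mean P (fun z => cst 1 z * Re (c * X z ^+ k)).
    case: k => [|k]; first by [].
    transitivity (0 : R); last rewrite -(pX 0 k.+1 c isT); rewrite -?(pT 0 k.+1 c isT);
      by congr (mean P _); apply/funext => z; rewrite expr0 !mul1r.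
  have := moments_determine b1 b1 mom bg.
  have e (h : R[i] -> R) : (fun z => cst 1 z * h z) = h by apply/funext => z; rewrite /= mul1r.
  by rewrite (e (fun z => g (T z))) (e g).
- move=> g v bg.
  have bF1 := bX v 1; have bF2 := bX (v * lam^*%C) 1.
  have mom c k : mean P (fun z => Re (v * X z ^+ 1) * Re (c * T z ^+ k)) =
      mean P (fun z => Re (v * lam^*%C * X z ^+ 1) * Re (c * X z ^+ k)).
    rewrite (mean_prod v c 1 k mT T1) (mean_prod (v * lam^*%C) c 1 k mX X1).
    rewrite (pT 1%N k (c * v) isT) (pX 1%N k (c * (v * lam^*%C)) isT) fourier; congr (_ * (_ + _)).
    case: k => [|k]; first by rewrite nT0.
    rewrite (@moment_neg R f df f1 f0 T mT T1 fT lam 1 k (c * v^*%C) hl) //.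
    case: k => [|k] /=; last by rewrite mulr0 mulr0.
    rewrite mulr1 expr1 -mulrA; congr (Re (_ * _)); exact/esym/conj_mulJ.
  rewrite (moments_determine bF1 bF2 mom bg).
  by congr (mean P _); apply/funext => z; rewrite mulrA.
- move=> g v bg.
  have b2 := bX (v * a2^*%C) 1; have b3 := bX (v * lam^*%C ^+ 2) 2.
  have bF1 := bX v 2; have bF2 := bmeasD b2 b3.
  have mom c k : mean P (fun z => Re (v * X z ^+ 2) * Re (c * T z ^+ k)) =
      mean P (fun z => (Re (v * a2^*%C * X z ^+ 1) + Re (v * lam^*%C ^+ 2 * X z ^+ 2)) *
        Re (c * X z ^+ k)).
    rewrite (mean_prod v c 2 k mT T1) (pT 2 k (c * v) isT).
    have -> : (fun z => (Re (v * a2^*%C * X z ^+ 1) + Re (v * lam^*%C ^+ 2 * X z ^+ 2)) *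
        Re (c * X z ^+ k)) = fun z => Re (v * a2^*%C * X z ^+ 1) * Re (c * X z ^+ k) +
        Re (v * lam^*%C ^+ 2 * X z ^+ 2) * Re (c * X z ^+ k).
      by apply/funext => z; rewrite mulrDl.
    rewrite (meanD P (bmeasM b2 (bX c k)) (bmeasM b3 (bX c k))).
    rewrite (mean_prod (v * a2^*%C) c 1 k mX X1) (mean_prod (v * lam^*%C ^+ 2) c 2 k mX X1).
    rewrite (pX 1%N k (c * (v * a2^*%C)) isT) (pX 2 k (c * (v * lam^*%C ^+ 2)) isT).
    rewrite !fourier !add0r -mulrDr; congr (_ * _).
    case: k => [|[|k]]; first by rewrite nT0 //= addr0.
    + have := a2E (c * v^*%C); rewrite /spow => -> /=.
      rewrite addr0 -mulrA; congr (Re (_ * _)); exact/esym/conj_mulJ.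
    + rewrite (@moment_neg R f df f1 f0 T mT T1 fT lam 2 k (c * v^*%C) hl) //= add0r.
      case: k => [|k] /=; last by rewrite mulr0 mulr0.
      rewrite mulr1 -rmorphXn -mulrA; congr (Re (_ * _)); exact/esym/conj_mulJ.
  rewrite (moments_determine bF1 bF2 mom bg).
  by congr (mean P _); apply/funext => z; rewrite -Re_add mulrDr !mulrA.
Qed.

End inner_circle_system.

(** * Boundary maps defined almost everywhere *)

Section nonmeasurable_integrand.
Context {d} {Om : measurableType d} {R : realType} (mu : {measure set Om -> \bar R}).
Local Open Scope ereal_scope.

Lemma ge0_integral_mono (f g : Om -> \bar R) : (forall x, 0 <= f x) ->
  (forall x, f x <= g x) -> \int[mu]_x f x <= \int[mu]_x g x.
Proof.
move=> f0 fg; have g0 x : 0 <= g x by exact: le_trans (fg x).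
rewrite !ge0_integralTE//; apply: ereal_sup_le => _ [h hf <-].
by exists h => // x; exact: le_trans (fg x).
Qed.

(** The integral of a nonnegative function is a supremum over simple functions
    below it, hence monotone, and f is squeezed between two measurable
    modifications of g on the null set. This applies to weighted sums, as the
    boundary map is arbitrary off a set of full measure. *)
Lemma ge0_integral_ae (f g : Om -> \bar R) : (forall x, 0 <= f x) -> (forall x, 0 <= g x) ->
  measurable_fun setT g -> {ae mu, forall x, f x = g x} -> \int[mu]_x f x = \int[mu]_x g x.
Proof.
move=> f0 g0 mg [N [mN N0 fgN]].
have mb : measurable_fun setT (fun x => x \in N).
  by apply: (measurable_fun_bool true); rewrite setTI preimage_mem_true.
have off (h : Om -> \bar R) : (forall x, 0 <= h x) -> measurable_fun setT h ->
    (forall x, ~ N x -> h x = g x) -> \int[mu]_x h x = \int[mu]_x g x.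
  move=> h0 mh hg; apply: ge0_ae_eq_integral => //.
  exists N; split => // x /= hx; apply: contrapT => Nx; apply: hx => _.
  exact: hg.
have eqfg x : ~ N x -> f x = g x by move=> Nx; apply: contrapT => fgx; apply: Nx; exact: fgN.
apply/eqP; rewrite eq_le; apply/andP; split.
  rewrite -(off (fun x => if x \in N then +oo else g x)).
  - apply: ge0_integral_mono => // x; case: ifPn => [_|/negP Nx]; first exact: leey.
    by rewrite eqfg// => ?; apply: Nx; exact: mem_set.
  - by move=> x; case: ifP.
  - by apply: measurable_fun_ifT.
  - by move=> x Nx; rewrite memNset.
rewrite -(off (fun x => if x \in N then 0 else g x)).
- apply: ge0_integral_mono => x; first by case: ifP.
  by case: ifPn => // /negP Nx; rewrite eqfg// => ?; apply: Nx; exact: mem_set.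
- by move=> x; case: ifP.
- by apply: measurable_fun_ifT.
- by move=> x Nx; rewrite memNset.
Qed.

End nonmeasurable_integrand.

Lemma sigma2_mean (R : realType) (f : R[i] -> R[i]) (b : nat -> R[i]) N (S : R[i] -> R[i]) :
  bmeas (fun z => modulus (S z) ^+ 2) ->
  {ae circle_measure R, forall z, weighted_sum f b N z = S z} ->
  sigma2 f b N = mean (circle_measure R) (fun z => modulus (S z) ^+ 2).
Proof.
move=> bS WS; rewrite /sigma2 unlock.
have sq (z : R[i]) : (`| (modulus z)%:E | `^ 2 = (modulus z ^+ 2)%:E)%E.
  by rewrite /= ger0_norm ?modulus_ge0// powR_mulrn// modulus_ge0.
under eq_integral do rewrite sq.
rewrite (@ge0_integral_ae _ _ _ _ _ (fun z => (modulus (S z) ^+ 2)%:E)); first last.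
- by apply: filterS WS => z ->.
- by apply/measurable_EFinP; case: bS.
- by move=> z; rewrite lee_fin sqr_ge0.
- by move=> z; rewrite lee_fin sqr_ge0.
have fin : (\int[circle_measure R]_z (modulus (S z) ^+ 2)%:E =
    (mean (circle_measure R) (fun z => modulus (S z) ^+ 2))%:E)%E.
  rewrite /mean /Rintegral fineK//.
  by apply: integrable_fin_num => //; exact: bmeas_integrable.
have m0 : 0 <= mean (circle_measure R) (fun z => modulus (S z) ^+ 2).
  by apply: mean_ge0 => z; exact: sqr_ge0.
by rewrite fin poweR_EFin /= powR12_sqrt// sqr_sqrtr.
Qed.

Section boundary_map.
Variables (R : realType) (f : R[i] -> R[i]).
Local Notation P := (circle_measure R).
Local Notation X := (@circle_retract R).

Lemma radii_at_left : radii R n @[n --> \oo] --> (1 : R)^'-.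
Proof.
move=> A /= [e /= e0 hA]; have h := @radii_cvg R.
have h' : \forall n \near \oo, `|1 - radii R n| < e by move/cvgrPdist_lt : h; apply.
have : \forall n \near \oo, A (radii R n); last by [].
near=> n; apply: hA; first by near: n.
by have /andP[_] := radii01 R n.
Unshelve. all: by end_near. Qed.

Hypothesis f_disc : forall z : R[i], `|z| < 1 -> `|f z| < 1.
Hypothesis f_inner : inner_function f.
Hypothesis f0 : f 0 = 0.
Hypothesis f_nrot : ~ rotation f.

Let df z : modulus z < 1 -> cdiff f z.
Proof. by move=> z1; apply: derivable_cdiff; case: f_inner => h _ _; apply: h; rewrite norm_lt1. Qed.

Let f1 z : modulus z < 1 -> modulus (f z) < 1.
Proof. by rewrite -!norm_lt1; exact: f_disc. Qed.

(** Radial limits exist off a null set, which lies in a Borel null set N. There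
    T is given the value 1, and elsewhere it is a pointwise limit of Borel
    functions. *)
Lemma borel_boundary_map : exists (T : R[i] -> R[i]) (N : set R[i]),
  [/\ measurable_fun setT T, forall z, modulus (T z) = 1, measurable N, P N = 0%E &
   forall z, ~ N z -> [/\ modulus z = 1, T z = boundary_map f z &
     f ((radii R n)%:C * X z) @[n --> \oo] --> T z]].
Proof.
have [_ _ [N1 [mN1 PN1 hN1]]] := f_inner.
have [N2 [mN2 PN2 hN2]] := @ae_circle R.
pose N := N1 `|` N2; have mN : measurable N by exact: measurableU.
have PN : P N = 0%E by apply: null_set_setU.
have mb : measurable_fun setT (fun z => z \in N).
  by apply: (measurable_fun_bool true); rewrite setTI preimage_mem_true.
have off z : ~ N z -> [/\ modulus z = 1, cvg (f (r%:C * z) @[r --> (1 : R)^'-]) & modulus (boundary_map f z) = 1].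
  move=> Nz; have z1 : modulus z = 1.
    by apply: contrapT => z1; apply: Nz; right; exact: hN2.
  have [h1 h2] : cvg (f (r%:C * z) @[r --> (1 : R)^'-]) /\ `|boundary_map f z| = 1.
    by apply: contrapT => h; apply: Nz; left; exact: hN1.
  by split => //; exact/norm_eq1.
pose T z := if z \in N then 1 else boundary_map f z.
have TN z : ~ N z -> T z = boundary_map f z by move=> Nz; rewrite /T memNset.
have lim z : ~ N z -> f ((radii R n)%:C * X z) @[n --> \oo] --> T z.
  move=> Nz; have [z1 cz _] := off z Nz; rewrite (circle_retract_id z1) (TN z Nz).
  exact: (cvg_comp _ _ radii_at_left cz).
have tf v : tame (fun z => v * f z).
  apply: tame_scale; have := @tame_spow R f df f1 false 0 1.
  by under eq_fun do rewrite /spow expr0 expr1 mul1r.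
have mlim v : measurable_fun setT (fun z => Re (v * T z)).
  pose u n z := if z \in N then Re v else Re (v * f ((radii R n)%:C * X z)).
  apply: (@measurable_fun_cvg _ _ _ _ u) => [n|z _].
    apply: measurable_fun_ifT => //.
    by have [] := bmeas_section (tf v) (radii01 R n).
  rewrite /u; case: (boolP (z \in N)) => Nz.
    by rewrite /T Nz mulr1; exact: cvg_cst.
  have Nz' : ~ N z by move=> h; move/negP : Nz; apply; exact: mem_set.
  have c : (fun w => Re (v * w)) @ T z --> Re (v * T z) by exact: continuous_Re_scale.
  exact: (cvg_comp _ _ (lim z Nz') c).
exists T, N; split => //.
- apply: measurable_complex_fun.
    by have := mlim 1; under eq_fun do rewrite mul1r.
  by have := mlim (- 'i); under eq_fun do rewrite Re_mulNi.
- move=> z; rewrite /T; case: (boolP (z \in N)) => Nz; first exact: modulus1.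
  by have [] := off z => // h; move/negP : Nz; apply; exact: mem_set.
- by move=> z Nz; split; [case: (off z Nz)|exact: TN|exact: lim].
Qed.

End boundary_map.

Unset Implicit Arguments.
Set Strict Implicit.

(* The sequence of the conclusion is indexed by N.+1, so that it ranges over
   the indices N >= 1. *)
Theorem theorem2p1 (R : realType) (f : R[i] -> R[i]) (b : nat -> R[i])
  (f_disc : forall z : R[i], `|z| < 1 -> `|f z| < 1)
  (f_inner : inner_function f)
  (f0 : f 0 = 0)
  (f_nrot : ~ rotation f)
  (B_infty : sqnorm_sum b N @[N --> \oo] --> +oo)
  (b_small : sqnorm_max b N * L (L (sqnorm_sum b N)) / sqnorm_sum b N
    @[N --> \oo] --> (0 : R)) :
  {ae circle_measure R, forall z : R[i],
    subsequential_limits (fun N : nat =>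
      weighted_sum f b N.+1 z /
        (Num.sqrt (sigma2 f b N.+1 * L (L (sigma2 f b N.+1))))%:C)
    = [set w : R[i] | `|w| <= 1]}.
Proof.
pose P := circle_measure R; pose X := @circle_retract R.
have df z : modulus z < 1 -> cdiff f z.
  by move=> z1; apply: derivable_cdiff; case: f_inner => h _ _; apply: h; rewrite norm_lt1.
have f1 z : modulus z < 1 -> modulus (f z) < 1 by rewrite -!norm_lt1; exact: f_disc.
have [T [N [mT T1 mN PN hN]]] := borel_boundary_map f_disc f_inner.
have aeN : {ae P, forall z, ~ N z}.
  by exists N; split => // z /= h; apply: contrapT.
have fT : {ae P, forall z, f ((radii R n)%:C * X z) @[n --> \oo] --> T z}.
  by apply: filterS aeN => z /hN[].
have [lam hl] := lim0_quotient df f0.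
have lam1 : modulus lam < 1.
  apply: (multiplier_lt1 df f1 f0 hl) => -[c c1 hc]; apply: f_nrot; exists c; first exact/norm_eq1.
  by move=> z; rewrite norm_lt1; exact: hc.
have cs := inner_circle_system df f1 f0 mT T1 fT hl lam1.
(* T preserves the measure, so almost every orbit avoids N altogether, and on
   such orbits T and the boundary map agree. *)
have aeNj : {ae P, forall z, forall j, ~ N (iter j T z)}.
  apply: ae_forall_count => j.
  have mNj : measurable ((fun z => iter j T z) @^-1` N).
    by rewrite -[X in measurable X]setTI; apply: (measurable_iter cs).
  exists ((fun z => iter j T z) @^-1` N); split => //; last by move=> z /= h; apply: contrapT.
  transitivity (mean P \1_((fun z => iter j T z) @^-1` N))%:E; first exact: (mean_indic P mNj).
  have -> : mean P \1_((fun z => iter j T z) @^-1` N) = mean P (fun z => \1_N (iter j T z)).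
    by congr (mean P _); apply/funext => z; rewrite !indicE.
  rewrite (mean_iter cs j (bmeas_indic R mN)).
  by transitivity (P N); first exact/esym/(mean_indic P mN).
have orbit z : (forall j, ~ N (iter j T z)) -> forall M, weighted_sum f b M z = orbit_sum T X b M z.
  move=> Nz M; rewrite /weighted_sum /orbit_sum; apply: eq_big_nat => j _.
  have -> : iter j (boundary_map f) z = iter j T z.
    by elim: j => [//|j IH]; rewrite !iterS IH; have [_ -> _] := hN _ (Nz j).
  by rewrite /X circle_retract_id//; have [] := hN _ (Nz j).
(* This is where the L^2 norm, defined through the boundary map, is replaced by
   the mean for the Borel version T. *)
have sE M : sigma2 f b M = mean P (fun z => modulus (orbit_sum T X b M z) ^+ 2).
  apply: sigma2_mean; last by apply: filterS aeNj => z /orbit.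
  have bR v : bmeas (fun z => Re (v * orbit_sum T X b M z)).
    have -> : (fun z => Re (v * orbit_sum T X b M z)) =
        fun z => \sum_(0 <= j < M) Re (v * b j * X (iter j T z)).
      apply/funext => z; rewrite /orbit_sum mulr_sumr (big_morph _ (@Re_add R) (erefl : Re 0 = 0)).
      by apply: eq_bigr => j _; rewrite mulrA.
    by apply: bmeas_sum => j; exact: (bmeas_iter cs j (bmeas_ReX cs (v * b j))).
  have -> : (fun z => modulus (orbit_sum T X b M z) ^+ 2) = fun z =>
      Re (1 * orbit_sum T X b M z) * Re (1 * orbit_sum T X b M z) +
      Re (- 'i * orbit_sum T X b M z) * Re (- 'i * orbit_sum T X b M z).
    by apply/funext => z; rewrite modulus_sqr mul1r Re_mulNi !expr2.
  by apply: bmeasD; apply: bmeasM.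
apply: filterS2 aeNj (circle_system_lil cs B_infty b_small) => z Nz <-.
congr subsequential_limits; apply/funext => M.
by rewrite orbit// sE.
Qed.
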